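(* Let $\mathbb{G}$ be a stratified Lie group of homogeneous dimension $Q$, let $1<p\leq Q$, and let $\Omega\subset\mathbb{G}$ be an admissible domain. Let $F:\Omega\times\mathbb{R}\to\mathbb{R}$ satisfy: (a) $F$ is a positive, bounded and measurable function and there exists a constant $C>0$ such that $F(x,\rho)\leq C(\rho^{p-1}+1)$ for all $\rho>0$ and a.e. $x\in\Omega$; (b) the function $\rho\mapsto\frac{F(x,\rho)}{\rho^{p-1}}$ is strictly decreasing on $(0,\infty)$ for a.e. $x\in\Omega$. Then there exists at most one positive weak solution to the problem $$-\mathcal{L}_{p}u=F(x,u)\ \text{ in }\Omega,\qquad u=0\ \text{ on }\partial\Omega .$$
   Context: Stratified Lie group: a Lie group $\mathbb{G}=(\mathbb{R}^{N},\circ)$ such that (i) for some natural numbers $N_{1}+\dots+N_{r}=N$, writing $\mathbb{R}^{N}=\mathbb{R}^{N_1}\times\dots\times\mathbb{R}^{N_r}$, $x=(x^{(1)},\dots,x^{(r)})$, for every $\lambda>0$ the dilation $\delta_\lambda(x)=(\lambda x^{(1)},\dots,\lambda^{r}x^{(r)})$ is an automorphism of $\mathbb{G}$; (ii) if $X_1,\dots,X_{N_1}$ are the left invariant vector fields with $X_k(0)=\frac{\partial}{\partial x_k}|_0$, $k=1,\dots,N_1$, then the iterated commutators of $X_1,\dots,X_{N_1}$ span the Lie algebra of $\mathbb{G}$, i.e. $\operatorname{rank}(\operatorname{Lie}\{X_1,\dots,X_{N_1}\})=N$ at every point. The homogeneous dimension is $Q=\sum_{k=1}^{r}kN_k$.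 The horizontal gradient is $\nabla_{\mathbb{G}}=(X_1,\dots,X_{N_1})$; $d\nu=dx$ is Lebesgue measure on $\mathbb{R}^N$ (the Haar measure of $\mathbb{G}$). $u\in C^1(\Omega)$ means $\nabla_{\mathbb{G}}u\in C(\Omega)$. Admissible domain: an open set $\Omega\subset\mathbb{G}$ which is bounded and whose boundary $\partial\Omega$ is piecewise smooth and simple (no self-intersections). $\overset{\circ}{S}{}^{1,p}(\Omega)$ is the completion of $C^1_0(\Omega)$ (real-valued, compactly supported) in the norm $J_p(u)=\left(\int_\Omega|\nabla_{\mathbb{G}}u|^p\,dx\right)^{1/p}$. The $p$-sub-Laplacian is $\mathcal{L}_{p}f=\nabla_{\mathbb{G}}\cdot(|\nabla_{\mathbb{G}}f|^{p-2}\nabla_{\mathbb{G}}f)$. A weak solution of the problem is a function $u\in\overset{\circ}{S}{}^{1,p}(\Omega)\cap L^\infty(\Omega)$ such that $$\int_\Omega|\nabla_{\mathbb{G}}u|^{p-2}(\widetilde\nabla u)\phi\,d\nu=\int_\Omega F(x,u)\phi\,d\nu\quad\text{for all }\phi\in C_0^\infty(\Omega),$$ where $\widetilde\nabla u=\sum_{k=1}^{N_1}(X_ku)X_k$, so that $(\widetilde\nabla u)\phi=\nabla_{\mathbb{G}}u\cdot\nabla_{\mathbb{G}}\phi$. *)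

(* Defs.v *)
From HB Require Import structures.
From mathcomp Require Import all_boot all_order all_algebra.
From mathcomp Require Import all_classical all_reals all_analysis.
From mathcomp Require Import measurable_realfun.
Set Implicit Arguments.
Unset Strict Implicit.
Unset Printing Implicit Defensive.
Import Order.TTheory GRing.Theory Num.Theory.
Import numFieldNormedType.Exports.
Local Open Scope classical_set_scope.
Local Open Scope ring_scope.

Section BorelRow.
Context (R : realType) (n : nat).
Let V := 'rV[R]_n.
Definition borel_rV : set (set V) := <<s @open V >>.
Let borel0 : borel_rV set0. Proof. exact: sigma_algebra0. Qed.
Let borelC A : borel_rV A -> borel_rV (~` A).
Proof. exact: sigma_algebraC. Qed.
Let borelU (F : _^nat) : (forall i, borel_rV (F i)) ->
  borel_rV (\bigcup_i F i).
Proof. exact: sigma_algebra_bigcup. Qed.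
HB.instance Definition _ := @isMeasurable.Build (sigma_display (@open V))
  'rV[R]_n borel_rV borel0 borelC borelU.
End BorelRow.

Definition row_of_tuple (R : realType) (n : nat)
  (t : n.-tuple (measurableTypeR R)) : 'rV[R]_n := \row_i tnth t i.

Lemma measurable_row_of_tuple (R : realType) (n : nat) :
  measurable_fun setT (@row_of_tuple R n).
Proof.
apply: (measurability (@open 'rV[R]_n)) => // _ [U oU <-]; rewrite setTI.
pose B (qk : n.-tuple rat * rat) : set 'rV[R]_n :=
  [set y | forall i, `|ratr (tnth qk.1 i) - y ord0 i| < ratr qk.2].
have -> : U = \bigcup_(qk in [set qk | B qk `<=` U]) B qk.
  apply/seteqP; split; last by move=> y [qk /= + ?]; exact.
  move=> x Ux.
  have /nbhs_ballP[e /= e0 eU] : nbhs x U by exact: open_nbhs_nbhs.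
  have [k /itvP k_e] := rat_in_itvoo (divr_gt0 e0 (ltr0n R 2)).
  have hq i : {q : rat | `|ratr q - x ord0 i| < ratr k}.
    apply: cid; have /rat_in_itvoo[q] : x ord0 i < x ord0 i + ratr k.
      by rewrite ltrDl k_e.
    rewrite in_itv/= => /andP[xq qk]; exists q.
    by rewrite ger0_norm ?subr_ge0 1?ltW// ltrBlDl.
  exists ([tuple sval (hq i) | i < n], k) => /=; last first.
    by move=> i /=; rewrite tnth_mktuple; exact: (svalP (hq i)).
  move=> y /= By; apply: eU; split => // i j; rewrite ord1 /ball/=.
  have := By j; rewrite tnth_mktuple => yj.
  have xj := svalP (hq j).
  rewrite (le_lt_trans (ler_distD (ratr (sval (hq j))) _ _))//.
  rewrite (splitr e) ltrD//; last by rewrite (lt_trans yj) ?k_e.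
  by rewrite distrC (lt_trans xj) ?k_e.
rewrite preimage_bigcup bigcup_mkcond.
apply: countable_bigcupT_measurable => // qk; case: ifPn => // _.
rewrite [X in measurable X](_ : _ = \bigcap_(i in [set: 'I_n])
    ((fun t => tnth t i) @^-1`
      [set s : measurableTypeR R | `|ratr (tnth qk.1 i) - s| < ratr qk.2])); last first.
  by apply/seteqP; split => t /= + i; move=> /(_ i); [move=> + _|move=> /(_ I)];
    rewrite /= mxE.
apply: fin_bigcap_measurable => // i _; rewrite -[X in measurable X]setTI.
apply: measurable_tnth => //.
rewrite (_ : [set s | _] = @ball _ R (ratr (tnth qk.1 i)) (ratr qk.2))//.
exact: measurable_ball.
Qed.

Section LebesgueTuple.
Context (R : realType).
Notation mR := (measurableTypeR R).
Notation leb1 := (@lebesgue_measure R).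

Definition tcons n (z : mR * n.-tuple mR) : n.+1.-tuple mR :=
  [the n.+1.-tuple mR of z.1 :: z.2].

Lemma measurable_tcons n : measurable_fun setT (@tcons n).
Proof. exact: (measurable_cons measurable_fst measurable_snd). Qed.

Definition tuncons n (t : n.+1.-tuple mR) : mR * n.-tuple mR :=
  (thead t, [tuple of behead t]).

Lemma measurable_tuncons n : measurable_fun setT (@tuncons n).
Proof.
apply/measurable_fun_pairP; split; last exact: measurable_behead.
exact: (measurable_tnth ord0).
Qed.

Section inst.
Variables (n : nat) (m : {sigma_finite_measure set (n.-tuple mR) -> \bar R}).

Definition cons_measure : set (n.+1.-tuple mR) -> \bar R :=
  pushforward (leb1 \x m)%E (@tcons n).

Let cons0 : cons_measure set0 = 0%E.
Proof. by rewrite /cons_measure /pushforward preimage_set0 measure0. Qed.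

Let cons_ge0 A : (0 <= cons_measure A)%E.
Proof. by rewrite ?/cons_measure ?/lebesgue_rV /pushforward measure_ge0. Qed.

Let cons_sigma_additive : semi_sigma_additive cons_measure.
Proof.
move=> F mF tF mUF; rewrite /cons_measure /pushforward preimage_bigcup.
have mp A : measurable A -> measurable (@tcons n @^-1` A).
  by move=> mA; rewrite -[X in measurable X]setTI; exact: measurable_tcons.
apply: measure_semi_sigma_additive; first by move=> i; exact: mp.
- apply/trivIsetP => /= i j _ _ ij; rewrite -preimage_setI.
  by move/trivIsetP : tF => /(_ _ _ _ _ ij) ->//; rewrite preimage_set0.
- by rewrite -preimage_bigcup; exact: mp.
Qed.

HB.instance Definition _ := isMeasure.Build _ _ _ cons_measure
  cons0 cons_ge0 cons_sigma_additive.

Let cons_sigma_finite : sigma_finite setT cons_measure.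
Proof.
have [F FT mF] : sigma_finite setT (leb1 \x m)%E.
  have /sigma_finiteP[F [TF ndF Foo]] := sigma_finiteT leb1.
  have /sigma_finiteP[G [TG ndG Goo]] := sigma_finiteT m.
  exists (fun k => F k `*` G k).
    rewrite -setXTT TF TG predeqE => -[x y]; split.
      move=> [/= [i _ Fx] [j _ Gy]]; exists (maxn i j) => //; split.
      - by move: x Fx; exact/subsetPset/ndF/leq_maxl.
      - by move: y Gy; exact/subsetPset/ndG/leq_maxr.
    by move=> [i _ []/= ? ?]; split; exists i.
  move=> k; have [? ?] := Foo k; have [? ?] := Goo k.
  split; first exact: measurableX.
  by rewrite product_measure1E// lte_mul_pinfty// ge0_fin_numE.
have tK : cancel (@tcons n) (@tuncons n).
  by move=> [a t]; rewrite /tcons /tuncons theadE; congr pair; exact/val_inj.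
have tK' : cancel (@tuncons n) (@tcons n).
  by move=> t; rewrite [RHS]tuple_eta.
exists (fun k => @tuncons n @^-1` F k).
  by rewrite -preimage_bigcup -FT preimage_setT.
move=> k; have [mFk Fk] := mF k; split.
  by rewrite -[X in measurable X]setTI; exact: measurable_tuncons.
rewrite /cons_measure /pushforward (_ : _ @^-1` _ = F k)//.
by apply/seteqP; split => z /=; rewrite tK.
Qed.

HB.instance Definition _ := Measure_isSigmaFinite.Build _ _ _ cons_measure
  cons_sigma_finite.

End inst.

Fixpoint lebesgue_tuple n :
    {sigma_finite_measure set (n.-tuple mR) -> \bar R} :=
  if n is k.+1 then cons_measure (lebesgue_tuple k)
  else \d_([tuple] : 0.-tuple mR).

(* Lebesgue measure on R^n: transported from the n-fold iterated product of the
   one-dimensional Lebesgue measure. *)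
Definition lebesgue_rV n : set 'rV[R]_n -> \bar R :=
  pushforward (lebesgue_tuple n) (@row_of_tuple R n).

Section rVinst.
Variable n : nat.
Notation mu := (@lebesgue_rV n).
Let rV0 : mu set0 = 0%E.
Proof. by rewrite /lebesgue_rV /pushforward preimage_set0 measure0. Qed.

Let rV_ge0 A : (0 <= mu A)%E.
Proof. by rewrite ?/cons_measure ?/lebesgue_rV /pushforward measure_ge0. Qed.

Let rV_sigma_additive : semi_sigma_additive mu.
Proof.
move=> F mF tF mUF; rewrite /lebesgue_rV /pushforward preimage_bigcup.
have mp A : measurable A -> measurable (@row_of_tuple R n @^-1` A).
  by move=> mA; rewrite -[X in measurable X]setTI; exact: measurable_row_of_tuple.
apply: measure_semi_sigma_additive; first by move=> i; exact: mp.
- apply/trivIsetP => /= i j _ _ ij; rewrite -preimage_setI.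
  by move/trivIsetP : tF => /(_ _ _ _ _ ij) ->//; rewrite preimage_set0.
- by rewrite -preimage_bigcup; exact: mp.
Qed.

HB.instance Definition _ := isMeasure.Build _ _ _ mu
  rV0 rV_ge0 rV_sigma_additive.
End rVinst.
End LebesgueTuple.

Section Smooth.
Context (R : realType) (V W : normedModType R).

(* On finite-dimensional V this is the usual class C^n. *)
Fixpoint Cn (n : nat) (f : V -> W) : Prop :=
  if n is m.+1 then
    continuous f /\
    forall v : V, (forall x, derivable f x v) /\ Cn m (fun x => 'D_v f x)
  else continuous f.

Definition smooth (f : V -> W) := forall n, Cn n f.
End Smooth.

Section VectorFields.
Context (R : realType) (n : nat).
Notation V := 'rV[R]_n.

Definition lie_bracket (X Y : V -> V) : V -> V :=
  fun x => 'D_(X x) Y x - 'D_(Y x) X x.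

Inductive iterated_commutator (m : nat) (X : 'I_m -> V -> V) :
    (V -> V) -> Prop :=
| ic_gen k : iterated_commutator X (X k)
| ic_bracket Y Z : iterated_commutator X Y -> iterated_commutator X Z ->
    iterated_commutator X (lie_bracket Y Z).

Definition lie_rank_full (m : nat) (X : 'I_m -> V -> V) (x : V) :=
  exists Y : 'I_n -> V -> V, (forall i, iterated_commutator X (Y i)) /\
    \rank (\matrix_(i < n) Y i x) = n.

Definition integral_curve (X : V -> V) (x : V) (gam : R -> V) :=
  gam 0 = x /\ forall t : R, is_derive t (1 : R) gam (X (gam t)).

(* The fields used below are complete, and integral curves are unique. *)
Definition flow (X : V -> V) (x : V) : R -> V := get (integral_curve X x).

(* X acts on functions by differentiation along its integral curves; for an
   (Euclidean) C^1 function u, lie_derive X u x is 'D_(X x) u x. *)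
Definition lie_derivable (X : V -> V) (u : V -> R) (x : V) :=
  derivable (u \o flow X x) 0 1.
Definition lie_derive (X : V -> V) (u : V -> R) (x : V) : R :=
  'D_1 (u \o flow X x) 0.

Definition enorm (v : V) : R := Num.sqrt (\sum_i v ord0 i ^+ 2).
Definition dotv (v w : V) : R := \sum_i v ord0 i * w ord0 i.
End VectorFields.

Definition gdim (r : nat) (Ns : 'I_r.+1 -> nat) : nat := (\sum_k Ns k)%N.

Section Dilation.
Context (R : realType) (r : nat) (Ns : 'I_r.+1 -> nat).

(* Layers are numbered from 0 here, so layer k is scaled by l ^+ k.+1. *)
Definition dilation (l : R) (x : 'rV[R]_(gdim Ns)) : 'rV[R]_(gdim Ns) :=
  \mxrow_(k < r.+1) (l ^+ k.+1 *: submxrow x k).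

Definition first_layer_basis (j : 'I_(Ns ord0)) : 'rV[R]_(gdim Ns) :=
  delta_mx ord0 (tagnat.Rank ord0 j).
End Dilation.

Definition left_invariant_field (R : realType) (n : nat)
    (op : 'rV[R]_n -> 'rV[R]_n -> 'rV[R]_n) (v : 'rV[R]_n) :
  'rV[R]_n -> 'rV[R]_n := fun x => 'D_v (op x) 0.

(* The dilations being automorphisms, they fix the neutral element, which is
   therefore 0. *)
Record stratified_group (R : realType) (r : nat) (Ns : 'I_r.+1 -> nat) :=
  StratifiedGroup {
  gop : 'rV[R]_(gdim Ns) -> 'rV[R]_(gdim Ns) -> 'rV[R]_(gdim Ns);
  ginv : 'rV[R]_(gdim Ns) -> 'rV[R]_(gdim Ns);
  gopA : associative gop;
  gop0x : left_id 0 gop;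
  gopx0 : right_id 0 gop;
  gopVx : left_inverse 0 ginv gop;
  gopxV : right_inverse 0 ginv gop;
  gop_smooth : smooth
    (fun z : ('rV[R]_(gdim Ns) * 'rV[R]_(gdim Ns))%type => gop z.1 z.2);
  ginv_smooth : smooth ginv;
  layer_gt0 : forall k, (0 < Ns k)%N;
  dilation_morph : forall l : R, 0 < l ->
    {morph dilation l : x y / gop x y};
  hormander : forall x,
    lie_rank_full
      (fun j => left_invariant_field gop (first_layer_basis R j)) x
}.

Definition homogeneous_dim (r : nat) (Ns : 'I_r.+1 -> nat) : nat :=
  (\sum_(k < r.+1) k.+1 * Ns k)%N.

Section AdmissibleDomain.
Context (R : realType) (n : nat).
Notation V := 'rV[R]_n.
Notation W := 'rV[R]_n.-1.

Definition bdry (A : set V) := closure A `\` interior A.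

Definition closed_cube : set W := [set t | forall i, 0 <= t ord0 i <= 1].
Definition open_cube : set W := [set t | forall i, 0 < t ord0 i < 1].

(* S is a finite union of smooth hypersurface patches parametrised by the
   (n-1)-cube, with pairwise disjoint interiors; the parametrisations may
   degenerate on the boundary of the cube (as at the apex of a cone). *)
Definition piecewise_smooth (S : set V) :=
  exists (m : nat) (sigma : 'I_m -> W -> V),
    [/\ forall i, smooth (sigma i),
        forall i, {in open_cube &, injective (sigma i)},
        forall i t, open_cube t -> \rank (jacobian (sigma i) t) = n.-1,
        forall i j, i != j ->
          sigma i @` open_cube `&` sigma j @` open_cube = set0
      & S = \bigcup_i (sigma i @` closed_cube)].

(* No self-intersections: S is locally homeomorphic to R^(n-1). *)
Definition simple_hypersurface (S : set V) :=
  forall x, S x -> exists (U : set V) (f : W -> V) (g : V -> W),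
    [/\ open U /\ U x, continuous f, {within S `&` U, continuous g},
        cancel f g & range f = S `&` U].

Definition admissible_domain (Om : set V) :=
  [/\ open Om, bounded_set Om, piecewise_smooth (bdry Om)
    & simple_hypersurface (bdry Om)].
End AdmissibleDomain.

Section Problem.
Context (R : realType) (r : nat) (Ns : 'I_r.+1 -> nat)
  (G : stratified_group R Ns).
Notation V := 'rV[R]_(gdim Ns).
Notation H := 'rV[R]_(Ns ord0).
Notation nu := (@lebesgue_rV R (gdim Ns)).

Definition Xfield (j : 'I_(Ns ord0)) : V -> V :=
  left_invariant_field (gop G) (first_layer_basis R j).

Definition hgrad (u : V -> R) (x : V) : H :=
  \row_j lie_derive (Xfield j) u x.

Definition compactly_supported (Om : set V) (u : V -> R) :=
  compact (closure [set x | u x != 0]) /\ closure [set x | u x != 0] `<=` Om.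

Definition C1c (Om : set V) (u : V -> R) :=
  [/\ compactly_supported Om u, continuous u,
      forall x j, Om x -> lie_derivable (Xfield j) u x
    & {within Om, continuous (hgrad u)}].

Definition Coo_c (Om : set V) (u : V -> R) :=
  smooth u /\ compactly_supported Om u.

Definition Lp_norm (p : R) (Om : set V) (f : V -> R) : \bar R :=
  ((\int[nu]_(x in Om) (`|f x| `^ p)%:E) `^ p^-1)%E.

Definition Jp (p : R) (Om : set V) (u : V -> R) : \bar R :=
  Lp_norm p Om (fun x => enorm (hgrad u x)).

(* u is an element of the completion of C^1_0(Om) for J_p, and g is its
   horizontal gradient.  An element of the completion is the class of a
   J_p-Cauchy sequence phi; Om being bounded, the Poincare inequality makes phi
   converge in L^p(Om), and the class is identified with the limit u, its
   gradient being the L^p limit of the gradients of the phi_k. *)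
Definition S0_1p (p : R) (Om : set V) (u : V -> R) (g : V -> H) :=
  [/\ measurable_fun Om (u : V -> measurableTypeR R), measurable_fun Om g
    & exists phi : nat -> V -> R,
      [/\ forall k, C1c Om (phi k),
          forall e : R, 0 < e -> exists K : nat, forall k l : nat,
            (K <= k)%N -> (K <= l)%N ->
            (Jp p Om (fun x => phi k x - phi l x)%R < e%:E)%E,
          Lp_norm p Om (fun x => u x - phi k x)%R @[k --> \oo] --> 0%E
        & Lp_norm p Om (fun x => enorm (g x - hgrad (phi k) x)%R) @[k --> \oo]
            --> 0%E]].

Definition Linfty (Om : set V) (u : V -> R) :=
  measurable_fun Om (u : V -> measurableTypeR R) /\
  exists M : R, {ae nu, forall x, Om x -> `|u x| <= M}.

Definition weak_solution (p : R) (Om : set V) (F : V -> R -> R)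
    (u : V -> R) :=
  Linfty Om u /\
  exists g : V -> H, S0_1p p Om u g /\
    forall phi, Coo_c Om phi ->
      (\int[nu]_(x in Om)
        (enorm (g x) `^ (p - 2) * dotv (g x) (hgrad phi x))%:E =
       \int[nu]_(x in Om) (F x (u x) * phi x)%:E)%E.

Definition positive_weak_solution (p : R) (Om : set V) (F : V -> R -> R)
    (u : V -> R) :=
  weak_solution p Om F u /\ {ae nu, forall x, Om x -> 0 < u x}.
End Problem.

(* Main.v *)
Require Import Defs.
From HB Require Import structures.
From mathcomp Require Import all_boot all_order all_algebra.
From mathcomp Require Import all_classical all_reals all_analysis.
From mathcomp Require Import measurable_realfun ring lra.
Set Implicit Arguments.
Unset Strict Implicit.
Unset Printing Implicit Defensive.
Import Order.TTheory GRing.Theory Num.Theory.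
Import numFieldNormedType.Exports.
Local Open Scope classical_set_scope.
Local Open Scope ring_scope.

(* Let U = u + e and V = v + e, with e > 0.  Test the equation of u with
   U - V^p U^(1-p) and that of v with V - U^p V^(1-p).  By Young's inequality
   (Picone's identity) the sum of the two left-hand sides is nonnegative, hence
     0 <= \int F(x,u) (U - V^p U^(1-p)) + F(x,v) (V - U^p V^(1-p)).
   As e -> 0 the integrand stays bounded above and tends to
   (F(x,u)/u^(p-1) - F(x,v)/v^(p-1)) (u^p - v^p), which is <= 0 by strict
   monotonicity and vanishes only where u = v; Fatou's lemma forces it to vanish
   almost everywhere.

   To make the test functions admissible, U and V are clamped (u and v are
   bounded) and u, v are replaced by C^1_0 approximants, which gives horizontally
   C^1 test functions with compact support.  These are mollified by left
   translations, which commute with the horizontal fields.  Homogeneity under the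
   dilations makes the group law triangular: (x o y)_i - x_i - y_i depends only on
   the coordinates of index less than i.  So left translations preserve Lebesgue
   measure, and the horizontal fields can be integrated coordinate by
   coordinate. *)

(** The shift by e is forced by the quotient V^p U^(1-p): nothing keeps u away from 0 inside Om, and
    without the shift the coefficients multiplying the gradients could be unbounded. Its price is
    that the right-hand side acquires its sign only in the limit. There F U and F V stay below a
    constant, because F, u and v are bounded, whereas the subtracted terms F V^p U^(1-p) have no
    bound uniform in e. Only a one-sided bound is available, hence Fatou's lemma rather than
    dominated convergence. Picone's inequality enters only through its sign; the equality of u and v
    is read off pointwise from the strict monotonicity of F / rho^(p-1). Functions in C^1_0 are
    differentiable only along the flows of the horizontal fields. Averaging over left translates
    respects this, since a left translate of an integral curve is again an integral curve. The
    approximants of u and v may be negative or large. The clamp is the identity on [0, M], where u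
    and v take their values, so it disappears once the approximation has converged. *)

Lemma continuous_pair (T U W : topologicalType) (f : T -> U) (g : T -> W) (x : T) :
  {for x, continuous f} -> {for x, continuous g} ->
  {for x, continuous (fun y => (f y, g y))}.
Proof. by move=> cf cg; exact: (cvg_pair cf cg). Qed.

Lemma continuous_row (R : realType) (T : topologicalType) n (f : T -> 'rV[R]_n) x :
  (forall i, {for x, continuous (fun y => f y ord0 i)}) -> {for x, continuous f}.
Proof.
move=> cf; apply/(@cvgrPdist_lt _ _ _ (nbhs x)) => e e0.
have : \forall y \near x, forall i, `|f x ord0 i - f y ord0 i| < e.
  apply: filter_forall => i.
  by have /cvgrPdist_lt := cf i; exact.
apply: filterS => y fy; rewrite [ltLHS]/Num.Def.normr/= mx_normrE.
by apply/bigmax_lt => // -[a b] _; rewrite ord1 !mxE.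
Qed.

(** * Calculus on row vectors *)

Section MeanValue.
Context (R : realType).

Lemma is_derive_scale (V : normedModType R) (f : V -> R) (x v : V) (c df : R) :
  is_derive x v f df -> is_derive x v (fun y => c * f y) (c * df).
Proof. exact: is_deriveZ. Qed.

Lemma is_derive_line (V W : normedModType R) (f : V -> W) (x v : V) (s : R) :
  derivable f (x + s *: v) v ->
  is_derive s (1 : R) (fun t => f (x + t *: v)) ('D_v f (x + s *: v)).
Proof.
move=> df; set g := (fun t => _).
have h : ((fun h : R => h^-1 *: (g (h *: 1 + s) - g s)) =
   (fun h : R => h^-1 *: (f (h *: v + (x + s *: v)) - f (x + s *: v)))).
  apply/funext => k; rewrite /g; congr (_ *: (f _ - _)).
  by rewrite [k *: 1]mulr1 scalerDl addrC -!addrA; congr (_ + _); rewrite addrC.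
by apply: DeriveDef; rewrite /derivable /derive h.
Qed.

Lemma mean_value_dir (V : normedModType R) (f : V -> R) (x v : V) (t : R) :
  (forall y, derivable f y v) ->
  exists2 s : R, `|s| <= `|t| & f (x + t *: v) - f x = t * 'D_v f (x + s *: v).
Proof.
move=> df.
pose g s := f (x + s *: v).
have dg s : is_derive s (1 : R) g ('D_v f (x + s *: v)) by exact: is_derive_line.
have cg : continuous g.
  move=> s; apply: differentiable_continuous; apply/derivable1_diffP.
  exact: ex_derive.
have [t0|t0|->] := ltgtP t 0; last first.
- by exists 0 => //; rewrite scale0r addr0 subrr mul0r.
- have [|c] := @MVT R g _ 0 t t0 (fun s _ => dg s).
    exact: continuous_subspaceT.
  rewrite in_itv/= => /andP[c0 ct].
  rewrite /g scale0r addr0 => ->; exists c; last by rewrite subr0 mulrC.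
  by rewrite !gtr0_norm// ltW.
- have [|c] := @MVT R g _ t 0 t0 (fun s _ => dg s).
    exact: continuous_subspaceT.
  rewrite in_itv/= => /andP[c0 ct].
  rewrite /g scale0r addr0 => /eqP; rewrite -subr_eq0 => /eqP e.
  exists c; first by rewrite !ltr0_norm// lerN2 ltW.
  by lra.
Qed.

Lemma is_derive0_cst (f : R -> R) : (forall t, is_derive t (1 : R) f 0) ->
  forall t, f t = f 0.
Proof.
move=> df t; have [|s _] := @mean_value_dir R f 0 1 t.
  by move=> y; exact: ex_derive.
rewrite derive_val mulr0 add0r [t *: 1]mulr1 => /eqP.
by rewrite subr_eq0 => /eqP.
Qed.

End MeanValue.

(** [differentiable] speaks of the chosen map ['d f x]; [diff_unique] identifies that map with [L],
    so it is enough to exhibit one continuous linear [L] with a small remainder. *)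
Lemma differentiable_expand (R : realType) (V W : normedModType R) (f : V -> W)
    (L : {linear V -> W}) (x : V) : continuous L ->
  (forall e : R, 0 < e -> \forall h \near (0 : V),
    `|f (x + h) - f x - L h| <= e * `|h|) ->
  differentiable f x.
Proof.
move=> cL expand.
have E : f \o shift x = cst (f x) + L +o_ (0 : V) id.
  apply/eqaddoP => e e0; apply: filterS (expand e e0) => h.
  by rewrite !fctE/= [h + x]addrC opprD addrA.
by apply/diff_locallyP; rewrite (diff_unique cL E).
Qed.

Section Differentiability.
Context (R : realType) (n : nat).
Notation V := 'rV[R]_n.
Implicit Types (x h : V).

Notation e_ i := (delta_mx ord0 i : V).

(** Interpolates between 0 and [h] by switching on one coordinate at a time; increments are
    telescoped along it here and in [gop_triangular]. *)
Definition take_row (m : nat) h : V := \row_i (if (i < m)%N then h ord0 i else 0).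

Lemma take_row_all h : take_row n h = h.
Proof. by apply/rowP => i; rewrite mxE ltn_ord. Qed.

Lemma take_row0 h : take_row 0 h = 0.
Proof. by apply/rowP => i; rewrite !mxE. Qed.

Lemma take_rowS (i : 'I_n) h : take_row i.+1 h = take_row i h + h ord0 i *: e_ i.
Proof.
apply/rowP => j; rewrite !mxE ltnS leq_eqVlt eqxx/=.
have [->|ij] := eqVneq j i; first by rewrite eqxx ltnn add0r mulr1.
by rewrite [in RHS]mulr0 addr0 (negbTE (ij : val j != val i)).
Qed.

Lemma normr_coord h i : `|h ord0 i| <= `|h|.
Proof.
rewrite [leRHS]/Num.Def.normr/= mx_normrE.
exact: (le_trans _ (le_bigmax _ _ (ord0, i))).
Qed.

Lemma norm_row_le h (e : R) : 0 <= e ->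
  (forall i, `|h ord0 i| <= e) -> `|h| <= e.
Proof.
move=> e0 he; rewrite [leLHS]/Num.Def.normr/= mx_normrE bigmax_le// => -[i j] _.
by rewrite ord1.
Qed.

Variable (f : V -> R).
Hypothesis df : forall x v, derivable f x v.
Hypothesis cdf : forall v, continuous (fun x => 'D_v f x).

Let L0 x h : R := \sum_i h ord0 i * 'D_(e_ i) f x.

Let L0_linear x : linear (L0 x).
Proof.
move=> k u v; rewrite /L0 scaler_sumr -big_split/=; apply: eq_bigr => i _.
by rewrite !mxE mulrDl scalerAl.
Qed.

Let L x : {linear V -> R} :=
  HB.pack (L0 x) (GRing.isLinear.Build R V R _ (L0 x) (L0_linear x)).

Let L_continuous x : continuous (L x).
Proof.
apply: continuousfor0_continuous; apply/(@cvgrPdist_le _ _ _ (nbhs (0 : V))).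
move=> e e0.
pose S := \sum_i `|'D_(e_ i) f x|.
have S0 : 0 <= S by apply: sumr_ge0.
(* The added 1 keeps the divisor positive when all partial derivatives vanish. *)
have nearh : \forall h \near (0 : V), `|h| <= e / (S + 1).
  by apply: nbhs0_le; rewrite divr_gt0// ltr_pwDr.
near=> h.
rewrite linear0 sub0r normrN /L0 (le_trans (ler_norm_sum _ _ _))//.
rewrite (@le_trans _ _ (`|h| * S))//.
  by rewrite mulr_sumr ler_sum// => i _; rewrite normrM ler_wpM2r// normr_coord.
have : `|h| <= e / (S + 1).
  by near: h; exact: nearh.
move=> /ler_wpM2r => /(_ _ S0) /le_trans; apply.
rewrite -mulrA ler_piMr ?(ltW e0)// mulrC ler_pdivrMr ?mul1r ?ltr_pwDr//.
by rewrite lerDl.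
Unshelve. all: by end_near. Qed.

(** From x to x + h one coordinate at a time: by the mean value theorem each increment is a partial
    derivative at an intermediate point. That point stays within |h| of x, where the partial
    derivative is close to its value at x. The n errors add up, whence e / (n + 1), which also makes
    sense for n = 0. *)
Let expand x (e : R) : 0 < e -> \forall h \near (0 : V),
  `|f (x + h) - f x - L0 x h| <= e * `|h|.
Proof.
move=> e0.
pose e' := e / n.+1%:R.
have e'0 : 0 < e' by rewrite divr_gt0.
have : \forall h \near (0 : V), forall i : 'I_n,
    `|'D_(e_ i) f x - 'D_(e_ i) f (x + h)| <= e'.
  have F : Filter (nbhs (0 : V)) by exact: nbhs_filter.
  apply: (@filter_forall _ _ (fun (i : 'I_n) (h : V) =>
    `|'D_(e_ i) f x - 'D_(e_ i) f (x + h)| <= e') _ F) => i.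
  have : 'D_(e_ i) f (x + h) @[h --> (0 : V)] --> 'D_(e_ i) f x.
    rewrite -[X in _ --> 'D_ _ _ X]addr0.
    apply: (@continuous_comp _ _ _ (fun h => x + h) (fun y => 'D_(e_ i) f y) 0).
      by apply: cvgD; [exact: cvg_cst|exact: cvg_id].
    exact: cdf.
  by move/cvgrPdist_le/(_ _ e'0).
move=> /nbhs_normP[d /= d0 hd]; apply/nbhs_normP; exists d => //= h.
rewrite /= sub0r normrN => hlt.
have step (i : 'I_n) : `|f (x + take_row i.+1 h) - f (x + take_row i h) -
     h ord0 i * 'D_(e_ i) f x| <= e' * `|h|.
  have [s s_le E] := @mean_value_dir _ V f (x + take_row i h) (e_ i) (h ord0 i)
    (fun y => @df y (e_ i)).
  rewrite take_rowS addrA E -mulrBr normrM mulrC ler_pM ?normr_coord//.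
  rewrite distrC -addrA; apply: hd => /=; rewrite sub0r normrN.
  apply: le_lt_trans hlt; apply: norm_row_le => // j; rewrite !mxE eqxx/=.
  case: ltngtP => ji.
  - rewrite (_ : (j == i) = false) ?mulr0 ?addr0 ?normr_coord//.
    by apply/negbTE/eqP => jj; rewrite jj ltnn in ji.
  - rewrite (_ : (j == i) = false) ?mulr0 ?addr0 ?normr0//.
    by apply/negbTE/eqP => jj; rewrite jj ltnn in ji.
  - have -> : j = i by exact/val_inj.
    by rewrite eqxx mulr1 add0r (le_trans s_le)// normr_coord.
have tele m : (m <= n)%N -> `|f (x + take_row m h) - f x -
     \sum_(i < n | (i < m)%N) h ord0 i * 'D_(e_ i) f x| <= m%:R * (e' * `|h|).
  elim: m => [_|m IH mn].
    by rewrite take_row0 addr0 subrr big_pred0// subr0 normr0 mul0r.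
  rewrite (bigD1 (Ordinal mn))//= (_ : \sum_(i < n | _) _ =
     \sum_(i < n | (i < m)%N) h ord0 i * 'D_(e_ i) f x); last first.
    apply: eq_bigl => i; rewrite ltnS ltn_neqAle andbC; congr (_ && _).
  have := step (Ordinal mn); move: (IH (ltnW mn)) => /= IH' st.
  rewrite -natr1 mulrDl mul1r.
  apply: le_trans (lerD IH' st); apply: le_trans (ler_normD _ _).
  by rewrite le_eqVlt; apply/orP; left; apply/eqP; congr (`| _ |); ring.
have := tele n (leqnn n); rewrite take_row_all.
rewrite (eq_bigl xpredT); last by move=> i; rewrite ltn_ord.
move=> /le_trans; apply; rewrite mulrA ler_wpM2r// /e' mulrCA ler_piMr ?ltW//.
by rewrite ltr_pdivrMr// mul1r ltr_nat.
Qed.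

(** [Cn] mentions directional derivatives only; this supplies the differential that the chain rule
    requires. *)
Lemma C1_differentiable x : differentiable f x.
Proof. exact: differentiable_expand (@L_continuous x) (@expand x). Qed.

Lemma C1_diffE x v : 'D_v f x = \sum_i v ord0 i * 'D_(e_ i) f x.
Proof.
have dfx := C1_differentiable x.
rewrite (deriveE _ dfx) [in LHS](row_sum_delta v) linear_sum.
by apply: eq_bigr => i _; rewrite linearZ (deriveE _ dfx).
Qed.

End Differentiability.

(** The inner map is only known to be derivable in the direction [w]. It is therefore restricted to
    the curve [g]: in one real variable derivability and differentiability coincide. *)
Lemma is_derive_diff_comp (R : realType) (T U W : normedModType R)
    (f : U -> W) (c : T -> U) (x w : T) (dc : U) :
  differentiable f (c x) -> is_derive x w c dc ->
  is_derive x w (f \o c) ('D_dc f (c x)).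
Proof.
move=> fd cx.
have [dcx Edc] := cx.
pose g (t : R) := c (t *: w + x).
have g' : is_derive (0 : R) (1 : R) g dc.
  apply: DeriveDef; first by have/derivable1P := dcx.
  rewrite -Edc /derive.
  rewrite (_ : (fun t => _) = fun t : R => t^-1 *: ((c \o shift x) (t *: w) - c x))//.
  by apply/funext => t; rewrite /= /g addr0 scale0r add0r [t *: 1]mulr1.
have gd : differentiable g 0 by apply/derivable1_diffP; exact: ex_derive.
have g0 : g 0 = c x by rewrite /g scale0r add0r.
have fgd : differentiable (f \o g) 0.
  by apply: differentiable_comp => //; rewrite g0.
have E : (fun t : R => t^-1 *: ((f \o c) (t *: w + x) - (f \o c) x)) =
  (fun t => t^-1 *: ((f \o g) (t *: 1 + 0) - (f \o g) 0)).
  by apply/funext => t; rewrite /= /g addr0 scale0r add0r [t *: 1]mulr1.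
apply: DeriveDef.
  by apply/derivable1P; apply: diff_derivable.
rewrite [LHS]/derive E -[LHS]/('D_1 (f \o g) 0) deriveE// diff_comp//= ?g0//.
have -> : 'd g 0 1 = dc by rewrite -(@deriveE _ _ _ g 0 1)//; exact: derive_val.
by rewrite -deriveE.
Qed.

Lemma is_derive_comp1 (R : realType) (T : normedModType R) (f : R -> R)
    (c : T -> R) (x w : T) (df dc : R) :
  is_derive (c x) (1 : R) f df -> is_derive x w c dc ->
  is_derive x w (f \o c) (df * dc).
Proof.
move=> fd cd.
have fdd : differentiable f (c x) by apply/derivable1_diffP; exact: ex_derive.
have := is_derive_diff_comp fdd cd.
suff -> : 'D_dc f (c x) = df * dc by [].
rewrite deriveE// -[X in 'd f (c x) X]mulr1 linearZ/= -deriveE//.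
by rewrite (@derive_val _ _ _ _ _ _ _ fd) mulrC.
Qed.

Section CnTheory.
Context (R : realType).

Lemma is_derive_coord (T : normedModType R) n (c : T -> 'rV[R]_n) (x w : T)
    (dc : 'rV[R]_n) i :
  is_derive x w c dc -> is_derive x w (fun y => c y ord0 i) (dc ord0 i).
Proof.
move=> [cx <-]; apply: DeriveDef; first by move/derivable_mxP : cx; exact.
by rewrite derive_mx// mxE.
Qed.

Lemma is_derive_row (T : normedModType R) n (c : T -> 'rV[R]_n) (x w : T)
    (dc : 'rV[R]_n) :
  (forall i, is_derive x w (fun y => c y ord0 i) (dc ord0 i)) ->
  is_derive x w c dc.
Proof.
move=> h; have cx : derivable c x w.
  by apply/derivable_mxP => i j; rewrite ord1; exact: ex_derive.
apply: DeriveDef => //; rewrite derive_mx//.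
apply/rowP => i; rewrite mxE; exact: derive_val.
Qed.

Lemma Cn_continuous (V W : normedModType R) k (f : V -> W) :
  Cn k f -> continuous f.
Proof. by case: k => [|k] // []. Qed.

Lemma CnSW (V W : normedModType R) k (f : V -> W) : Cn k.+1 f -> Cn k f.
Proof.
elim: k f => [|k IH] f; first by case.
move=> [cf df]; split => // v; have [dv Dv] := df v; split => //; exact: IH.
Qed.

Lemma Cn_cst (V W : normedModType R) k (a : W) : Cn k (fun _ : V => a).
Proof.
elim: k a => [|k IH] a /=; first exact: cst_continuous.
split; first exact: cst_continuous.
move=> v; split => [x|]; first exact: derivable_cst.
rewrite [X in Cn _ X](_ : _ = fun=> 0); first exact: IH.
by apply/funext => x; rewrite derive_cst.
Qed.

Lemma CnD (V W : normedModType R) k (f g : V -> W) :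
  Cn k f -> Cn k g -> Cn k (fun x => f x + g x).
Proof.
elim: k f g => [|k IH] f g /=.
  by move=> cf cg x; apply: continuousD; [exact: cf|exact: cg].
move=> [cf df] [cg dg]; split.
  by move=> x; apply: continuousD; [exact: cf|exact: cg].
move=> v; have [dfv Cf] := df v; have [dgv Cg] := dg v; split.
  by move=> x; apply: derivableD.
rewrite [X in Cn _ X](_ : _ = fun x => 'D_v f x + 'D_v g x); first exact: IH.
by apply/funext => x; rewrite deriveD.
Qed.

Lemma Cn_sum (V W : normedModType R) k n (f : 'I_n -> V -> W) :
  (forall i, Cn k (f i)) -> Cn k (fun x => \sum_i f i x).
Proof.
elim: n f => [|n IH] f fC.
  rewrite [X in Cn _ X](_ : _ = fun=> 0); first exact: Cn_cst.
  by apply/funext => x; rewrite big_ord0.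
rewrite [X in Cn _ X](_ : _ =
  fun x => \sum_(i < n) f (widen_ord (leqnSn n) i) x + f ord_max x).
  by apply: CnD => //; exact: IH.
by apply/funext => x; rewrite big_ord_recr.
Qed.

Lemma CnM (V : normedModType R) k (f g : V -> R) :
  Cn k f -> Cn k g -> Cn k (fun x => f x * g x).
Proof.
elim: k f g => [|k IH] f g /=.
  by move=> cf cg x; apply: continuousM; [exact: cf|exact: cg].
move=> [cf df] [cg dg]; split.
  by move=> x; apply: continuousM; [exact: cf|exact: cg].
move=> v; have [dfv Cf] := df v; have [dgv Cg] := dg v; split.
  by move=> x; apply: derivableM.
rewrite [X in Cn _ X](_ : _ = fun x => f x * 'D_v g x + g x * 'D_v f x).
  by apply: CnD; apply: IH => //; exact: (@CnSW _ _ k _ (conj _ _)).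
by apply/funext => x; rewrite deriveM.
Qed.

Lemma Cn_prod (V : normedModType R) k n (f : 'I_n -> V -> R) :
  (forall i, Cn k (f i)) -> Cn k (fun x => \prod_i f i x).
Proof.
elim: n f => [|n IH] f fC.
  rewrite [X in Cn _ X](_ : _ = fun=> 1); first exact: Cn_cst.
  by apply/funext => x; rewrite big_ord0.
rewrite [X in Cn _ X](_ : _ =
  fun x => (\prod_(i < n) f (widen_ord (leqnSn n) i) x) * f ord_max x).
  by apply: CnM => //; exact: IH.
by apply/funext => x; rewrite big_ord_recr.
Qed.

Lemma Cn_coord (V : normedModType R) k n (f : V -> 'rV[R]_n) i :
  Cn k f -> Cn k (fun x => f x ord0 i).
Proof.
have cc (g : V -> 'rV[R]_n) : continuous g -> continuous (fun x => g x ord0 i).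
  move=> cg x; apply: (@continuous_comp _ _ _ g (fun M : 'rV[R]_n => M ord0 i)).
    exact: cg.
  exact: coord_continuous.
elim: k f => [|k IH] f /=; first exact: cc.
move=> [cf df]; split; first exact: cc.
move=> v; have [dfv Cf] := df v; split.
  by move=> x; have /derivable_mxP := dfv x; exact.
rewrite [X in Cn _ X](_ : _ = fun x => ('D_v f x) ord0 i); first exact: IH.
by apply/funext => x; rewrite derive_mx// mxE.
Qed.

Lemma Cn_coordf k n (i : 'I_n) : Cn k (fun x : 'rV[R]_n => x ord0 i).
Proof.
case: k => [|k] /=; first exact: coord_continuous.
split; first exact: coord_continuous.
move=> v; split.
  by move=> x; have /derivable_mxP := @derivable_id R 'rV[R]_n x v; exact.
rewrite [X in Cn _ X](_ : _ = fun=> v ord0 i); first exact: Cn_cst.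
apply/funext => x; have := derive_mx (@derivable_id R 'rV[R]_n x v).
rewrite derive_id => /(congr1 (fun M : 'rV[R]_n => M ord0 i)).
by rewrite mxE => ->.
Qed.

(** The derivative of the composite is the sum over i of the i-th coordinate of ['D_v c] times the
    i-th partial derivative of [f] composed with [c], so the induction reduces to sums and
    products. *)
Lemma Cn_comp (V : normedModType R) k n (f : 'rV[R]_n -> R) (c : V -> 'rV[R]_n) :
  Cn k f -> Cn k c -> Cn k (f \o c).
Proof.
elim: k f => [|k IH] f /=.
  by move=> cf cc x; apply: continuous_comp; [exact: cc|exact: cf].
move=> [cf df] Cc; have [cc dc] := Cc; split.
  by move=> x; apply: continuous_comp; [exact: cc|exact: cf].
have dff x v : derivable f x v by have [] := df v.
have cdf v : continuous (fun x => 'D_v f x).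
  by have [_ /Cn_continuous] := df v.
have ch x v : is_derive x v (f \o c) ('D_('D_v c x) f (c x)).
  apply: is_derive_diff_comp; first exact: C1_differentiable.
  by apply: DeriveDef => //; have [] := dc v.
move=> v; split; first by move=> x; have [] := ch x v.
rewrite [X in Cn _ X](_ : _ = fun x => \sum_i ('D_v c x) ord0 i *
   (('D_(delta_mx ord0 i) f) \o c) x).
  apply: Cn_sum => i; apply: CnM.
    by apply: Cn_coord; have [] := dc v.
  apply: IH; last exact: CnSW.
  by have [] := df (delta_mx ord0 i).
apply/funext => x; rewrite (@derive_val _ _ _ _ _ _ _ (ch x v)).
by rewrite C1_diffE.
Qed.

Lemma Cn_comp1 (V : normedModType R) k (f : R -> R) (c : V -> R) :
  Cn k f -> Cn k c -> Cn k (f \o c).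
Proof.
elim: k f => [|k IH] f /=.
  by move=> cf cc x; apply: continuous_comp; [exact: cc|exact: cf].
move=> [cf df] Cc; have [cc dc] := Cc; split.
  by move=> x; apply: continuous_comp; [exact: cc|exact: cf].
have ch x v : is_derive x v (f \o c) ('D_1 f (c x) * 'D_v c x).
  apply: is_derive_comp1; apply: DeriveDef => //; first by have [] := df 1.
  by have [] := dc v.
move=> v; split; first by move=> x; have [] := ch x v.
rewrite [X in Cn _ X](_ : _ = fun x => ('D_1 f \o c) x * 'D_v c x).
  apply: CnM; last by have [] := dc v.
  by apply: IH; [have [] := df 1|exact: CnSW].
by apply/funext => x; rewrite (@derive_val _ _ _ _ _ _ _ (ch x v)).
Qed.

End CnTheory.

(** * Antiderivatives and smooth bump functions *)

Section Antiderivative.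
Context (R : realType) (f : R -> R).
Hypothesis cf : continuous f.
Notation mu := (@lebesgue_measure R).

Lemma antiderivative_ex : exists F : R -> R, F 0 = 0 /\
  forall t, is_derive t (1 : R) F (f t).
Proof.
pose F t : R := if 0 <= t then \int[mu]_(s in `]0, t]) f s
  else - \int[mu]_(s in `]t, 0]) f s.
have intf (a b : R) : mu.-integrable `[a, b] (EFin \o f).
  apply: continuous_compact_integrable; first exact: segment_compact.
  exact: continuous_subspaceT.
(* On [-M, M] the oriented integral is a difference of integrals from the fixed base point -M, the
   form in which the fundamental theorem of calculus applies. *)
have FE (M t : R) : 0 <= M -> `|t| <= M ->
    F t = \int[mu]_(s in `[- M, t]) f s - \int[mu]_(s in `[- M, 0]) f s.
  move=> M0; rewrite ler_norml => /andP[Mt tM]; rewrite /F; case: ifPn => t0.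
    by rewrite Rintegral_itvB// ?bnd_simp// lerNl oppr0.
  rewrite -opprB Rintegral_itvB// ?bnd_simp// ltW// ltNge//.
exists F; split.
  by rewrite (FE 0)// ?normr0// oppr0 subrr.
move=> t.
pose M := `|t| + 1.
have tM : `|t| < M by rewrite ltrDl.
pose G (x : R) := \int[mu]_(s in `[- M, x]) f s.
have [dG GE] : derivable G t 1 /\ derive1 G t = f t.
  apply: (@continuous_FTC1_closed _ f (- M) t M) => //.
  - by move: tM; rewrite ltr_norml => /andP[].
  - by move: tM; rewrite ltr_norml => /andP[].
  - exact: cf.
have dG' : is_derive t (1 : R) (fun x => G x - G 0) (f t).
  have dG1 : is_derive t (1 : R) G (f t).
    by apply: DeriveDef => //; rewrite -GE derive1E.
  have := @is_deriveB _ _ _ _ _ _ _ _ _ dG1 (is_derive_cst (G 0) t (1 : R)).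
  by rewrite subr0.
apply: near_eq_is_derive dG'.
have : \forall x \near t, `|x| < M.
  have cn : {for t, continuous (fun x : R => `|x|)} by exact: norm_continuous.
  exact: (cvgr_lt _ cn).
apply: filterS => x xM; rewrite (FE M)//; last exact: ltW.
by rewrite (le_trans _ (ltW tM)).
Qed.

End Antiderivative.

Section Bump.
Context (R : realType).

(** t^(-k) exp(-1/t), extended by 0. The index makes the family stable under differentiation up to
    linear combinations ([is_derive_flat]), so a single induction proves all its members smooth. *)
Definition flat (k : nat) (t : R) : R :=
  if 0 < t then t^-1 ^+ k * expR (- t^-1) else 0.

Lemma flat_ge0 k t : 0 <= flat k t.
Proof.
by rewrite /flat; case: ifPn => // t0; rewrite mulr_ge0 ?expR_ge0// exprn_ge0// invr_ge0 ltW.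
Qed.

Lemma flat_gt0 k t : 0 < t -> 0 < flat k t.
Proof.
by move=> t0; rewrite /flat t0 mulr_gt0 ?expR_gt0// exprn_gt0// invr_gt0.
Qed.

Lemma flat_le0 k t : t <= 0 -> flat k t = 0.
Proof. by rewrite /flat ltNge => ->. Qed.

(** A single term of the exponential series, (1/t)^(k+2) / (k+2)!, bounds exp(1/t) from below. Two
    powers more than t^(-k) leave the factor t^2, which makes the derivative at 0 vanish. *)
Let flat_ub k t : flat k t <= (k.+2)`!%:R * t ^+ 2.
Proof.
rewrite /flat; case: ifPn => t0; last by rewrite mulr_ge0// sqr_ge0.
have s0 : 0 < t^-1 by rewrite invr_gt0.
have := @expR_ge1Dxn R t^-1 k.+1 (ltW s0).
rewrite expRN => h.
have {}h : t^-1 ^+ k.+2 / (k.+2)`!%:R <= expR t^-1 by rewrite (le_trans _ h)// lerDr.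
rewrite ler_pdivrMr ?expR_gt0//.
rewrite ler_pdivrMr ?ltr0n ?fact_gt0// in h.
have t20 : 0 < t ^+ 2 by rewrite exprn_gt0.
rewrite -(ler_pM2l t20) in h.
have E : t ^+ 2 * t^-1 ^+ k.+2 = t^-1 ^+ k.
  by rewrite -[k.+2]addn2 exprD mulrCA -exprMn divff ?gt_eqF// expr1n mulr1.
rewrite E in h; apply: (le_trans h); rewrite le_eqVlt; apply/orP; left; apply/eqP; ring.
Qed.

Lemma is_derive_flat k t :
  is_derive t (1 : R) (flat k) (flat k.+2 t - k%:R * flat k.+1 t).
Proof.
have [t0|t0|->] := ltgtP t 0.
- rewrite !flat_le0 ?ltW// mulr0 subr0.
  apply: (@near_eq_is_derive _ _ _ (cst 0)).
  near=> x; rewrite flat_le0// ltW//; near: x; exact: lt_nbhsl.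
- have tn0 : t != 0 by rewrite gt_eqF.
  have dV : is_derive t (1 : R) (fun x : R => x^-1) (- t ^- 2).
    apply: (is_derive_eq (is_deriveV tn0 (is_derive_id t (1 : R)))).
    by rewrite [_ *: _]mulr1.
  have dX : is_derive t (1 : R) (fun x : R => x^-1 ^+ k) (k%:R * t^-1 ^+ k.-1 * - t ^- 2).
    rewrite (_ : (fun x => _) = (fun x : R => x^-1) ^+ k); last first.
      by apply/funext => x; rewrite exprfctE.
    by apply: (is_derive_eq (is_deriveX k dV)).
  have dE : is_derive t (1 : R) (fun x : R => expR (- x^-1)) (expR (- t^-1) * t ^- 2).
    rewrite -[X in _ * X]opprK.
    have dN : is_derive t (1 : R) (fun x : R => - x^-1) (- - t ^- 2) by exact: is_deriveN.
    exact: (@is_derive_comp1 R R expR (fun x => - x^-1) t 1 _ _ (is_derive_expR _) dN).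
  have dM : is_derive t (1 : R) (fun x => x^-1 ^+ k * expR (- x^-1))
      (flat k.+2 t - k%:R * flat k.+1 t).
    apply: (is_derive_eq (is_deriveM dX dE)).
    rewrite /flat t0 /GRing.scale/= !exprVn.
    case: k {dX} => [|k] /=; first by rewrite !expr0; field.
    by rewrite !exprS; field; rewrite tn0/= expf_neq0.
  apply: near_eq_is_derive dM.
  near=> x; rewrite /flat ifT//; near: x; exact: lt_nbhsr.
- have f0 : flat k 0 = 0 by rewrite flat_le0.
  rewrite !flat_le0// mulr0 subr0.
  (* By [flat_ub] the difference quotient is at most (k+2)! |h| in absolute value. *)
  have H : h^-1 *: ((flat k \o shift 0) (h *: 1) - flat k 0) @[h --> 0^'] --> (0 : R).
    apply/cvgr0Pnorm_le => e e0; near=> h.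
    rewrite /= addr0 f0 subr0 [h *: 1]mulr1 normrM normfV ger0_norm ?flat_ge0//.
    have h0 : 0 < `|h| by rewrite normr_gt0; near: h; exact: nbhs_dnbhs_neq.
    rewrite mulrC ler_pdivrMr// (le_trans (flat_ub _ _))//.
    rewrite -real_normK ?num_real// expr2 mulrA ler_wpM2r//.
    rewrite mulrC -ler_pdivlMr ?ltr0n ?fact_gt0//; near: h; apply: dnbhs0_le.
    by rewrite divr_gt0// ltr0n fact_gt0.
  apply: DeriveDef; first by apply/cvg_ex; exists 0.
  exact: cvg_lim H.
Unshelve. all: by end_near. Qed.

Lemma Cn_flat m k : Cn m (flat k).
Proof.
have cf j : continuous (flat j).
  move=> t; apply: differentiable_continuous; apply/derivable1_diffP.
  by have [] := is_derive_flat j t.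
elim: m k => [|m IH] k /=; first exact: cf.
split; first exact: cf.
have D v t : is_derive t v (flat k) (v * (flat k.+2 t - k%:R * flat k.+1 t)).
  have dfl : differentiable (flat k) t.
    by apply/derivable1_diffP; have [] := is_derive_flat k t.
  apply: DeriveDef; first exact: diff_derivable.
  have [_ <-] := is_derive_flat k t.
  by rewrite !deriveE// -[X in 'd _ _ X = _]mulr1 linearZ.
move=> v; split; first by move=> t; have [] := D v t.
rewrite [X in Cn _ X](_ : _ = fun t => v * (flat k.+2 t + - k%:R * flat k.+1 t)).
  apply: CnM; first exact: Cn_cst.
  apply: CnD; first exact: IH.
  apply: CnM; [exact: Cn_cst|exact: IH].
by apply/funext => t; rewrite (@derive_val _ _ _ _ _ _ _ (D v t)) mulNr.
Qed.

(** Positive exactly on the open cube [box e]. It is not normalised; [mollify] divides by its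
    integral. *)
Definition sbump n (e : R) (x : 'rV[R]_n) : R :=
  \prod_i (flat 0 (e - x ord0 i) * flat 0 (e + x ord0 i)).

Lemma sbump_smooth n e : smooth (@sbump n e).
Proof.
move=> k; apply: Cn_prod => i.
apply: CnM; apply: (@Cn_comp1 _ _ _ (flat 0)); try exact: Cn_flat.
  rewrite (_ : (fun _ => _) = fun x : 'rV[R]_n => e + (-1) * x ord0 i).
    apply: CnD; first exact: Cn_cst.
    by apply: CnM; [exact: Cn_cst|exact: Cn_coordf].
  by apply/funext => x; rewrite mulN1r.
by apply: CnD; [exact: Cn_cst|exact: Cn_coordf].
Qed.

Lemma sbump_ge0 n e (x : 'rV[R]_n) : 0 <= @sbump n e x.
Proof. by apply: prodr_ge0 => i _; rewrite mulr_ge0// flat_ge0. Qed.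

Lemma sbump_gt0 n e (x : 'rV[R]_n) : (forall i, `|x ord0 i| < e) -> 0 < @sbump n e x.
Proof.
move=> xe; apply: prodr_gt0 => i _.
have := xe i; rewrite ltr_norml => /andP[a b].
by rewrite mulr_gt0// flat_gt0//; lra.
Qed.

Lemma sbump_eq0 n e (x : 'rV[R]_n) i : e <= `|x ord0 i| -> @sbump n e x = 0.
Proof.
move=> xe; rewrite /sbump (bigD1 i)//=.
suff -> : flat 0 (e - x ord0 i) * flat 0 (e + x ord0 i) = 0 by rewrite mul0r.
have [x0|x0] := leP 0 (x ord0 i).
  by rewrite ger0_norm// in xe; rewrite flat_le0 ?mul0r// subr_le0.
rewrite ltr0_norm// in xe; rewrite [X in _ * X]flat_le0 ?mulr0//; lra.
Qed.

End Bump.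

(** * Triangularity of the group law *)

Section GroupLaw.
Context (R : realType) (r : nat) (Ns : 'I_r.+1 -> nat).
Variable (G : stratified_group R Ns).
Notation N := (gdim Ns).
Notation V := 'rV[R]_N.
Notation op := (gop G).
Notation e_ j := (delta_mx ord0 j : V).
Implicit Types (x y a : V) (i j : 'I_N).

(** The layer of the i-th coordinate counted from 1, that is, its degree of homogeneity under
    dilations. *)
Definition weight (i : 'I_N) : nat := (tagnat.sig1 i).+1.

Lemma leq_weight i j : (i <= j)%N -> (weight i <= weight j)%N.
Proof. by move=> ij; rewrite ltnS; exact: (@tagnat.le_sig1 _ Ns i j). Qed.

Lemma dilationE l x i : dilation l x ord0 i = l ^+ weight i * x ord0 i.
Proof. by rewrite /dilation !mxE tagnat.sig2K. Qed.

Lemma dilation0 x : dilation 0 x = 0.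
Proof. by apply/rowP => i; rewrite dilationE expr0n mul0r mxE. Qed.

Lemma dilationD l x y : dilation l (x + y) = dilation l x + dilation l y.
Proof. by apply/rowP => i; rewrite !mxE mulrDr. Qed.

Lemma dilation_basis l (s : R) j :
  dilation l (s *: e_ j) = (l ^+ weight j * s) *: e_ j.
Proof.
apply/rowP => i; rewrite dilationE !mxE eqxx/=.
by have [->|_] := eqVneq i j; rewrite ?mulr1 ?mulr0.
Qed.

Lemma continuous_dilation x : continuous (fun l => dilation l x).
Proof.
move=> l; apply: differentiable_continuous; apply/derivable1_diffP.
suff : is_derive l (1 : R) (fun l => dilation l x)
  (\row_i (x ord0 i * (weight i)%:R * l ^+ (weight i).-1)) by case.
apply: is_derive_row => i; rewrite mxE.
rewrite [X in is_derive _ _ X](_ : _ = (fun l : R => x ord0 i * l ^+ weight i)); last first.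
  by apply/funext => y; rewrite dilationE mulrC.
rewrite -mulrA; apply: is_derive_scale.
have := is_deriveX (weight i) (is_derive_id l (1 : R)).
rewrite [_ *: _]mulr1; congr is_derive.
by apply/funext => y; rewrite exprfctE.
Qed.

Let Phi (z : V * V) : V := op z.1 z.2.
Let Phi_C k : Cn k Phi. Proof. exact: gop_smooth. Qed.

Lemma continuous_gop : continuous Phi.
Proof. exact: Cn_continuous (Phi_C 0). Qed.

Definition gop_coord i (z : V * V) : R := op z.1 z.2 ord0 i.

Lemma gop_coord_C k i : Cn k (gop_coord i).
Proof. exact: (Cn_coord i (Phi_C k)). Qed.

Lemma gop_coord_derivable i z v : derivable (gop_coord i) z v.
Proof. by have [_ /(_ v)[]] := gop_coord_C 1 i. Qed.

Lemma gop_coord_continuous_derive i v : continuous (fun z => 'D_v (gop_coord i) z).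
Proof. by have [_ /(_ v)[]] := gop_coord_C 1 i. Qed.

(* The partial derivative has weight [weight i - weight j], so it vanishes or is
   constant. *)
Lemma derive_gop_coord i j (v : V * V) z :
  v = (e_ j, 0) \/ v = (0, e_ j) -> (weight i <= weight j)%N ->
  'D_v (gop_coord i) z = (i == j)%:R.
Proof.
move=> vE wij.
pose h z := 'D_v (gop_coord i) z.
pose d (l : R) (z : V * V) : V * V := (dilation l z.1, dilation l z.2).
have dline l s z' : d l (z' + s *: v) = d l z' + (l ^+ weight j * s) *: v.
  rewrite /d; case: vE => ->; congr (_, _) => /=;
    by rewrite dilationD ?dilation_basis// !scaler0 [X in _ + X](_ : _ = 0)//;
       apply/rowP => k; rewrite dilationE !mxE mulr0.
(* The i-th coordinate of the product at [d l (z + s *: v)] is differentiated at s = 0 in two ways: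
   the automorphism property contributes l^(weight i), while along [v] the argument moves at speed
   l^(weight j). *)
have hom l : 0 < l -> h z = l ^+ (weight j - weight i) * h (d l z).
  move=> l0.
  have D1 : is_derive (0 : R) (1 : R)
     (fun s => gop_coord i (d l (z + s *: v))) (l ^+ weight i * h z).
    rewrite [X in is_derive _ _ X](_ : _ = fun s => l ^+ weight i * gop_coord i (z + s *: v)).
      have L := is_derive_line (@gop_coord_derivable i (z + 0 *: v) v).
      rewrite scale0r addr0 in L.
      exact: is_derive_scale.
    by apply/funext => s; rewrite /gop_coord /= -dilation_morph// dilationE.
  have D2 : is_derive (0 : R) (1 : R)
     (fun s => gop_coord i (d l (z + s *: v))) (h (d l z) * l ^+ weight j).
    rewrite [X in is_derive _ _ X](_ : _ = (fun s => gop_coord i (d l z + s *: v)) \o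
       (fun s => l ^+ weight j * s)); last first.
      by apply/funext => s /=; rewrite dline.
    apply: is_derive_comp1.
      rewrite mulr0; have L := is_derive_line (@gop_coord_derivable i (d l z + 0 *: v) v).
      by rewrite scale0r addr0 in L.
    rewrite -[X in is_derive _ _ _ X]mulr1.
    by apply: is_derive_scale; exact: is_derive_id.
  have E : l ^+ weight i * h z = h (d l z) * l ^+ weight j.
    by rewrite -(@derive_val _ _ _ _ _ _ _ D1) (@derive_val _ _ _ _ _ _ _ D2).
  have li : l ^+ weight i != 0 by rewrite expf_neq0// gt_eqF.
  apply: (mulfI li); rewrite E mulrA -exprD addnC subnK// mulrC //.
have cd : continuous (fun l => d l z).
  move=> l; apply: (@continuous_pair R V V (fun l => dilation l z.1)
    (fun l => dilation l z.2)); exact: continuous_dilation.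
have ch : continuous (fun l : R => l ^+ (weight j - weight i) * h (d l z)).
  move=> l; apply: (@continuousM R R (fun l => l ^+ (weight j - weight i))
    (fun l => h (d l z))); first exact: exprn_continuous.
  apply: (@continuous_comp _ _ _ (fun l => d l z) h); first exact: cd.
  exact: gop_coord_continuous_derive.
(* As l tends to 0 from the right, [d l z] tends to 0. When the weights agree the power is 0^0 = 1
   and [h] is constant. *)
have hz0 : h z = 0 ^+ (weight j - weight i) * h 0.
  have d0 : d 0 z = 0 by rewrite /d !dilation0.
  have L1 : l ^+ (weight j - weight i) * h (d l z) @[l --> 0^'+] -->
      0 ^+ (weight j - weight i) * h 0.
    by rewrite -[in X in _ --> X]d0; apply: cvg_at_right_filter; exact: ch.
  have L2 : l ^+ (weight j - weight i) * h (d l z) @[l --> 0^'+] --> h z.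
    apply: cvg_near_cst; near=> l; rewrite -hom//.
  exact: (cvg_unique _ L2 L1).
(* At the origin one factor is the neutral element, so the product is s times the j-th basis
   vector. *)
have h0 : h 0 = (i == j)%:R.
  have D : is_derive (0 : R) (1 : R) (fun s => gop_coord i (0 + s *: v)) (h 0).
    have L := is_derive_line (@gop_coord_derivable i (0 + 0 *: v) v).
    by rewrite scale0r addr0 in L.
  have E : (fun s => gop_coord i (0 + s *: v)) = fun s => (i == j)%:R * id s.
    apply/funext => s; rewrite /gop_coord add0r; case: vE => ->/=.
    - by rewrite scaler0 gopx0 !mxE eqxx/= mulrC.
    - by rewrite scaler0 gop0x !mxE eqxx/= mulrC.
  rewrite E in D; rewrite -(@derive_val _ _ _ _ _ _ _ D).
  have D' := is_derive_scale (i == j)%:R (is_derive_id (0 : R) (1 : R)).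
  by rewrite (@derive_val _ _ _ _ _ _ _ D') mulr1.
rewrite -/(h z) hz0 h0; have [->|ij] := eqVneq i j; last by rewrite mulr0.
by rewrite subnn mul1r.
Unshelve. all: by end_near. Qed.

Let excess i (z : V * V) : R := gop_coord i z - z.1 ord0 i - z.2 ord0 i.

(** By [derive_gop_coord], moving a coordinate of index j >= i in either factor changes the i-th
    coordinate of the product exactly as it changes the sum, so their difference has zero
    derivative. *)
Let excess_step i j (v : V * V) z (s : R) :
  v = (e_ j, 0) \/ v = (0, e_ j) -> (i <= j)%N ->
  excess i (z + s *: v) = excess i z.
Proof.
move=> vE ij.
have L t : is_derive t (1 : R) (fun t => excess i (z + t *: v)) 0.
  have L := is_derive_line (@gop_coord_derivable i (z + t *: v) v).
  rewrite (derive_gop_coord _ vE (leq_weight ij)) in L.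
  have A : is_derive t (1 : R) (fun t => z.1 ord0 i + z.2 ord0 i + t * (i == j)%:R) (i == j)%:R.
    have := is_deriveD (is_derive_cst (z.1 ord0 i + z.2 ord0 i) t (1:R))
      (is_derive_scale (i == j)%:R (is_derive_id t (1 : R))).
    rewrite add0r mulr1.
    suff -> : cst (z.1 ord0 i + z.2 ord0 i) + (fun t => (i == j)%:R * id t) =
      fun t : R => z.1 ord0 i + z.2 ord0 i + t * (i == j)%:R by [].
    by apply/funext => u; rewrite !fctE mulrC.
  have := is_deriveB L A; rewrite subrr.
  rewrite (_ : _ - _ = fun t => excess i (z + t *: v))//.
  apply/funext => u; transitivity (gop_coord i (z + u *: v) -
    (z.1 ord0 i + z.2 ord0 i + u * (i == j)%:R)); first by [].
  rewrite /excess; set g := gop_coord _ _.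
  by case: vE => ->; rewrite /= !mxE ?eqxx/=; ring.
by rewrite (is_derive0_cst L) scale0r addr0.
Qed.

(** Replace x by x', then y by y', one coordinate at a time: those before i agree, and those from i
    on leave [excess i] unchanged. *)
Lemma gop_triangular i x x' y y' :
  (forall j, (j < i)%N -> x ord0 j = x' ord0 j) ->
  (forall j, (j < i)%N -> y ord0 j = y' ord0 j) ->
  op x y ord0 i - x ord0 i - y ord0 i = op x' y' ord0 i - x' ord0 i - y' ord0 i.
Proof.
move=> xx yy; rewrite -[LHS]/(excess i (x, y)) -[RHS]/(excess i (x', y')).
have H1 m : (m <= N)%N -> excess i (x + take_row m (x' - x), y) = excess i (x, y).
  elim: m => [|m IH] mN; first by rewrite take_row0 addr0.
  rewrite -(IH (ltnW mN)) (take_rowS (Ordinal mN)) addrA /= !mxE.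
  have [mi|im] := ltnP m i.
    by rewrite xx// subrr scale0r addr0.
  rewrite -(@excess_step i (Ordinal mN) (e_ (Ordinal mN), 0)
     (x + take_row m (x' - x), y)
     (x' ord0 (Ordinal mN) - x ord0 (Ordinal mN)) (or_introl erefl) im).
  by congr (excess i (_, _)); rewrite /= scaler0 addr0.
have H2 m : (m <= N)%N -> excess i (x', y + take_row m (y' - y)) = excess i (x', y).
  elim: m => [|m IH] mN; first by rewrite take_row0 addr0.
  rewrite -(IH (ltnW mN)) (take_rowS (Ordinal mN)) addrA /= !mxE.
  have [mi|im] := ltnP m i.
    by rewrite yy// subrr scale0r addr0.
  rewrite -(@excess_step i (Ordinal mN) (0, e_ (Ordinal mN))
     (x', y + take_row m (y' - y))
     (y' ord0 (Ordinal mN) - y ord0 (Ordinal mN)) (or_intror erefl) im).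
  by congr (excess i (_, _)); rewrite /= scaler0 addr0.
have := H1 N (leqnn _); rewrite take_row_all subrKC => <-.
by have := H2 N (leqnn _); rewrite take_row_all subrKC => <-.
Qed.

End GroupLaw.

Lemma open_setI_preimage (T U : topologicalType) (D : set T) (f : T -> U)
    (B : set U) : open D -> (forall x, D x -> {for x, continuous f}) -> open B ->
  open (D `&` f @^-1` B).
Proof.
move=> oD cf oB; rewrite openE => x [Dx /= fx].
apply: filterI; first exact: open_nbhs_nbhs.
by apply: (cf _ Dx); exact: open_nbhs_nbhs.
Qed.

Section Borel.
Context (R : realType) (n : nat).
Notation V := 'rV[R]_n.
Notation mR := (measurableTypeR R).

Lemma open_measurable_rV (U : set V) : open U -> measurable U.
Proof. by move=> oU; exact: sub_sigma_algebra. Qed.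

Lemma continuous_measurable_rV (D : set V) (f : V -> R) : open D ->
  {in D, continuous f} -> measurable_fun D (f : V -> mR).
Proof.
move=> oD /in_setP cf mD; apply: (measurability _ (RGenOpens.measurableE R)) => //.
move=> _ [_ [a [b ->] <-]]; apply: open_measurable_rV.
by apply: open_setI_preimage => //; exact: interval_open.
Qed.

Lemma continuous_measurable_rVT (f : V -> R) : continuous f ->
  measurable_fun setT (f : V -> mR).
Proof.
by move=> cf; apply: continuous_measurable_rV; [exact: openT|move=> x _; exact: cf].
Qed.

Lemma measurable_coord (D : set V) i : measurable_fun D (fun x : V => x ord0 i : mR).
Proof.
apply: (@measurable_funS _ _ _ _ setT) => //.
by apply: continuous_measurable_rVT; exact: coord_continuous.
Qed.

End Borel.

(** * Invariance of Lebesgue measure *)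

Section Triangular.
Context (R : realType).
Notation mR := (measurableTypeR R).
Notation leb1 := (@lebesgue_measure R).

Let shift_meas (c : R) : measurable_fun setT (fun z : mR => z + c : mR).
Proof. exact: measurable_funD. Qed.

Lemma lebesgue_measure_shift (c : R) (A : set mR) : measurable A ->
  leb1 ((fun z => z + c) @^-1` A) = leb1 A.
Proof.
move=> mA; apply/esym.
pose f := fun z : mR => z + c : mR.
have mf : measurable_fun setT f by exact: shift_meas.
pose M := [the {measure set mR -> \bar R} of pushforward leb1 f].
rewrite -[RHS]/(M mf A); apply: lebesgue_measure_unique => // _ [[a b] _ <-].
rewrite /M/= /pushforward (_ : _ @^-1` _ = `]a - c, b - c]%classic); last first.
  by apply/seteqP; split => z /=; rewrite /f !in_itv/= ltrBlDr lerBrDr.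
rewrite !lebesgue_measure_itv/= !lte_fin ltrD2r; case: ifPn => // _.
by rewrite -!EFinB opprB addrA subrK.
Qed.

Lemma ge0_integral_shift (c : R) (f : mR -> \bar R) : measurable_fun setT f ->
  (forall z, (0 <= f z)%E) ->
  (\int[leb1]_z f (z + c)%R = \int[leb1]_z f z)%E.
Proof.
move=> mf f0.
have mg : measurable_fun setT (fun z : mR => z + c : mR) by exact: shift_meas.
have := @ge0_integral_pushforward _ _ _ _ R _ mg leb1 setT f measurableT mf (fun y _ => f0 y).
rewrite preimage_setT /comp => <-.
by apply: eq_measure_integral => A mA _; have := lebesgue_measure_shift c mA.
Qed.

(* Fubini: each fibre of the remaining coordinates is mapped by a triangular map,
   and the first coordinate is translated. *)
Lemma lebesgue_tuple_triangular n (f : n.-tuple mR -> n.-tuple mR) :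
  measurable_fun setT f ->
  (forall (i : 'I_n) t t', (forall j : 'I_n, (j < i)%N -> tnth t j = tnth t' j) ->
     tnth (f t) i - tnth t i = tnth (f t') i - tnth t' i) ->
  forall A, measurable A -> lebesgue_tuple R n (f @^-1` A) = lebesgue_tuple R n A.
Proof.
elim: n f => [|n IH] f mf tri A mA.
  congr (lebesgue_tuple R 0 _); apply/seteqP; split => t /=;
  by rewrite (tuple0 (f t)) (tuple0 t).
rewrite [LHS]/= [RHS]/= /cons_measure /pushforward /product_measure1.
(* At index 0 the premise of triangularity is empty, so the first coordinate moves by a constant,
   which can be read off at any point. *)
pose t0 : n.+1.-tuple mR := [tuple 0 | _ < n.+1].
pose c := tnth (f t0) ord0 - tnth t0 ord0.
have f0 t : tnth (f t) ord0 = tnth t ord0 + c.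
  by apply/eqP; rewrite addrC -subr_eq; apply/eqP; apply: tri.
pose g (z : mR) (t : n.-tuple mR) : n.-tuple mR := [tuple of behead (f (tcons (z, t)))].
have fE z t : f (tcons (z, t)) = tcons (z + c, g z t).
  apply: eq_from_tnth => i; have [->|i0] := eqVneq i ord0; first by rewrite f0.
  have [j ->] : exists j, i = lift ord0 j.
    by case: (unliftP ord0 i) i0 => [j ->|->]; [exists j|rewrite eqxx].
  rewrite [RHS]tnthS tnth_behead; congr (tnth _ _); apply/val_inj.
  by rewrite /= inordK ?ltnS// /bump/= add1n.
pose B : set (mR * n.-tuple mR) := @tcons R n @^-1` A.
have mB : measurable B by rewrite -[B]setTI; exact: measurable_tcons.
(* The section of the preimage at [z] is the preimage under [g z] of the section of [B] at [z + c];
   the induction hypothesis removes [g z]. *)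
transitivity (\int[leb1]_z (lebesgue_tuple R n (xsection B (z + c)%R)))%E.
  apply: eq_integral => z _ /=.
  apply: etrans (IH (g z) _ _ _ _).
  - congr (lebesgue_tuple R n _); apply/seteqP; split => t /=;
    by rewrite /xsection/= !inE/= fE.
  - apply: (measurableT_comp (@measurable_behead _ _ n)).
    apply: (measurableT_comp mf); exact: measurable_fun_pair2 (@measurable_tcons R n).
  - move=> i t t' tt'.
    have E u : tnth (g z u) i - tnth u i =
        tnth (f (tcons (z, u))) (lift ord0 i) - tnth (tcons (z, u)) (lift ord0 i).
      by rewrite fE !tnthS.
    rewrite !E; apply: tri => j; rewrite /= /bump/= add1n ltnS.
    have [->//|j0] := eqVneq j ord0.
    have [k ->] : exists k, j = lift ord0 k.
      by case: (unliftP ord0 j) j0 => [k ->|->]; [exists k|rewrite eqxx].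
    by rewrite /= /bump/= add1n => ki; rewrite !tnthS; exact: tt'.
  - exact: measurable_xsection.
apply: (@ge0_integral_shift c (fun z => lebesgue_tuple R n (xsection B z))) => //.
exact: measurable_fun_xsection.
Qed.

End Triangular.

Section Invariance.
Context (R : realType) (r : nat) (Ns : 'I_r.+1 -> nat).
Variable (G : stratified_group R Ns).
Notation N := (gdim Ns).
Notation V := 'rV[R]_N.
Notation nu := (@lebesgue_rV R N).

Lemma continuous_gopr a : continuous (gop G a).
Proof.
move=> x; apply: (@continuous_comp _ _ _ (fun y => (a, y)) (fun z : V * V => gop G z.1 z.2)).
  by apply: (@continuous_pair V V V (fun=> a) id x); [exact: cst_continuous|move=> A; exact].
exact: continuous_gop.
Qed.

Lemma lebesgue_rV_left_invariant a (A : set V) : measurable A ->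
  nu (gop G a @^-1` A) = nu A.
Proof.
move=> mA; rewrite /lebesgue_rV /pushforward.
pose f (t : N.-tuple (measurableTypeR R)) : N.-tuple (measurableTypeR R) :=
  [tuple gop G a (row_of_tuple t) ord0 i | i < N].
rewrite (_ : _ @^-1` _ = f @^-1` (@row_of_tuple R N @^-1` A)); last first.
  have fE t : row_of_tuple (f t) = gop G a (row_of_tuple t).
    by apply/rowP => i; rewrite mxE tnth_mktuple.
  by apply/seteqP; split => t /=; rewrite fE.
apply: lebesgue_tuple_triangular.
- apply/measurable_fun_tnthP => i.
  rewrite (_ : _ \o _ = (fun x : V => gop G a x ord0 i) \o @row_of_tuple R N); last first.
    by apply/funext => t /=; rewrite tnth_mktuple.
  apply: measurableT_comp; last exact: measurable_row_of_tuple.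
  apply: continuous_measurable_rVT => x.
  apply: (@continuous_comp _ _ _ (gop G a) (fun M : V => M ord0 i)).
    exact: continuous_gopr.
  exact: coord_continuous.
- move=> i t t' tt'; rewrite !tnth_mktuple.
  have := @gop_triangular R r Ns G i a a (row_of_tuple t) (row_of_tuple t')
    (fun _ _ => erefl) _.
  have TT : forall j : 'I_N, (j < i)%N -> (row_of_tuple t) ord0 j = (row_of_tuple t') ord0 j.
    by move=> j ji; rewrite !mxE tt'.
  move=> /(_ TT); rewrite ![row_of_tuple _ ord0 i]mxE => E.
  have : forall u v w z w' : R, u - v - w = z - v - w' -> u - w = z - w' by move=> *; lra.
  by move=> H; exact: H E.
- by rewrite -[X in measurable X]setTI; exact: measurable_row_of_tuple.
Qed.

End Invariance.

(** * Flows of the horizontal fields *)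

Section Flow.
Context (R : realType) (r : nat) (Ns : 'I_r.+1 -> nat).
Variable (G : stratified_group R Ns).
Notation N := (gdim Ns).
Notation V := 'rV[R]_N.
Notation op := (gop G).
Implicit Types (x y a : V) (i : 'I_N).

Let Phi (z : V * V) : V := op z.1 z.2.
Let Phi_C k : Cn k Phi. Proof. exact: gop_smooth. Qed.

Lemma is_derive_gopr a y v : is_derive y v (op a) ('D_(0, v) Phi (a, y)).
Proof.
have [_ /(_ (0, v))[dP _]] := Phi_C 1.
have E : (fun h : R => h^-1 *: ((op a \o shift y) (h *: v) - op a y)) =
  (fun h => h^-1 *: ((Phi \o shift (a, y)) (h *: (0, v)) - Phi (a, y))).
  by apply/funext => h; rewrite /Phi /= scaler0 add0r.
apply: DeriveDef; last by rewrite /derive E.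
by rewrite /derivable E; exact: dP.
Qed.

Lemma is_derive_gopr_coord a y v i :
  is_derive y v (fun y => op a y ord0 i) ('D_(0, v) (gop_coord G i) (a, y)).
Proof.
have E : (fun h : R => h^-1 *: (((fun y => op a y ord0 i) \o shift y) (h *: v) - op a y ord0 i)) =
  (fun h => h^-1 *: ((gop_coord G i \o shift (a, y)) (h *: (0, v)) - gop_coord G i (a, y))).
  by apply/funext => h; rewrite /gop_coord /= scaler0 add0r.
apply: DeriveDef; last by rewrite /derive E.
by rewrite /derivable E; exact: gop_coord_derivable.
Qed.

Variable j : 'I_(Ns ord0).
Notation X := (Xfield G j).
Notation e := (first_layer_basis R j).

Lemma XfieldE x : X x = 'D_(0, e) Phi (x, 0).
Proof. exact: (@derive_val _ _ _ _ _ _ _ (is_derive_gopr x 0 e)). Qed.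

Lemma continuous_Xfield : continuous X.
Proof.
rewrite (_ : X = 'D_(0, e) Phi \o (fun x => (x, 0))); last first.
  by apply/funext => x; rewrite XfieldE.
move=> x; apply: continuous_comp.
  by apply: (@continuous_pair V V V id (fun=> 0) x); [move=> A; exact|exact: cst_continuous].
have [_ /(_ (0, e))[_]] := Phi_C 1; exact.
Qed.

(** The i-th coordinates of [op x y] and [op x' y] differ by x_i - x'_i, which does not depend on
    [y] and disappears on differentiating. *)
Lemma Xfield_triangular x x' i :
  (forall k : 'I_N, (k < i)%N -> x ord0 k = x' ord0 k) -> X x ord0 i = X x' ord0 i.
Proof.
move=> xx'.
have D z : derivable (op z) 0 e by have [] := is_derive_gopr z 0 e.
rewrite /X /Xfield /left_invariant_field (derive_mx (D x)) (derive_mx (D x')) !mxE.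
have E : (fun y => op x y ord0 i) =
    (fun y => op x' y ord0 i) + cst (x ord0 i - x' ord0 i).
  apply/funext => y.
  have := @gop_triangular R r Ns G i x x' y y xx' (fun _ _ => erefl).
  have : forall u v w z k : R, u - v - w = z - k - w -> u = z + (v - k) by move=> *; lra.
  by move=> H /H.
rewrite E deriveD//; last by have [] := is_derive_gopr_coord x' 0 e i.
by rewrite derive_cst addr0.
Qed.

(** By triangularity the right-hand side of the k-th equation is a known continuous function of time
    once the earlier coordinates are found. An antiderivative solves it, and it exists for all
    times, so the curve is global. *)
Lemma integral_curve_ex x : exists gam, integral_curve X x gam.
Proof.
have H m : (m <= N)%N -> exists gam : R -> V, [/\ gam 0 = x, continuous gam &
    forall i, (i < m)%N -> forall t, is_derive t (1 : R) (fun t => gam t ord0 i) (X (gam t) ord0 i)].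
  elim: m => [_|m IH mN].
    by exists (fun=> x); split => //; exact: cst_continuous.
  have [gam [g0 cg dg]] := IH (ltnW mN).
  pose k := Ordinal mN.
  have cf : continuous (fun t => X (gam t) ord0 k).
    move=> t; apply: (@continuous_comp _ _ _ (X \o gam) (fun M : V => M ord0 k)).
      by apply: continuous_comp; [exact: cg|exact: continuous_Xfield].
    exact: coord_continuous.
  have [F [F0 dF]] := antiderivative_ex cf.
  pose gam' t : V := \row_i (if i == k then x ord0 k + F t else gam t ord0 i).
  have agree t i : (i < k)%N -> gam' t ord0 i = gam t ord0 i.
    by move=> ik; rewrite mxE ifF//; apply/negbTE/eqP => ik'; rewrite ik' ltnn in ik.
  have XE t i : (i <= k)%N -> X (gam' t) ord0 i = X (gam t) ord0 i.
    by move=> ik; apply: Xfield_triangular => l li; apply: agree; exact: leq_trans li ik.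
  have dF' t : is_derive t (1 : R) (fun t => gam' t ord0 k) (X (gam' t) ord0 k).
    rewrite XE// (_ : (fun t => gam' t ord0 k) = cst (x ord0 k) + F).
      by rewrite -[X in is_derive _ _ _ X]add0r; exact: is_deriveD.
    by apply/funext => s; rewrite mxE eqxx.
  exists gam'; split.
  - by apply/rowP => i; rewrite mxE g0 F0; case: eqP => // ->; rewrite addr0.
  - move=> t; apply: continuous_row => i.
    have [->|ik] := eqVneq i k.
      apply: differentiable_continuous; apply/derivable1_diffP.
      by have [] := dF' t.
    rewrite (_ : (fun t => gam' t ord0 i) = (fun t => gam t ord0 i)).
      apply: (@continuous_comp _ _ _ gam (fun M : V => M ord0 i)); first exact: cg.
      exact: coord_continuous.
    by apply/funext => s; rewrite mxE (negbTE ik).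
  - move=> i; rewrite ltnS leq_eqVlt => /orP[/eqP ik|im] t.
      by have -> : i = k by [exact/val_inj]; exact: dF'.
    rewrite XE; last exact: ltnW.
    rewrite (_ : (fun t => gam' t ord0 i) = (fun t => gam t ord0 i)); first exact: dg.
    by apply/funext => s; exact: agree.
have [gam [g0 _ dg]] := H N (leqnn _).
by exists gam; split => // t; apply: is_derive_row => i; exact: dg.
Qed.

(** Once two curves agree in the earlier coordinates, their i-th velocities agree too, so the i-th
    coordinates differ by a constant, which is 0 at time 0. *)
Lemma integral_curve_unique x gam gam' :
  integral_curve X x gam -> integral_curve X x gam' -> gam = gam'.
Proof.
move=> [g0 dg] [g0' dg'].
suff H m i : (i < m)%N -> forall t, gam t ord0 i = gam' t ord0 i.
  by apply/funext => t; apply/rowP => i; exact: (H N).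
elim: m i => // m IH i; rewrite ltnS => im t.
have D s : is_derive s (1 : R) (fun s => gam s ord0 i - gam' s ord0 i) 0.
  have D1 := is_derive_coord i (dg s); have D2 := is_derive_coord i (dg' s).
  have := is_deriveB D1 D2.
  rewrite (@Xfield_triangular (gam s) (gam' s) i) ?subrr//.
  by move=> k ki; apply: IH; exact: leq_trans ki im.
have := is_derive0_cst D t; rewrite g0 g0' subrr => /eqP.
by rewrite subr_eq0 => /eqP.
Qed.

Lemma flowP x : integral_curve X x (flow X x).
Proof. exact: getPex (integral_curve_ex x). Qed.

Lemma flow0 x : flow X x 0 = x.
Proof. by have [] := flowP x. Qed.

Lemma is_derive_flow x t : is_derive t (1 : R) (flow X x) (X (flow X x t)).
Proof. by have [] := flowP x. Qed.

Lemma continuous_flow x : continuous (flow X x).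
Proof.
move=> t; apply: differentiable_continuous; apply/derivable1_diffP.
by have [] := is_derive_flow x t.
Qed.

Lemma flowD x s t : flow X (flow X x s) t = flow X x (s + t).
Proof.
suff -> : flow X (flow X x s) = fun t => flow X x (s + t) by [].
apply: integral_curve_unique (flowP _) _; split; first by rewrite addr0.
move=> u; apply: is_derive_row => i.
rewrite -[X in is_derive _ _ _ X]mulr1.
apply: (@is_derive_comp1 R R (fun t => flow X x t ord0 i) (fun t => s + t)).
  exact: is_derive_coord (is_derive_flow x (s + u)).
rewrite -[X in is_derive _ _ _ X]add0r.
exact: is_deriveD (is_derive_cst s u (1 : R)) (is_derive_id u (1 : R)).
Qed.

Lemma is_derive_gopr_comp a (T : normedModType R) (c : T -> V) z w dc i :
  is_derive z w c dc ->
  is_derive z w (fun z => op a (c z) ord0 i) ('D_(0, dc) (gop_coord G i) (a, c z)).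
Proof.
move=> dcz.
have D y v := is_derive_gopr_coord a y v i.
have DE v : 'D_v (fun y => op a y ord0 i) = fun y => 'D_(0, v) (gop_coord G i) (a, y).
  by apply/funext => y; exact: (@derive_val _ _ _ _ _ _ _ (D y v)).
have df : differentiable (fun y => op a y ord0 i) (c z).
  apply: C1_differentiable; first by move=> y v; have [] := D y v.
  move=> v; rewrite DE => y.
  apply: (@continuous_comp _ _ _ (fun y => (a, y)) ('D_(0, v) (gop_coord G i))).
    by apply: (@continuous_pair V V V (fun=> a) id); [exact: cst_continuous|move=> A; exact].
  exact: gop_coord_continuous_derive.
apply: (is_derive_eq (is_derive_diff_comp df dcz)).
exact: (@derive_val _ _ _ _ _ _ _ (D (c z) dc)).
Qed.

(** Differentiate associativity, (a x) y = a (x y), with respect to y at 0. *)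
Lemma Xfield_left_invariant a x i :
  X (op a x) ord0 i = 'D_(0, X x) (gop_coord G i) (a, x).
Proof.
have D := is_derive_gopr x 0 e.
have := is_derive_gopr_comp a i D.
rewrite -XfieldE gopx0 => D'.
have D'' := is_derive_coord i (is_derive_gopr (op a x) 0 e).
rewrite -XfieldE in D''.
rewrite -(@derive_val _ _ _ _ _ _ _ D'') -(@derive_val _ _ _ _ _ _ _ D').
by congr ('D_e _ 0); apply/funext => y; rewrite gopA.
Qed.

(** The left translate by [a] of the curve from [x] solves the equation of the curve from [op a x].
    This is the reason why mollification commutes with horizontal derivatives. *)
Lemma flow_gop a x t : flow X (op a x) t = op a (flow X x t).
Proof.
suff -> : flow X (op a x) = fun t => op a (flow X x t) by [].
apply: integral_curve_unique (flowP _) _; split; first by rewrite flow0.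
move=> s; apply: is_derive_row => i; rewrite Xfield_left_invariant.
exact: is_derive_gopr_comp (is_derive_flow x s).
Qed.

(** [lie_derivable] concerns time 0 only; the group property [flowD] restarts the curve at time
    t. *)
Lemma is_derive_along_flow (u : V -> R) x t :
  lie_derivable X u (flow X x t) ->
  is_derive t (1 : R) (u \o flow X x) (lie_derive X u (flow X x t)).
Proof.
move=> du.
have E : u \o flow X x = (u \o flow X (flow X x t)) \o (fun s => s - t).
  by apply/funext => s /=; rewrite flowD addrC subrK.
rewrite E -[X in is_derive _ _ _ X]mulr1; apply: is_derive_comp1.
  by rewrite subrr; exact: derivableP.
rewrite -[X in is_derive _ _ _ X]subr0.
exact: is_deriveB (is_derive_id t (1 : R)) (is_derive_cst t t (1 : R)).
Qed.

End Flow.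

(** * Boxes and integrals depending on a parameter *)

Section Boxes.
Context (R : realType) (n : nat).
Notation V := 'rV[R]_n.
Notation mR := (measurableTypeR R).
Notation nu := (@lebesgue_rV R n).

Definition box (M : R) : set V := [set x | forall i, `|x ord0 i| < M].

Lemma open_box M : open (box M).
Proof.
rewrite openE => x bx.
apply: (@filter_forall V 'I_n (fun i y => `|y ord0 i| < M) (nbhs x)) => i.
have cn : {for x, continuous (fun y : V => `|y ord0 i|)}.
  apply: (@continuous_comp _ _ _ (fun y : V => y ord0 i) Num.norm).
    exact: coord_continuous.
  exact: norm_continuous.
by apply: (cvgr_lt _ cn); exact: bx.
Qed.

Lemma measurable_box M : measurable (box M).
Proof. by apply: open_measurable_rV; exact: open_box. Qed.

Lemma compact_closed_box M : compact [set x : V | forall i, `|x ord0 i| <= M].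
Proof.
rewrite (_ : mkset _ = [set x : V | forall i, `[- M, M]%classic (x ord0 i)]).
  by apply: (@rV_compact R n (fun=> `[- M, M]%classic)) => i; exact: segment_compact.
by apply/seteqP; split => x /= + i => /(_ i); rewrite in_itv/= ler_norml.
Qed.

Lemma box_closed_box M : box M `<=` [set x : V | forall i, `|x ord0 i| <= M].
Proof. by move=> x bx i; exact/ltW/bx. Qed.

Lemma bounded_sub_box (A : set V) : bounded_set A -> exists2 M, 0 < M & A `<=` box M.
Proof.
move=> [M [_ MA]]; pose M' := Num.max M 0 + 1.
have M'0 : 0 < M' by rewrite ltr_pwDr// le_max lexx orbT.
exists (M' + 1); first by rewrite addr_gt0.
move=> x Ax i; rewrite (le_lt_trans (normr_coord x i))//.
rewrite (@le_lt_trans _ _ M') ?ltrDl//; apply: MA => //.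
by rewrite /M' (@le_lt_trans _ _ (Num.max M 0)) ?ltrDl// le_max lexx.
Qed.

Lemma compact_sub_box (A : set V) : compact A -> exists2 M, 0 < M & A `<=` box M.
Proof. by move=> cA; apply: bounded_sub_box; exact: compact_bounded. Qed.

Lemma nu_box (M : R) : 0 < M -> nu (box M) = ((2 * M) ^+ n)%:E.
Proof.
move=> M0; rewrite /lebesgue_rV /pushforward.
pose tbox m : set (m.-tuple mR) := [set t | forall i, `|tnth t i| < M].
rewrite (_ : _ @^-1` _ = tbox n); last first.
  by apply/seteqP; split => t /= + i => /(_ i); rewrite mxE.
have mtbox m : measurable (tbox m).
  rewrite (_ : tbox m = \bigcap_(i in [set: 'I_m])
      ((fun t => tnth t i) @^-1` `]- M, M[%classic)); last first.
    apply/seteqP; split => t /= + i => /(_ i); last move=> /(_ I);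
      by rewrite /= in_itv/= ltr_norml.
  apply: fin_bigcap_measurable => // i _; rewrite -[X in measurable X]setTI.
  by apply: measurable_tnth.
elim: n => [|m IH].
  rewrite expr0 /= diracE mem_set//; by case.
rewrite [LHS]/= /cons_measure /pushforward.
rewrite (_ : _ @^-1` _ = `]- M, M[%classic `*` tbox m); last first.
  apply/seteqP; split => -[z t] /=.
    move=> h; split; first by have := h ord0; rewrite in_itv/= ltr_norml.
    by move=> i; have := h (lift ord0 i); rewrite tnthS.
  move=> [z0 ht] i; have [->|i0] := eqVneq i ord0.
    by move: z0; rewrite in_itv/= ltr_norml.
  have [k ->] : exists k, i = lift ord0 k.
    by case: (unliftP ord0 i) i0 => [k ->|->]; [exists k|rewrite eqxx].
  by rewrite tnthS; exact: ht.
transitivity ((2 * M)%:E * ((2 * M) ^+ m)%:E)%E; last by rewrite -EFinM -exprS.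
rewrite product_measure1E; [|exact: measurable_itv|exact: mtbox].
congr (_ * _)%E; last exact: IH.
apply: etrans (lebesgue_measure_itv `]- M, M[) _.
rewrite /= lte_fin ifT; last lra.
by rewrite -EFinB; congr EFin; ring.
Qed.

Lemma nu_box_fin (M : R) : (nu (box M) < +oo)%E.
Proof.
have [M0|M0] := ltP 0 M; first by rewrite nu_box// ltry.
have N0 : 0 < 1 :> R by [].
have := nu_box N0 => E; apply: (@le_lt_trans _ _ (nu (box 1))).
  apply: le_measure; rewrite ?inE; try exact: measurable_box.
  by move=> x bx i; apply: lt_le_trans (bx i) _; lra.
by rewrite E ltry.
Qed.

Lemma nu_sub_box (A : set V) M : measurable A -> A `<=` box M -> (nu A < +oo)%E.
Proof.
move=> mA AM; apply: (le_lt_trans _ (nu_box_fin M)).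
by apply: le_measure; rewrite ?inE//; exact: measurable_box.
Qed.

Lemma bounded_integrable (D : set V) (f : V -> R) C : measurable D -> (nu D < +oo)%E ->
  measurable_fun D (f : V -> mR) -> (forall x, D x -> `|f x| <= C) ->
  nu.-integrable D (EFin \o f).
Proof.
move=> mD Doo mf fC; apply: measurable_bounded_integrable => //.
exists C; split; first exact: num_real.
by move=> M CM x Dx; apply: le_trans (fC _ Dx) _; exact: ltW.
Qed.

Lemma cst_integrable (D : set V) (c : R) : measurable D -> (nu D < +oo)%E ->
  nu.-integrable D (EFin \o (fun=> c)).
Proof.
by move=> mD Doo; apply: (@bounded_integrable D _ `|c|).
Qed.

Lemma continuous_bounded_on (T : topologicalType) (f : T -> R) (A : set T) :
  compact A -> continuous f -> exists C, forall x, A x -> `|f x| <= C.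
Proof.
move=> cA cf.
have : compact (f @` A) by apply: continuous_compact => //; exact: continuous_subspaceT.
move=> /compact_bounded [M [_ MA]]; exists (M + 1) => x Ax.
by apply: MA; [rewrite ltrDl|exists x].
Qed.

End Boxes.

Section ParametricIntegral.
Context (R : realType) (n : nat).
Notation V := 'rV[R]_n.
Notation mR := (measurableTypeR R).
Notation nu := (@lebesgue_rV R n).
Variables (M C : R) (psi : V -> R).
Hypothesis cpsi : continuous psi.
Hypothesis psiC : forall w, `|psi w| <= C.

Let B : set V := box M.
Let mB : measurable B. Proof. exact: measurable_box. Qed.
Let cB : compact [set x : V | forall i, `|x ord0 i| <= M].
Proof. exact: compact_closed_box. Qed.
Let C0 : 0 <= C. Proof. exact: le_trans (psiC 0). Qed.

Let slice_continuous (K : V * V -> R) x : continuous K -> continuous (fun w => K (x, w)).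
Proof.
move=> cK w; apply: (@continuous_comp _ _ _ (fun w => (x, w)) K); last exact: cK.
by apply: (@continuous_pair V V V (fun=> x) id); [exact: cst_continuous|move=> A; exact].
Qed.

Let integ (K : V * V -> R) x : continuous K ->
  nu.-integrable B (EFin \o (fun w => K (x, w) * psi w)).
Proof.
move=> cK; have cKx := @slice_continuous K x cK.
have [D KD] := continuous_bounded_on cB cKx.
apply: (@bounded_integrable _ _ _ _ (D * C)) => //; first exact: nu_box_fin.
  apply: (@measurable_funS _ _ _ _ setT) => //.
  apply: continuous_measurable_rVT => w.
  by apply: continuousM; [exact: cKx|exact: cpsi].
move=> w Bw; rewrite normrM ler_pM//; apply: KD; exact: box_closed_box.
Qed.

(** Differentiating in x along v replaces [K] by its derivative in the direction (v, 0), which is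
    again smooth, so the same kind of integral recurs at each order. *)
Lemma Cn_parametric_integral k (K : V * V -> R) : smooth K ->
  Cn k (fun x => \int[nu]_(w in B) (K (x, w) * psi w)).
Proof.
elim: k K => [|k IH] K sK.
  have cK : continuous K := sK 0.
  move=> x; apply/(@cvgrPdist_le _ _ _ (nbhs x)) => e e0.
  pose m := fine (nu B).
  have m0 : 0 <= m by rewrite fine_ge0.
  pose d := e / (C * m + 1).
  have d0 : 0 < d by rewrite divr_gt0// ltr_pwDr// mulr_ge0.
  (* Compactness of the closed box makes the continuity of [K] at [x] uniform in [w]. *)
  have near_x : \forall x' \near x, forall w, B w -> `|K (x, w) - K (x', w)| <= d.
    have := (@compact_near_coveringP _ _).1 cB V (nbhs x)
      (fun x' w => `|K (x, w) - K (x', w)| <= d) _.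
    move=> H; have {}H : \forall x' \near x, [set x : V | forall i, `|x ord0 i| <= M] `<=`
        (fun w => `|K (x, w) - K (x', w)| <= d).
      apply: H => w _.
      pose g (q : V * V) := `|K (x, q.1) - K (q.2, q.1)|.
      have cg : {for (w, x), continuous g}.
        apply: (@continuous_comp _ _ _ (fun q : V * V => K (x, q.1) - K (q.2, q.1)) Num.norm).
          apply: continuousB.
            apply: (@continuous_comp _ _ _ fst (fun w => K (x, w))); first exact: cvg_fst.
            exact: slice_continuous.
          apply: (@continuous_comp _ _ _ (fun q : V * V => (q.2, q.1)) K); last exact: cK.
          by apply: (@continuous_pair _ V V snd fst); [exact: cvg_snd|exact: cvg_fst].
        exact: norm_continuous.
      have : \forall q \near (w, x), g q < d.
        by apply: (cvgr_lt _ cg); rewrite /g/= subrr normr0.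
      by apply: filterS => q /ltW.
    by apply: filterS H => x' H w Bw; apply: H; exact: box_closed_box.
  apply: filterS near_x => x' near_x.
  rewrite -RintegralB//; [|exact: integ..].
  have iD : nu.-integrable B (EFin \o (fun w => K (x, w) * psi w - K (x', w) * psi w)).
    have := integrableB mB (@integ K x cK) (@integ K x' cK).
    by apply: eq_integrable => // w _; rewrite /= EFinB.
  apply: (le_trans (le_normr_Rintegral _ iD)) => //.
  apply: (@le_trans _ _ (\int[nu]_(w in B) (d * C))).
    apply: le_Rintegral => //.
    - by have := integrable_norm iD.
    - by apply: cst_integrable => //; exact: nu_box_fin.
    - by move=> w Bw; rewrite -mulrBl normrM ler_pM// near_x.
  have X0 : 0 < C * m + 1 by rewrite ltr_pwDr// mulr_ge0.
  have Ed : d * C * m = e * (C * m) / (C * m + 1) by rewrite /d; field; rewrite gt_eqF.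
  rewrite (@Rintegral_cst _ _ _ nu B mB (d * C)) -/m Ed ler_pdivrMr//.
  by rewrite ler_pM2l// lerDl.
have cK : continuous K := sK 0.
have D x v : is_derive x v (fun x => \int[nu]_(w in B) (K (x, w) * psi w))
    (\int[nu]_(w in B) ('D_(v, 0) K (x, w) * psi w)).
  have [_ /(_ (v, 0))[dK cdK]] := sK 1.
  pose f (t : R) w := K (x + t *: v, w) * psi w.
  have lineE t w : (x + t *: v, w) = (x, w) + t *: ((v, 0) : V * V).
    by apply: injective_projections => /=; rewrite ?scaler0 ?addr0.
  have df t w : is_derive t (1 : R) (f ^~ w) ('D_(v, 0) K (x + t *: v, w) * psi w).
    rewrite mulrC /f (_ : (fun x0 => _) = fun t => psi w * K ((x, w) + t *: (v, 0))); last first.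
      by apply/funext => s; rewrite mulrC lineE.
    apply: is_derive_scale; rewrite lineE.
    exact: is_derive_line.
  (* A bound on the derivative, uniform for |t| <= 1 and over the closed box, gives a constant
     dominating function. *)
  have [Cd dKC] : exists Cd, forall q : R * V, (`[-1, 1]%classic `*` [set x : V | forall i, `|x ord0 i| <= M]) q ->
      `|'D_(v, 0) K (x + q.1 *: v, q.2)| <= Cd.
    apply: continuous_bounded_on; first by apply: compact_setX => //; exact: segment_compact.
    move=> q; apply: (@continuous_comp _ _ _ (fun q : R * V => (x + q.1 *: v, q.2)) ('D_(v, 0) K)).
      apply: (@continuous_pair _ V V (fun q : R * V => x + q.1 *: v) snd); last exact: cvg_snd.
      apply: continuousD; first exact: cst_continuous.
      apply: continuousZr_tmp; exact: cvg_fst.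
    exact: cdK.
  have Cd0 : B 0 -> 0 <= Cd.
    move=> B0; apply: le_trans (dKC (0, 0) _); first exact: normr_ge0.
    by split; [rewrite /= in_itv/= lerN10 ler01|exact: box_closed_box].
  have I0 : `]-1, 1[%classic (0 : R) by rewrite /= in_itv/= ltrN10 ltr01.
  have intf t : `]-1, 1[%classic t -> nu.-integrable B (EFin \o f t) by move=> _; exact: integ.
  have derf t w : `]-1, 1[%classic t -> B w -> derivable (f ^~ w) t 1.
    by move=> _ _; have [] := df t w.
  (* The absolute value is there because [Cd] may be negative when the box is empty. *)
  have G0 (w : V) : 0 <= (cst (`|Cd| * C) w : R) by rewrite /= mulr_ge0.
  have intG : nu.-integrable B (EFin \o cst (`|Cd| * C)).
    by apply: cst_integrable => //; exact: nu_box_fin.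
  have Gub t w : `]-1, 1[%classic t -> B w -> `|partial1of2 f t w| <= cst (`|Cd| * C) w.
    move=> It Bw; rewrite partial1of2E (@derive_val _ _ _ _ _ _ _ (df t w)) normrM ler_pM//.
    apply: le_trans (ler_norm Cd); apply: (dKC (t, w)); split => /=; last exact: box_closed_box.
    by move: It; rewrite /= !in_itv/= => /andP[/ltW -> /ltW ->].
  have dF := derivable_under_integral mB I0 intf derf G0 intG Gub.
  have EF := differentiation_under_integral mB I0 intf derf G0 intG Gub.
  have E : (fun h : R => h^-1 *: (((fun x => \int[nu]_(w in B) (K (x, w) * psi w)) \o shift x) (h *: v)
       - \int[nu]_(w in B) (K (x, w) * psi w))) =
     (fun h : R => h^-1 *: (((fun t => \int[nu]_(w in B) f t w) \o shift 0) (h *: 1) - \int[nu]_(w in B) f 0 w)).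
    apply/funext => h; rewrite /f /= scale0r !addr0 [h *: 1]mulr1.
    by rewrite [h *: v + x]addrC.
  apply: DeriveDef; first by rewrite /derivable E; exact: dF.
  rewrite /derive E -[LHS]/('D_1 (fun t => \int[nu]_(w in B) f t w) 0) -derive1E EF.
  apply: eq_Rintegral => w _ /=.
  rewrite partial1of2E (@derive_val _ _ _ _ _ _ _ (df 0 w)) scale0r addr0//.
split.
  by move=> x; apply: (Cn_continuous (IH K sK)).
move=> v; split; first by move=> x; have [] := D x v.
rewrite [X in Cn _ X](_ : _ = fun x => \int[nu]_(w in B) ('D_(v, 0) K (x, w) * psi w)).
  apply: (IH ('D_(v, 0) K)) => m.
  by have [_ /(_ (v, 0))[]] := sK m.+1.
by apply/funext => x; exact: (@derive_val _ _ _ _ _ _ _ (D x v)).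
Qed.

End ParametricIntegral.

(** * Mollification along the group *)

Section Mollify.
Context (R : realType) (r : nat) (Ns : 'I_r.+1 -> nat).
Variable (G : stratified_group R Ns).
Notation N := (gdim Ns).
Notation V := 'rV[R]_N.
Notation nu := (@lebesgue_rV R N).
Notation op := (gop G).
Notation inv := (ginv G).
Implicit Types (x y : V) (psi : V -> R).

Lemma box_integrable psi M : continuous psi ->
  nu.-integrable (box M) (EFin \o psi).
Proof.
move=> cpsi; have [C psiC] := continuous_bounded_on (@compact_closed_box R N M) cpsi.
apply: (@bounded_integrable _ _ _ _ C); [exact: measurable_box|exact: nu_box_fin| |].
  apply: (@measurable_funS _ _ _ _ setT) => //.
  exact: continuous_measurable_rVT.
by move=> x bx; apply: psiC; exact: box_closed_box.
Qed.

Lemma continuous_sbump e : continuous (@sbump R N e).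
Proof. exact: sbump_smooth 0%N. Qed.

Lemma sbump_out e x : ~ box e x -> sbump e x = 0.
Proof.
by move=> /existsNP[i /negP]; rewrite -leNgt; exact: sbump_eq0.
Qed.

Definition sbump_mass e : R := \int[nu]_(y in box e) sbump e y.

(** If the integral were 0, the nonnegative bump would vanish almost everywhere on the box, where it
    is positive; but the box has positive measure. *)
Lemma sbump_mass_gt0 e : 0 < e -> 0 < sbump_mass e.
Proof.
move=> e0; rewrite lt_neqAle Rintegral_ge0 ?andbT; last first.
  by move=> x _; exact: sbump_ge0.
apply/eqP => m0.
have mB := @measurable_box R N e.
have iB := @box_integrable _ e (@continuous_sbump e).
have I0 : (\int[nu]_(y in box e) `|(sbump e y)%:E| = 0)%E.
  rewrite (eq_integral (fun y => (sbump e y)%:E)); last first.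
    by move=> y _; rewrite gee0_abs// lee_fin sbump_ge0.
  rewrite -[LHS]fineK; last exact: integrable_fin_num.
  by congr EFin; rewrite m0.
have /ae_eq_integral_abs : measurable_fun (box e) (EFin \o @sbump R N e).
  by case/integrableP : iB.
move=> /(_ nu mB)/iffLR/(_ I0).
move=> /negligibleP; rewrite (_ : ~` _ = box e).
  move=> /(_ mB) Z; have Z' : nu (box e) = 0%E by exact: Z.
  have := @nu_box R N e e0; rewrite Z' => /eqP; rewrite eqe eq_sym expf_eq0 mulf_eq0.
  by rewrite pnatr_eq0/= gt_eqF// andbF.
apply/seteqP; split => x /=.
  by apply: contra_notP => nx /nx.
move=> bx /(_ bx) /= [] /eqP; apply/negP.
by rewrite gt_eqF// sbump_gt0.
Qed.

(* Translating by [inv y] on the left commutes with the left invariant fields. *)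
Definition mollify psi e x : R :=
  (\int[nu]_(y in box e) (sbump e y * psi (op (inv y) x))) / sbump_mass e.

Lemma continuous_ginv : continuous inv.
Proof. exact: ginv_smooth 0%N. Qed.

Lemma continuous_gop_comp (T : topologicalType) (f g : T -> V) (t : T) :
  {for t, continuous f} -> {for t, continuous g} ->
  {for t, continuous (fun s => op (f s) (g s))}.
Proof.
move=> cf cg.
apply: (@continuous_comp _ _ _ (fun s => (f s, g s)) (fun z : V * V => op z.1 z.2)).
  exact: continuous_pair.
exact: continuous_gop.
Qed.

Lemma continuous_mollify_integrand psi e x : continuous psi ->
  continuous (fun y => sbump e y * psi (op (inv y) x)).
Proof.
move=> cpsi y; apply: continuousM; first exact: continuous_sbump.
apply: (@continuous_comp _ _ _ (fun y => op (inv y) x) psi); last exact: cpsi.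
by apply: continuous_gop_comp; [exact: continuous_ginv|exact: cst_continuous].
Qed.

(** The mollification is a weighted mean of the values psi(y^-1 x), so it stays as close to [a] as
    they do. Pointwise convergence, sup bounds and control of the support all follow from this. *)
Lemma mollify_near psi e x (a d : R) : 0 < e -> continuous psi ->
  (forall y, box e y -> `|psi (op (inv y) x) - a| <= d) ->
  `|mollify psi e x - a| <= d.
Proof.
move=> e0 cpsi H; have c0 := sbump_mass_gt0 e0.
have mB := @measurable_box R N e.
have i1 := @box_integrable _ e (@continuous_mollify_integrand psi e x cpsi).
have i2 : nu.-integrable (box e) (EFin \o (fun y => sbump e y * a)).
  apply: box_integrable => y; apply: continuousM; first exact: continuous_sbump.
  exact: cst_continuous.
have i3 : nu.-integrable (box e) (EFin \o (fun y => sbump e y * d)).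
  apply: box_integrable => y; apply: continuousM; first exact: continuous_sbump.
  exact: cst_continuous.
have i4 : nu.-integrable (box e) (EFin \o (fun y => sbump e y * psi (op (inv y) x) - sbump e y * a)).
  have := integrableB mB i1 i2.
  by apply: eq_integrable => // w _; rewrite /= EFinB.
have mass z : \int[nu]_(y in box e) (sbump e y * z) = sbump_mass e * z.
  by rewrite RintegralZr//; exact: box_integrable (@continuous_sbump e).
have cn0 : sbump_mass e != 0 by rewrite gt_eqF.
rewrite /mollify -[a](mulfK cn0) [a * _]mulrC -mulrBl normrM.
rewrite [`|_^-1|]gtr0_norm ?invr_gt0// ler_pdivrMr// -mass -RintegralB//.
apply: (le_trans (le_normr_Rintegral _ i4)) => //.
rewrite [d * _]mulrC -mass; apply: le_Rintegral => //.
  by have := integrable_norm i4.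
move=> y By; rewrite -mulrBr normrM ger0_norm ?sbump_ge0//.
by rewrite ler_wpM2l ?sbump_ge0//; exact: H.
Qed.

Lemma cvg_mollify psi x : continuous psi ->
  mollify psi k.+1%:R^-1 x @[k --> \oo] --> psi x.
Proof.
move=> cpsi; apply/cvgrPdist_le => d d0.
have cf : {for 0, continuous (fun y => psi (op (inv y) x))}.
  apply: (@continuous_comp _ _ _ (fun y => op (inv y) x) psi); last exact: cpsi.
  by apply: continuous_gop_comp; [exact: continuous_ginv|exact: cst_continuous].
have inv0 : inv 0 = 0 by rewrite -[LHS](gopx0 G) gopVx.
have : \forall y \near (0 : V), `|psi (op (inv y) x) - psi x| <= d.
  have /(@cvgrPdist_le _ _ _ (nbhs (0 : V)))/(_ d d0) := cf.
  by rewrite inv0 gop0x; apply: filterS => y; rewrite distrC.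
move=> /nbhs_normP[s /= s0 hs].
have : \forall k \near \oo, k.+1%:R^-1 < s
  by have := near_infty_natSinv_lt (PosNum s0).
apply: filterS => k ks; rewrite distrC; apply: mollify_near => //.
move=> y By; apply: hs; rewrite /= sub0r normrN.
apply: le_lt_trans ks; apply: norm_row_le => // i; exact/ltW/By.
Unshelve. all: by end_near. Qed.

Lemma mollify_le psi e x C : 0 < e -> continuous psi ->
  (forall y, `|psi y| <= C) -> `|mollify psi e x| <= C.
Proof.
move=> e0 cpsi psiC; rewrite -[mollify _ _ _]subr0; apply: mollify_near => // y _.
by rewrite subr0.
Qed.

(* The substitution y = x w moves the variable x from psi to the smooth bump. *)
Lemma smooth_mollify psi e : 0 < e -> continuous psi ->
  compact (closure [set x | psi x != 0]) -> smooth (mollify psi e).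
Proof.
move=> e0 cpsi cK.
set K := closure _ in cK.
have cinvK : compact (inv @` K).
  by apply: continuous_compact => //; apply: continuous_subspaceT; exact: continuous_ginv.
have [M M0 KM] := compact_sub_box cinvK.
have invK : involutive inv.
  by move=> y; rewrite -[LHS](gopx0 G) -(gopVx G y) gopA gopVx gop0x.
pose phi w := psi (inv w).
have phi_out w : ~ box M w -> phi w = 0.
  move=> nw; apply/eqP/negP => /negP phiw; apply: nw; apply: KM.
  exists (inv w); last by rewrite invK.
  by apply: subset_closure.
have cphi : continuous phi.
  by move=> w; apply: (@continuous_comp _ _ _ inv psi); [exact: continuous_ginv|exact: cpsi].
have [C psiC] : exists C, forall w, `|phi w| <= C.
  have [C phiC] := continuous_bounded_on (@compact_closed_box R N M) cphi.
  exists (Num.max C 0) => w; have [bw|nw] := pselect (box M w).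
    by rewrite le_max phiC//; exact: box_closed_box.
  by rewrite phi_out// normr0 le_max lexx orbT.
have E x : mollify psi e x =
    (sbump_mass e)^-1 * \int[nu]_(w in box M) (sbump e (op x w) * phi w).
  rewrite mulrC /mollify; congr (_ / _).
  pose h y := sbump e y * psi (op (inv y) x).
  have ch : continuous h by exact: continuous_mollify_integrand.
  (* For y = x w one has y^-1 x = w^-1. *)
  have hE w : h (op x w) = sbump e (op x w) * phi w.
    rewrite /h /phi; congr (_ * psi _).
    have : op (op (inv (op x w)) x) w = 0 by rewrite -gopA gopVx.
    move=> H; rewrite -[LHS](gopx0 G) -(gopxV G w) gopA H gop0x//.
  rewrite [X in _ = Rintegral _ _ X](_ : _ = fun w => h (op x w)); last first.
    by apply/funext => w; rewrite hE.
  (* Both integrands vanish outside their boxes, so both integrals may be taken over the whole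
     space, where left translation by [x] preserves the measure. *)
  have hout y : ~ box e y -> h y = 0 by move=> /sbump_out; rewrite /h => ->; rewrite mul0r.
  have hout' w : ~ box M w -> h (op x w) = 0 by move=> nw; rewrite hE phi_out// mulr0.
  have patchT (D : set V) (f : V -> R) : (forall y, ~ D y -> f y = 0) -> f \_ D = f.
    move=> fD; apply/funext => y; rewrite patchE; case: ifPn => //.
    by move=> /negP; rewrite inE => /fD.
  rewrite Rintegral_mkcond (patchT (box e) h)//.
  rewrite [RHS]Rintegral_mkcond (patchT (box M) (fun w => h (op x w)))//.
  have chop : continuous (fun w => h (op x w)).
    by move=> w; apply: (@continuous_comp _ _ _ (op x) h); [exact: continuous_gopr|exact: ch].
  have ih : nu.-integrable setT (EFin \o (fun w => h (op x w))).
    have /(integrable_mkcond _ (measurable_box M)) := @box_integrable _ M chop.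
    apply: eq_integrable => // w _; rewrite patchE; case: ifPn => // /negP.
    by rewrite inE => /hout' /= ->.
  have mh : measurable_fun setT (EFin \o (h : V -> measurableTypeR R)).
    by apply/measurable_EFinP; exact: continuous_measurable_rVT.
  have mop : measurable_fun setT (op x : V -> V).
    move=> _ ; apply: (measurability (@open V)) => // _ [U oU <-]; rewrite setTI.
    apply: open_measurable_rV; apply: open_comp => // y _; exact: continuous_gopr.
  rewrite /Rintegral; congr fine.
  apply: etrans _ (integral_pushforward mop mh ih measurableT).
  apply: eq_measure_integral => A mA _.
  exact: (esym (lebesgue_rV_left_invariant _ _ _)).
move=> k; rewrite (_ : mollify psi e = fun x => (sbump_mass e)^-1 *
   \int[nu]_(w in box M) (sbump e (op (x, w).1 (x, w).2) * phi w)); last first.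
  by apply/funext => x; rewrite E.
apply: CnM; first exact: Cn_cst.
apply: (@Cn_parametric_integral R N M C phi cphi psiC k (fun z => sbump e (op z.1 z.2))).
move=> m; apply: (@Cn_comp R _ m N (@sbump R N e) (fun z : V * V => op z.1 z.2)).
  exact: sbump_smooth.
exact: gop_smooth.
Qed.

End Mollify.

(** * From smooth to horizontally C^1 test functions *)

Lemma cvg_integral_dominated d (T : measurableType d) (R : realType)
    (mu : {measure set T -> \bar R}) (D : set T) (f_ : nat -> T -> R) (f : T -> R) (g : T -> \bar R) :
  measurable D ->
  (forall k, measurable_fun D (f_ k : T -> measurableTypeR R)) ->
  measurable_fun D (f : T -> measurableTypeR R) ->
  mu.-integrable D g ->
  {ae mu, forall x, D x -> f_ ^~ x @ \oo --> f x /\ forall k, (`|f_ k x|%:E <= g x)%E} ->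
  mu.-integrable D (EFin \o f) /\
  (\int[mu]_(x in D) (f_ k x)%:E)%E @[k --> \oo] --> (\int[mu]_(x in D) (f x)%:E)%E.
Proof.
move=> mD mf_ mf ig fg.
have m1 k : measurable_fun D (fun x => (f_ k x)%:E) by apply/measurable_EFinP; exact: mf_.
have m2 : measurable_fun D (EFin \o f) by apply/measurable_EFinP.
have c : {ae mu, forall x, D x -> (f_ k x)%:E @[k --> \oo] --> (EFin \o f) x}.
  apply: filterS fg => x H Dx; have [fx _] := H Dx.
  by apply: cvg_EFin; [exact: nearW|exact: fx].
have g1 : {ae mu, forall x k, D x -> (`|(f_ k x)%:E| <= g x)%E}.
  by apply: filterS fg => x H k Dx; have [_ /(_ k)] := H Dx.
by have [] := dominated_convergence mD m1 m2 c ig g1.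
Qed.

Section C1cFacts.
Context (R : realType) (r : nat) (Ns : 'I_r.+1 -> nat).
Variable (G : stratified_group R Ns).
Notation N := (gdim Ns).
Notation V := 'rV[R]_N.
Notation H := 'rV[R]_(Ns ord0).
Notation nu := (@lebesgue_rV R N).
Notation op := (gop G).
Notation inv := (ginv G).
Notation Xf j := (Xfield G j).
Implicit Types (x y : V) (j : 'I_(Ns ord0)).
Variable (Om : set V).
Hypothesis oOm : open Om.

Lemma continuous_vanish_bounded (f : V -> R) (K : set V) : compact K ->
  continuous f -> (forall x, ~ K x -> f x = 0) -> exists C, forall x, `|f x| <= C.
Proof.
move=> cK cf f0; have [C fC] := continuous_bounded_on cK cf.
exists (Num.max C 0) => x; have [Kx|nKx] := pselect (K x).
  by rewrite le_max fC.
by rewrite f0// normr0 le_max lexx orbT.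
Qed.

Lemma near_flow x j (P : V -> Prop) : (\forall y \near x, P y) ->
  \forall t \near (0 : R), P (flow (Xf j) x t).
Proof.
move=> Px; have cfl : {for 0, continuous (flow (Xf j) x)} by exact: continuous_flow.
by apply: cfl; rewrite flow0.
Qed.

Lemma is_derive_flow_vanish (phi : V -> R) x j :
  (\forall y \near x, phi y = 0) ->
  is_derive (0 : R) (1 : R) (phi \o flow (Xf j) x) 0.
Proof.
move=> phi0; apply: near_eq_is_derive (is_derive_cst 0 (0 : R) (1 : R)).
by apply: filterS (near_flow j phi0) => t /= ->.
Qed.

Section OneFunction.
Variable (phi : V -> R).
Hypothesis phiC1 : C1c G Om phi.

Let K := closure [set x | phi x != 0].
Let cK : compact K. Proof. by have [[]] := phiC1. Qed.
Let KOm : K `<=` Om. Proof. by have [[]] := phiC1. Qed.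
Let cphi : continuous phi. Proof. by have [] := phiC1. Qed.

Lemma near_vanish x : ~ K x -> \forall y \near x, phi y = 0.
Proof.
move=> nKx; have : open (~` K) by apply: closed_openC; exact: closed_closure.
move=> oK; have : nbhs x (~` K) by apply: open_nbhs_nbhs.
apply: filterS => y nKy; apply/eqP/negP => /negP phiy; apply: nKy.
exact: subset_closure.
Qed.

Lemma C1c_vanish x : ~ K x -> phi x = 0.
Proof. by move=> /near_vanish/nbhs_singleton. Qed.

Lemma lie_derive_vanish x j : ~ K x -> lie_derive (Xf j) phi x = 0.
Proof.
move=> /near_vanish/(is_derive_flow_vanish j) D.
exact: (@derive_val _ _ _ _ _ _ _ D).
Qed.

(** [C1c] gives this on [Om] only. Off the support, which lies in [Om], the function is locally
    zero, and so it is along the flow for small times. *)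
Lemma C1c_lie_derivable x j : lie_derivable (Xf j) phi x.
Proof.
have [Kx|/near_vanish/(is_derive_flow_vanish j)[]//] := pselect (K x).
by have [_ _ /(_ x j (KOm Kx))] := phiC1.
Qed.

Lemma C1c_continuous_lie_derive j : continuous (lie_derive (Xf j) phi).
Proof.
move=> x; have [Kx|nKx] := pselect (K x).
  have [_ _ _] := phiC1; rewrite continuous_open_subspace// => /in_setP/(_ x (KOm Kx)) ch.
  rewrite (_ : lie_derive _ _ = fun y => hgrad G phi y ord0 j); last first.
    by apply/funext => y; rewrite mxE.
  apply: (@continuous_comp _ _ _ (hgrad G phi) (fun M : H => M ord0 j)) => //.
  exact: coord_continuous.
have oK : open (~` K) by apply: closed_openC; exact: closed_closure.
have near0 : \forall y \near x, 0 = lie_derive (Xf j) phi y.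
  have : nbhs x (~` K) by apply: open_nbhs_nbhs.
  by apply: filterS => y /lie_derive_vanish ->.
rewrite /continuous_at lie_derive_vanish//.
exact: (cvg_trans (near_eq_cvg near0) (cvg_cst _)).
Qed.

Lemma is_derive_C1c_flow x j t :
  is_derive t (1 : R) (phi \o flow (Xf j) x) (lie_derive (Xf j) phi (flow (Xf j) x t)).
Proof. by apply: is_derive_along_flow; exact: C1c_lie_derivable. Qed.

(** By [flow_gop], translating by y^-1 turns the curve from x into the curve from y^-1 x, so
    differentiating under the integral produces the Lie derivative of [phi] at y^-1 x. *)
Lemma is_derive_mollify_flow e x j : 0 < e ->
  is_derive (0 : R) (1 : R) (mollify G phi e \o flow (Xf j) x)
    (mollify G (lie_derive (Xf j) phi) e x).
Proof.
move=> e0.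
pose w := lie_derive (Xf j) phi.
have cw : continuous w by exact: C1c_continuous_lie_derive.
have [C wC] : exists C, forall y, `|w y| <= C.
  by apply: continuous_vanish_bounded cK cw _ => y; exact: lie_derive_vanish.
pose f (t : R) y := sbump e y * phi (op (inv y) (flow (Xf j) x t)).
have df t y : is_derive t (1 : R) (f ^~ y) (sbump e y * w (op (inv y) (flow (Xf j) x t))).
  rewrite /f; under eq_fun do rewrite -flow_gop.
  by apply: is_derive_scale; rewrite -flow_gop; exact: is_derive_C1c_flow.
have mB := @measurable_box R N e.
have I0 : `]-1, 1[%classic (0 : R) by rewrite /= in_itv/= ltrN10 ltr01.
have intf t : `]-1, 1[%classic t -> nu.-integrable (box e) (EFin \o f t).
  by move=> _; apply: box_integrable; exact: continuous_mollify_integrand.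
have derf t y : `]-1, 1[%classic t -> box e y -> derivable (f ^~ y) t 1.
  by move=> _ _; have [] := df t y.
have G0 (y : V) : 0 <= sbump e y * C.
  by rewrite mulr_ge0 ?sbump_ge0// (le_trans _ (wC 0)).
have intG : nu.-integrable (box e) (EFin \o (fun y => sbump e y * C)).
  apply: box_integrable => y; apply: continuousM; first exact: continuous_sbump.
  exact: cst_continuous.
have Gub t y : `]-1, 1[%classic t -> box e y -> `|partial1of2 f t y| <= sbump e y * C.
  move=> _ _; rewrite partial1of2E (@derive_val _ _ _ _ _ _ _ (df t y)) normrM.
  by rewrite ger0_norm ?sbump_ge0// ler_wpM2l ?sbump_ge0.
have dF := derivable_under_integral mB I0 intf derf G0 intG Gub.
have EF := differentiation_under_integral mB I0 intf derf G0 intG Gub.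
have D : is_derive (0 : R) (1 : R) (fun t => \int[nu]_(y in box e) f t y)
    (\int[nu]_(y in box e) (sbump e y * w (op (inv y) x))).
  apply: DeriveDef => //; rewrite -derive1E EF; apply: eq_Rintegral => y _ /=.
  by rewrite partial1of2E (@derive_val _ _ _ _ _ _ _ (df 0 y)) flow0.
rewrite /mollify mulrC.
rewrite (_ : _ \o _ = fun t => (sbump_mass Ns e)^-1 * \int[nu]_(y in box e) f t y).
  exact: is_derive_scale.
by apply/funext => t /=; rewrite mulrC.
Qed.

Lemma hgrad_mollify e x : 0 < e ->
  hgrad G (mollify G phi e) x = \row_j mollify G (lie_derive (Xf j) phi) e x.
Proof.
move=> e0; apply/rowP => j; rewrite !mxE.
exact: (@derive_val _ _ _ _ _ _ _ (is_derive_mollify_flow x j e0)).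
Qed.

(** The mean can be nonzero only on the product of the closed box and the support of [phi]. This set
    is compact and, by compactness of the support, inside [Om] once the box is small. *)
Lemma mollify_Coo_c : \forall k \near \oo, Coo_c Om (mollify G phi k.+1%:R^-1).
Proof.
have nearOm : \forall y \near (0 : V), K `<=` (fun k => Om (op y k)).
  have := (@compact_near_coveringP _ _).1 cK V (nbhs (0 : V)) (fun y k => Om (op y k)) _.
  apply => k Kk.
  have ck : {for (k, 0), continuous (fun q : V * V => op q.2 q.1)}.
    by apply: continuous_gop_comp; [exact: cvg_snd|exact: cvg_fst].
  have := ck Om; apply; rewrite gop0x; apply: open_nbhs_nbhs; split => //.
  exact: KOm.
have /nbhs_normP[s /= s0 hs] := nearOm.
have : \forall k \near \oo, k.+1%:R^-1 < s by have := near_infty_natSinv_lt (PosNum s0).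
apply: filterS => k ks; set e := k.+1%:R^-1.
have e0 : 0 < e by rewrite invr_gt0.
split; first exact: smooth_mollify.
pose B := [set y : V | forall i, `|y ord0 i| <= e].
pose S := (fun q : V * V => op q.1 q.2) @` (B `*` K).
have cS : compact S.
  apply: continuous_compact; last by apply: compact_setX => //; exact: compact_closed_box.
  by apply: continuous_subspaceT; exact: continuous_gop.
have SOm : S `<=` Om.
  move=> _ [[y z] [/= By Kz] <-] /=; apply: hs Kz; rewrite /= sub0r normrN.
  by apply: le_lt_trans ks; apply: norm_row_le => //; exact: ltW.
have clS : closed S by apply: compact_closed => //; exact: norm_hausdorff.
have suppS : [set x | mollify G phi e x != 0] `<=` S.
  move=> x /= mx; apply: contrapT => nS; move/eqP: mx; apply.
  have Z : `|mollify G phi e x - 0| <= 0.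
    apply: mollify_near => // y By.
    rewrite C1c_vanish ?subrr ?normr0// => Ky; apply: nS.
    exists (y, op (inv y) x); last by rewrite /= gopA gopxV gop0x.
    by split => //=; exact: box_closed_box.
  by apply/eqP; rewrite -normr_le0 -[mollify _ _ _ _]subr0.
have clSS : closure [set x | mollify G phi e x != 0] `<=` S.
  by move: clS => /closure_id ->; exact: closure_subset.
split; last exact: subset_trans clSS SOm.
exact: subclosed_compact (@closed_closure _ _) cS clSS.
Qed.

End OneFunction.

(** The mollified functions and their horizontal gradients converge pointwise with sup bounds
    independent of k, which suffices for dominated convergence against the integrable [A] and
    [f]. *)
Lemma weak_form_C1c (A : V -> H) (f : V -> R) :
  (forall j, nu.-integrable Om (EFin \o (fun x => A x ord0 j))) ->
  nu.-integrable Om (EFin \o f) ->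
  (forall phi, Coo_c Om phi ->
    (\int[nu]_(x in Om) (dotv (A x) (hgrad G phi x))%:E =
     \int[nu]_(x in Om) (f x * phi x)%:E)%E) ->
  forall phi, C1c G Om phi ->
    (\int[nu]_(x in Om) (dotv (A x) (hgrad G phi x))%:E =
     \int[nu]_(x in Om) (f x * phi x)%:E)%E.
Proof.
move=> iA intf weak phi C1phi.
have mOm : measurable Om by exact: open_measurable_rV.
have [[cK _] cphi _ _] := C1phi.
have [C phiC] : exists C, forall y, `|phi y| <= C.
  by apply: continuous_vanish_bounded cK cphi _ => y; exact: C1c_vanish.
have cw j : continuous (lie_derive (Xf j) phi).
  exact: (C1c_continuous_lie_derive C1phi).
have wC j : exists C, forall y, `|lie_derive (Xf j) phi y| <= C.
  apply: continuous_vanish_bounded cK (cw j) _ => y; exact: lie_derive_vanish.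
pose D j := sval (cid (wC j)).
have wD j y : `|lie_derive (Xf j) phi y| <= D j by rewrite /D; case: cid => /=.
pose e (k : nat) : R := k.+1%:R^-1.
have e0 k : 0 < e k by rewrite invr_gt0.
pose phik k := mollify G phi (e k).
have mcont (psi : V -> R) : continuous psi -> measurable_fun Om (psi : V -> measurableTypeR R).
  by move=> cp; apply: (@measurable_funS _ _ _ _ setT) => //; exact: continuous_measurable_rVT.
have cmol k : continuous (phik k).
  by exact: (Cn_continuous (@smooth_mollify _ _ _ G _ _ (e0 k) cphi cK 0%N)).
have mA j : measurable_fun Om ((fun x => A x ord0 j) : V -> measurableTypeR R).
  by have /integrableP[/measurable_EFinP] := iA j.
have mf : measurable_fun Om (f : V -> measurableTypeR R).
  by have /integrableP[/measurable_EFinP] := intf.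
have cwk j k : continuous (mollify G (lie_derive (Xf j) phi) (e k)).
  apply: (Cn_continuous (@smooth_mollify _ _ _ G _ _ (e0 k) (@cw j) _ 0%N)).
  apply: subclosed_compact (@closed_closure _ _) cK _.
  rewrite [X in _ `<=` X](closure_id _).1; last exact: closed_closure.
  apply: closure_subset => y /= wy; apply: contrapT => nK; move: wy.
  by rewrite lie_derive_vanish// eqxx.
have mL k : measurable_fun Om ((fun x => dotv (A x) (hgrad G (phik k) x)) : V -> measurableTypeR R).
  rewrite /dotv; apply: measurable_sum => j; apply: measurable_funM; first exact: mA.
  by under eq_fun do rewrite /phik hgrad_mollify// mxE; apply: mcont.
have mL0 : measurable_fun Om ((fun x => dotv (A x) (hgrad G phi x)) : V -> measurableTypeR R).
  rewrite /dotv; apply: measurable_sum => j; apply: measurable_funM; first exact: mA.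
  by under eq_fun do rewrite mxE; apply: mcont.
have iL : nu.-integrable Om (EFin \o (fun x => \sum_j `|A x ord0 j| * D j)).
  rewrite (_ : _ \o _ = fun x => (\sum_j (`|A x ord0 j| * D j)%:E)%E); last first.
    by apply/funext => x /=; rewrite sumEFin.
  apply: integrable_sum => // j _.
  have := integrableZr mOm (D j) (integrable_norm (iA j)).
  by apply: eq_integrable => // x _ /=; rewrite EFinM.
have aL : {ae nu, forall x, Om x ->
    (fun k => dotv (A x) (hgrad G (phik k) x)) @ \oo --> dotv (A x) (hgrad G phi x) /\
    forall k, (`|dotv (A x) (hgrad G (phik k) x)|%:E <= (\sum_j `|A x ord0 j| * D j)%:E)%E}.
  apply: aeW => x Omx; split.
    rewrite /dotv; apply: cvg_big => [|j _]; first exact: add_continuous.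
    apply: cvgM; first exact: cvg_cst.
    rewrite [X in X @ _](_ : _ = fun k => mollify G (lie_derive (Xf j) phi) (e k) x).
      by rewrite mxE; exact: cvg_mollify.
    by apply/funext => k; rewrite /phik hgrad_mollify// mxE.
  move=> k; rewrite lee_fin /dotv (le_trans (ler_norm_sum _ _ _))// ler_sum// => j _.
  rewrite normrM /phik hgrad_mollify// mxE ler_wpM2l//.
  by apply: mollify_le.
have mR k : measurable_fun Om ((fun x => f x * phik k x) : V -> measurableTypeR R).
  by apply: measurable_funM => //; apply: mcont; exact: cmol.
have mR0 : measurable_fun Om ((fun x => f x * phi x) : V -> measurableTypeR R).
  by apply: measurable_funM => //; exact: mcont.
have iR : nu.-integrable Om (EFin \o (fun x => `|f x| * C)).
  have := integrableZr mOm C (integrable_norm intf).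
  by apply: eq_integrable => // x _ /=; rewrite EFinM.
have aR : {ae nu, forall x, Om x -> (fun k => f x * phik k x) @ \oo --> f x * phi x /\
    forall k, (`|f x * phik k x|%:E <= (`|f x| * C)%:E)%E}.
  apply: aeW => x Omx; split.
    by apply: cvgM; [exact: cvg_cst|exact: cvg_mollify].
  by move=> k; rewrite lee_fin normrM ler_wpM2l//; exact: mollify_le.
have [_ L] := cvg_integral_dominated mOm mL mL0 iL aL.
have [_ L'] := cvg_integral_dominated mOm mR mR0 iR aR.
(* The mollified function is supported in [Om] only for large k, so the two sequences agree only
   eventually. *)
have E : \forall k \near \oo, (\int[nu]_(x in Om) (dotv (A x) (hgrad G (phik k) x))%:E =
     \int[nu]_(x in Om) (f x * phik k x)%:E)%E.
  by apply: filterS (mollify_Coo_c C1phi) => k; exact: weak.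
have L'' := cvg_trans (near_eq_cvg E) L.
exact: (cvg_unique _ (L'' _) L').
Qed.

End C1cFacts.

(** * Inequalities for real powers and the Euclidean norm *)

Section RealPowers.
Context (R : realType).
Implicit Types (x y p : R).

Lemma ler_powR_nneg p x y : 0 <= p -> 0 <= x -> x <= y -> x `^ p <= y `^ p.
Proof.
by move=> p0 x0 xy; apply: ge0_ler_powR => //; rewrite nnegrE// (le_trans x0).
Qed.

Lemma powR_sum_le p x y : 0 <= p -> 0 <= x -> 0 <= y ->
  (x + y) `^ p <= 2 `^ p * (x `^ p + y `^ p).
Proof.
move=> p0 x0 y0.
apply: (@le_trans _ _ ((2 * Num.max x y) `^ p)).
  apply: ler_powR_nneg => //; first exact: addr_ge0.
  by have [xy|yx] := leP x y; lra.
rewrite powRM ?le_max ?x0// ler_wpM2l ?powR_ge0//.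
by have [xy|yx] := leP x y; rewrite ?lerDl ?lerDr powR_ge0.
Qed.

Lemma powR_le1D p x : 0 <= x -> 1 <= p -> x `^ (p - 1) <= x `^ p + 1.
Proof.
move=> x0 p1; have [x1|x1] := leP x 1.
  rewrite (@le_trans _ _ 1)// ?lerDr ?powR_ge0//.
  have E1 : 1 `^ (p - 1) = 1 :> R by rewrite powR1.
  rewrite -[leRHS]E1; apply: ler_powR_nneg => //; lra.
rewrite (@le_trans _ _ (x `^ p))// ?lerDl//; apply: ler_powR; lra.
Qed.

Lemma powRB1_mul_le p x y : 1 < p -> 0 <= x -> 0 <= y ->
  x `^ (p - 1) * y <= x `^ p + y `^ p.
Proof.
move=> p1 x0 y0; have p0 : 0 < p by lra.
have [xy|/ltW yx] := leP x y.
  apply: (@le_trans _ _ (y `^ p)); last by rewrite lerDr powR_ge0.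
  rewrite -(mulr_powRB1 y0 p0) [leRHS]mulrC ler_wpM2r//.
  by apply: ler_powR_nneg => //; lra.
apply: (@le_trans _ _ (x `^ p)); last by rewrite lerDl powR_ge0.
by rewrite -(mulr_powRB1 x0 p0) [leRHS]mulrC ler_wpM2l ?powR_ge0.
Qed.

Lemma powR_cvg0_inv p (T : nat -> R) : 0 < p -> (forall k, 0 <= T k) ->
  T k `^ p @[k --> \oo] --> 0 -> T k @[k --> \oo] --> 0.
Proof.
move=> p0 T0 Tp; apply/cvgr0Pnorm_lt => e e0.
have ep : 0 < e `^ p by exact: powR_gt0.
move/cvgr0Pnorm_lt : Tp => /(_ _ ep).
apply: filterS => k; rewrite !ger0_norm ?powR_ge0// => H.
rewrite ltNge; apply/negP => eT; move: H; rewrite ltNge => /negP; apply.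
by apply: ler_powR_nneg => //; exact: ltW.
Qed.

(** Young's inequality for x^(p-1) and y with the conjugate exponents p/(p-1) and p, multiplied by
    p. *)
Lemma young_powR p x y : 1 < p -> 0 <= x -> 0 <= y ->
  p * (x `^ (p - 1) * y) <= (p - 1) * x `^ p + y `^ p.
Proof.
move=> p1 x0 y0.
have p0 : 0 < p by lra.
have pn0 : p != 0 by rewrite gt_eqF.
have p10 : p - 1 != 0 by rewrite gt_eqF//; lra.
have q0 : 0 < p / (p - 1) by rewrite divr_gt0//; lra.
have conj : (p / (p - 1))^-1 + p^-1 = 1 by field; rewrite p10 pn0.
have := conjugate_powR (powR_ge0 x (p - 1)) y0 q0 p0 conj.
rewrite -powRrM (_ : (p - 1) * (p / (p - 1)) = p); last by field.
move=> /(ler_wpM2l (ltW p0)) /le_trans; apply.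
rewrite le_eqVlt; apply/orP; left; apply/eqP; field; rewrite p10 pn0//.
Qed.

End RealPowers.

Section EuclideanNorm.
Context (R : realType) (n : nat).
Implicit Types (v w : 'rV[R]_n).

Lemma enorm_ge0 v : 0 <= enorm v.
Proof. exact: sqrtr_ge0. Qed.

Lemma enorm_sqr v : enorm v ^+ 2 = \sum_i v ord0 i ^+ 2.
Proof. by rewrite sqr_sqrtr// sumr_ge0// => i _; exact: sqr_ge0. Qed.

Lemma coord_le_enorm v i : `|v ord0 i| <= enorm v.
Proof.
rewrite -(@ler_pXn2r _ 2) ?nnegrE ?enorm_ge0// real_normK ?num_real// enorm_sqr.
by rewrite (bigD1 i)//= lerDl sumr_ge0// => j _; exact: sqr_ge0.
Qed.

Lemma enorm_le_sum v : enorm v <= \sum_i `|v ord0 i|.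
Proof.
have S0 : 0 <= \sum_i `|v ord0 i| by exact: sumr_ge0.
rewrite -(@ler_pXn2r _ 2) ?nnegrE ?enorm_ge0// enorm_sqr expr2 mulr_suml.
apply: ler_sum => i _; rewrite -real_normK ?num_real// expr2 ler_wpM2l//.
by rewrite (bigD1 i)//= lerDl sumr_ge0.
Qed.

Lemma enorm_eq0 v : enorm v = 0 -> v = 0.
Proof.
move=> v0; apply/rowP => i; rewrite mxE; apply/eqP.
by rewrite -normr_le0 -v0 coord_le_enorm.
Qed.

Lemma dotvv v : dotv v v = enorm v ^+ 2.
Proof. by rewrite enorm_sqr; apply: eq_bigr => i _; rewrite expr2. Qed.

Lemma dotv0l w : dotv 0 w = 0 :> R.
Proof. by rewrite /dotv big1// => i _; rewrite mxE mul0r. Qed.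

Lemma dotv0r v : dotv v 0 = 0 :> R.
Proof. by rewrite /dotv big1// => i _; rewrite mxE mulr0. Qed.

Lemma dotvZl (a : R) v w : dotv (a *: v) w = a * dotv v w.
Proof. by rewrite /dotv mulr_sumr; apply: eq_bigr => i _; rewrite mxE mulrA. Qed.

Lemma dotvZr (a : R) v w : dotv v (a *: w) = a * dotv v w.
Proof. by rewrite /dotv mulr_sumr; apply: eq_bigr => i _; rewrite mxE mulrCA. Qed.

Lemma dotvBr v w w' : dotv v (w - w') = dotv v w - dotv v w'.
Proof. by rewrite /dotv -sumrB; apply: eq_bigr => i _; rewrite !mxE mulrBr. Qed.

(** Cauchy-Schwarz: with a = |v| and b = |w|, expanding the sum of (b v_i - a w_i)^2 >= 0 gives 2ab
    (ab - v.w) >= 0. *)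
Lemma dotv_le v w : dotv v w <= enorm v * enorm w.
Proof.
have [v0|v0] := eqVneq (enorm v) 0; first by rewrite (enorm_eq0 v0) dotv0l mulr_ge0 ?enorm_ge0.
have [w0|w0] := eqVneq (enorm w) 0; first by rewrite (enorm_eq0 w0) dotv0r mulr_ge0 ?enorm_ge0.
set a := enorm v in v0 *; set b := enorm w in w0 *.
have a0 : 0 < a by rewrite lt_neqAle eq_sym v0 enorm_ge0.
have b0 : 0 < b by rewrite lt_neqAle eq_sym w0 enorm_ge0.
have ab0 : 0 < 2 * (a * b) by rewrite !mulr_gt0.
have : 0 <= \sum_i (b * v ord0 i - a * w ord0 i) ^+ 2 by rewrite sumr_ge0// => i _; exact: sqr_ge0.
rewrite (_ : \sum_i _ = b ^+ 2 * dotv v v - 2 * (a * b) * dotv v w + a ^+ 2 * dotv w w); last first.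
  rewrite /dotv !mulr_sumr -sumrB -big_split/=; apply: eq_bigr => i _; ring.
rewrite !dotvv -/a -/b => H; rewrite -(ler_pM2l ab0); nra.
Qed.

(** The constant is crude; the bound serves for domination and convergence, where its size is
    irrelevant. *)
Lemma normr_dotv_le v w : `|dotv v w| <= n%:R * (enorm v * enorm w).
Proof.
rewrite (le_trans (ler_norm_sum _ _ _))// (@le_trans _ _ (\sum_(i < n) enorm v * enorm w))//.
  by apply: ler_sum => i _; rewrite normrM ler_pM// coord_le_enorm.
by rewrite sumr_const card_ord mulr_natl.
Qed.

End EuclideanNorm.

(** * Almost everywhere convergent approximation in the completion *)

Section FastSubsequence.
Context (R : realType) (r : nat) (Ns : 'I_r.+1 -> nat).
Variable (G : stratified_group R Ns).
Notation N := (gdim Ns).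
Notation V := 'rV[R]_N.
Notation H := 'rV[R]_(Ns ord0).
Notation nu := (@lebesgue_rV R N).
Notation mR := (measurableTypeR R).
Variable (Om : set V).
Hypothesis oOm : open Om.
Variable p : R.
Hypothesis p1 : 1 < p.

Let mOm : measurable Om. Proof. exact: open_measurable_rV. Qed.
Let p0 : 0 < p. Proof. by rewrite (lt_trans _ p1). Qed.

Lemma measurable_enorm n (f : V -> 'rV[R]_n) :
  (forall i, measurable_fun Om ((fun x => f x ord0 i) : V -> mR)) ->
  measurable_fun Om ((fun x => enorm (f x)) : V -> mR).
Proof.
move=> mf; apply: (@measurableT_comp _ _ _ _ _ _ (@Num.sqrt R : mR -> mR)).
  by apply: continuous_measurable_fun; exact: sqrt_continuous.
by apply: measurable_sum => i; apply: measurable_funX; exact: mf.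
Qed.

Lemma measurable_powR_comp (f : V -> R) (q : R) :
  measurable_fun Om (f : V -> mR) -> measurable_fun Om ((fun x => f x `^ q) : V -> mR).
Proof. by move=> mf; exact: (measurableT_comp (measurable_powR q) mf). Qed.

Lemma Lp_norm_small (f : V -> R) (d : R) : 0 < d ->
  (Lp_norm p Om f < d%:E)%E -> (\int[nu]_(x in Om) (`|f x| `^ p)%:E <= (d `^ p)%:E)%E.
Proof.
move=> d0; rewrite /Lp_norm; set I := (\int[nu]_(x in Om) _)%E => Id.
have I0 : (0 <= I)%E by apply: integral_ge0 => x _; rewrite lee_fin powR_ge0.
rewrite -[leLHS](poweRe1 I0) -(mulVf (lt0r_neq0 p0)) poweRrM -poweR_EFin.
have memb (x : \bar R) : (0 <= x)%E -> x \in `[0%E, +oo%E] by rewrite in_itv/= leey andbT.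
apply: (gt0_ler_poweR (ltW p0)); [exact/memb/poweR_ge0| |exact: ltW].
by apply: memb; rewrite lee_fin ltW.
Qed.

Lemma measurable_C1c_coord phi j : C1c G Om phi ->
  measurable_fun Om ((fun x => hgrad G phi x ord0 j) : V -> mR).
Proof.
move=> C1; apply: (@measurable_funS _ _ _ _ setT) => //.
apply: continuous_measurable_rVT.
under eq_fun do rewrite mxE.
exact: (C1c_continuous_lie_derive oOm C1).
Qed.

Lemma measurable_C1c phi : C1c G Om phi -> measurable_fun Om (phi : V -> mR).
Proof.
move=> [_ cphi _ _]; apply: (@measurable_funS _ _ _ _ setT) => //.
exact: continuous_measurable_rVT.
Qed.

(* [D] is the sum over k of the p-th powers of the errors, along a subsequence
   whose errors are summable. *)
Lemma S0_fast_subsequence u g : S0_1p G p Om u g ->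
  exists (phi : nat -> V -> R) (D : V -> \bar R),
  [/\ forall k, C1c G Om (phi k), nu.-integrable Om D &
    {ae nu, forall x, Om x -> [/\ phi k x @[k --> \oo] --> u x,
       enorm (g x - hgrad G (phi k) x) @[k --> \oo] --> 0 &
       forall k, ((enorm (g x - hgrad G (phi k) x) `^ p)%:E <= D x)%E]}].
Proof.
move=> [mu mg [phi [C1phi _ cu cg]]].
(* Chosen so that d_k^p = 2^-(k+2): the errors of the function and of its gradient together
   contribute 2^-(k+1), and these sum to 1. *)
pose d (k : nat) : R := (1 / (2 ^ (k + 2))%:R) `^ p^-1.
have d0 k : 0 < d k by rewrite powR_gt0// divr_gt0// ltr0n expn_gt0.
have dp k : d k `^ p = 1 / (2 ^ (k + 2))%:R.
  by rewrite /d -powRrM mulVf ?gt_eqF// powRr1// divr_ge0.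
have ex k : exists n, (Lp_norm p Om (fun x => u x - phi n x)%R < (d k)%:E)%E /\
   (Lp_norm p Om (fun x => enorm (g x - hgrad G (phi n) x)%R) < (d k)%:E)%E.
  have near_lt (F : nat -> \bar R) : F n @[n --> \oo] --> 0%E ->
      \forall n \near \oo, (F n < (d k)%:E)%E.
    by move=> F0; have := F0 [set y | (y < (d k)%:E)%E]; apply; apply: open_ereal_lt'; rewrite lte_fin.
  have [n _ Hn] := filterI (near_lt _ cu) (near_lt _ cg).
  by exists n; exact: (Hn n (leqnn n)).
pose n_ k := sval (cid (ex k)).
have n_P k := svalP (cid (ex k)).
pose psi k := phi (n_ k).
have C1psi k : C1c G Om (psi k) by exact: C1phi.
pose T k x : R := `|u x - psi k x| `^ p + enorm (g x - hgrad G (psi k) x) `^ p.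
have T0 k x : 0 <= T k x by rewrite addr_ge0// powR_ge0.
have mg' j : measurable_fun Om ((fun x => g x ord0 j) : V -> mR).
  by apply: (measurableT_comp (@measurable_coord R _ setT j) mg).
have m1 k : measurable_fun Om ((fun x => `|u x - psi k x| `^ p) : V -> mR).
  apply: measurable_powR_comp; apply: measurableT_comp => //.
  by apply: measurable_funB => //; exact: measurable_C1c.
have m2 k : measurable_fun Om ((fun x => enorm (g x - hgrad G (psi k) x) `^ p) : V -> mR).
  apply: measurable_powR_comp; apply: measurable_enorm => j.
  rewrite (_ : (fun x => _) = fun x => g x ord0 j - hgrad G (psi k) x ord0 j).
    by apply: measurable_funB; [exact: mg'|exact: measurable_C1c_coord].
  by apply/funext => x; rewrite !mxE.
have mT k : measurable_fun Om (EFin \o T k).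
  by apply/measurable_EFinP; exact: (measurable_funD (m1 k) (m2 k)).
pose D x := (\sum_(k <oo) (T k x)%:E)%E.
have D0 x : (0 <= D x)%E by apply: nneseries_ge0 => k _ _; rewrite lee_fin.
have mD : measurable_fun Om D.
  apply: ge0_emeasurable_sum; first by move=> k x Dx tt; rewrite lee_fin.
  by move=> k _; exact: mT.
have IT k : (\int[nu]_(x in Om) (T k x)%:E <= (1 / (2 ^ (k + 1))%:R)%:E)%E.
  under eq_integral do rewrite EFinD.
  have e1 x : Om x -> (0 <= (`|u x - psi k x| `^ p)%:E)%E.
    by move=> _; rewrite lee_fin powR_ge0.
  have e2 x : Om x -> (0 <= (enorm (g x - hgrad G (psi k) x) `^ p)%:E)%E.
    by move=> _; rewrite lee_fin powR_ge0.
  have /measurable_EFinP me1 := m1 k; have /measurable_EFinP me2 := m2 k.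
  rewrite (ge0_integralD nu mOm e1 me1 e2 me2).
  have [/(Lp_norm_small (d0 k)) H1 /(Lp_norm_small (d0 k)) H2] := n_P k.
  rewrite dp in H1 H2.
  rewrite (_ : 1 / _ = 1 / (2 ^ (k + 2))%:R + 1 / (2 ^ (k + 2))%:R); last first.
    by rewrite !natrX addn2 addn1 [in RHS]exprS; field; rewrite expf_neq0.
  rewrite EFinD; apply: leeD; first exact: H1.
  apply: le_trans H2; rewrite le_eqVlt; apply/orP; left; apply/eqP.
  by apply: eq_integral => x _; rewrite (ger0_norm (enorm_ge0 _)).
have ID : (\int[nu]_(x in Om) D x < +oo)%E.
  have T0e k x : Om x -> (0 <= (EFin \o T k) x)%E by rewrite lee_fin.
  rewrite (integral_nneseries nu mOm mT T0e).
  apply: (@le_lt_trans _ _ (1 / 2 ^+ 0)%:E); last by rewrite ltry.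
  rewrite -(cvg_lim _ (@cvg_geometric_eseries_half R 1 0))//.
  apply: lee_nneseries => [k _ _|k _]; last exact: IT.
  by apply: integral_ge0 => x Omx; exact: T0e.
have iD : nu.-integrable Om D.
  apply/integrableP; split => //.
  by under eq_integral do rewrite gee0_abs//.
exists psi, D; split => //.
(* [D] is finite almost everywhere, so there the series converges and its terms tend to 0; this
   turns convergence in norm into pointwise convergence. *)
have finD := integrable_ae mOm iD.
apply: filterS finD => x H Omx; have {}H := H Omx.
have Doo : (D x < +oo)%E by rewrite ltey_eq H.
have Tle k : ((T k x)%:E <= D x)%E.
  rewrite /D (@nneseriesD1 R (fun k => (T k x)%:E) k xpredT)//.
    by rewrite leeDl// nneseries_ge0// => i _ _; rewrite lee_fin.
  by move=> i _; rewrite lee_fin.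
have cT : T k x @[k --> \oo] --> 0.
  have tail0 : (\sum_(K <= k <oo) (T k x)%:E)%E @[K --> \oo] --> 0%E.
    by apply: nneseries_tail_cvg => // k _; rewrite lee_fin.
  have cE : (T k x)%:E @[k --> \oo] --> 0%E.
    apply: squeeze_cvge (cvg_cst 0%E) tail0; apply: nearW => k.
    rewrite lee_fin T0/=.
    have := @nneseries_lim_ge R (fun k => (T k x)%:E) xpredT k k.+1.
    by rewrite big_nat1; apply => i _ _; rewrite lee_fin.
  by have /fine_cvgP[] := cE.
split.
- have c1 : `|u x - psi k x| @[k --> \oo] --> 0.
    apply: (powR_cvg0_inv p0) => //.
    apply: squeeze_cvgr (cvg_cst 0) cT.
    by apply: nearW => k; rewrite powR_ge0/= lerDl powR_ge0.
  apply/cvgrPdist_lt => e e0; move/cvgr0Pnorm_lt : c1 => /(_ e e0).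
  by apply: filterS => k; rewrite normr_id.
- apply: (powR_cvg0_inv p0) => [k|]; first exact: enorm_ge0.
  apply: squeeze_cvgr (cvg_cst 0) cT.
  by apply: nearW => k; rewrite powR_ge0/= lerDr powR_ge0.
- by move=> k; apply: le_trans (Tle k); rewrite lee_fin lerDr powR_ge0.
Qed.

End FastSubsequence.

(** * Test functions and Picone's inequality *)

Section TestFunctions.
Context (R : realType) (r : nat) (Ns : 'I_r.+1 -> nat).
Variable (G : stratified_group R Ns).
Notation N := (gdim Ns).
Notation V := 'rV[R]_N.
Notation H := 'rV[R]_(Ns ord0).
Notation nu := (@lebesgue_rV R N).
Notation mR := (measurableTypeR R).
Variable (Om : set V).
Hypothesis oOm : open Om.

Variables (a b c a' b' c' : R -> R).
Hypothesis da : forall s, is_derive s (1 : R) a (a' s).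
Hypothesis db : forall s, is_derive s (1 : R) b (b' s).
Hypothesis dc : forall s, is_derive s (1 : R) c (c' s).
Hypothesis ca' : continuous a'.
Hypothesis cb' : continuous b'.
Hypothesis cc' : continuous c'.
Hypothesis abc0 : a 0 = b 0 * c 0.

Lemma derive_continuous (f f' : R -> R) :
  (forall s, is_derive s (1 : R) f (f' s)) -> continuous f.
Proof.
move=> df s; apply: differentiable_continuous; apply/derivable1_diffP.
by have [] := df s.
Qed.

Let ca : continuous a. Proof. exact: derive_continuous da. Qed.
Let cb : continuous b. Proof. exact: derive_continuous db. Qed.
Let cc : continuous c. Proof. exact: derive_continuous dc. Qed.

(** In the application a = P, b = P^p and c = P^(1-p), where P is the shifted clamp, so this is U -
    V^p U^(1-p). The two coefficients below multiply the gradient of u and minus that of v. *)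
Definition test_fun (u v : V -> R) x := a (u x) - b (v x) * c (u x).
Definition test_coef1 (u v : V -> R) x := a' (u x) - b (v x) * c' (u x).
Definition test_coef2 (u v : V -> R) x := b' (v x) * c (u x).

Lemma test_fun_is_derive (u v : V -> R) x j : C1c G Om u -> C1c G Om v ->
  is_derive (0 : R) (1 : R) (test_fun u v \o flow (Xfield G j) x)
   (test_coef1 u v x * lie_derive (Xfield G j) u x -
    test_coef2 u v x * lie_derive (Xfield G j) v x).
Proof.
move=> C1u C1v.
have du := is_derive_C1c_flow C1u x j 0.
have dv := is_derive_C1c_flow C1v x j 0.
have Da := is_derive_comp1 (da _) du.
have Db := is_derive_comp1 (db _) dv.
have Dc := is_derive_comp1 (dc _) du.
apply: (is_derive_eq (is_deriveB Da (is_deriveM Db Dc))).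
rewrite /= !flow0 /test_coef1 /test_coef2 /GRing.scale/=; ring.
Qed.

Lemma test_fun_hgrad (u v : V -> R) x : C1c G Om u -> C1c G Om v ->
  hgrad G (test_fun u v) x =
  test_coef1 u v x *: hgrad G u x - test_coef2 u v x *: hgrad G v x.
Proof.
move=> C1u C1v; apply/rowP => j; rewrite !mxE.
exact: (@derive_val _ _ _ _ _ _ _ (test_fun_is_derive x j C1u C1v)).
Qed.

Let comp (f : R -> R) (u : V -> R) : continuous f -> continuous u -> continuous (fun x => f (u x)).
Proof. by move=> cf cu x; apply: (@continuous_comp _ _ _ u f); [exact: cu|exact: cf]. Qed.

Let contB (f g : V -> R) : continuous f -> continuous g -> continuous (fun x => f x - g x).
Proof. by move=> cf cg x; apply: continuousB; [exact: cf|exact: cg]. Qed.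

Let contM (f g : V -> R) : continuous f -> continuous g -> continuous (fun x => f x * g x).
Proof. by move=> cf cg x; apply: continuousM; [exact: cf|exact: cg]. Qed.

Lemma test_fun_C1c (u v : V -> R) : C1c G Om u -> C1c G Om v -> C1c G Om (test_fun u v).
Proof.
move=> C1u C1v; have [[Ku KuOm] cu _ _] := C1u; have [[Kv KvOm] cv _ _] := C1v.
(* By [abc0] the test function vanishes wherever u and v both do. *)
have supp : closure [set x | test_fun u v x != 0] `<=`
    closure [set x | u x != 0] `|` closure [set x | v x != 0].
  rewrite -closureU; apply: closure_subset => x /= t0.
  apply: contrapT => /not_orP[/negP/negPn/eqP u0 /negP/negPn/eqP v0].
  by move: t0; rewrite /test_fun u0 v0 abc0 subrr eqxx.
split.
- split; last by apply: subset_trans supp _ => x [/KuOm|/KvOm].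
  exact: subclosed_compact (@closed_closure _ _) (compactU Ku Kv) supp.
- rewrite /test_fun; apply: contB; first exact: comp.
  by apply: contM; exact: comp.
- by move=> x j Omx; have [] := test_fun_is_derive x j C1u C1v.
- apply: continuous_subspaceT => x.
  rewrite (_ : hgrad G (test_fun u v) = fun x => test_coef1 u v x *: hgrad G u x - test_coef2 u v x *: hgrad G v x).
    apply: continuous_row => j; move: x.
    rewrite -/(continuous _) (_ : (fun y => _) = fun y => (a' (u y) - b (v y) * c' (u y)) * lie_derive (Xfield G j) u y -
       (b' (v y) * c (u y)) * lie_derive (Xfield G j) v y).
      apply: contB; apply: contM.
      + by apply: contB; [exact: comp|apply: contM; exact: comp].
      + exact: (C1c_continuous_lie_derive oOm C1u).
      + by apply: contM; exact: comp.
      + exact: (C1c_continuous_lie_derive oOm C1v).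
    by apply/funext => y; rewrite !mxE.
  by apply/funext => y; exact: test_fun_hgrad.
Qed.

Variable p : R.
Hypothesis p1 : 1 < p.
Hypothesis nuOm : (nu Om < +oo)%E.
Let mOm : measurable Om. Proof. exact: open_measurable_rV. Qed.
Let p0 : 0 < p. Proof. by rewrite (lt_trans _ p1). Qed.

Lemma S0_measurable_coord u g j : S0_1p G p Om u g ->
  measurable_fun Om ((fun x => g x ord0 j) : V -> mR).
Proof.
by move=> [_ mg _]; apply: (measurableT_comp (@measurable_coord R _ setT j) mg).
Qed.

(** [g] is compared with the gradient of the first approximant, which is continuous with compact
    support, hence bounded; the p-th power of the error is below [D]. *)
Lemma S0_integrable_grad u g : S0_1p G p Om u g ->
  nu.-integrable Om (EFin \o (fun x => enorm (g x) `^ p)).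
Proof.
move=> Su; have [phi [D [C1phi iD aeD]]] := S0_fast_subsequence oOm p1 Su.
have mg j := S0_measurable_coord j Su.
have cw j : continuous (lie_derive (Xfield G j) (phi 0%N)).
  exact: (C1c_continuous_lie_derive oOm (C1phi 0%N)).
have [[cK _] _ _ _] := C1phi 0%N.
have wB j : exists B, forall y, `|lie_derive (Xfield G j) (phi 0%N) y| <= B.
  by apply: (continuous_vanish_bounded cK (@cw j)) => y; exact: lie_derive_vanish.
pose B := \sum_j sval (cid (wB j)).
have wBj j y : `|lie_derive (Xfield G j) (phi 0%N) y| <= sval (cid (wB j)) by case: cid => /=.
have B0 : 0 <= B by apply: sumr_ge0 => j _; exact: le_trans (normr_ge0 _) (wBj j 0).
pose m : R := (Ns ord0)%:R.
pose W x := ((m `^ p * 2 `^ p)%:E * (D x + (B `^ p)%:E))%E.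
have iW : nu.-integrable Om W.
  apply: integrableZl => //; apply: integrableD => //; exact: cst_integrable.
have mG : measurable_fun Om ((fun x => enorm (g x) `^ p) : V -> mR).
  by apply: measurable_powR_comp; apply: measurable_enorm.
(* Dominated convergence is applied to a constant sequence, for the integrability it yields. *)
suff ae : {ae nu, forall x, Om x ->
    (fun _ : nat => enorm (g x) `^ p) @ \oo --> enorm (g x) `^ p /\
    forall k : nat, (`|enorm (g x) `^ p|%:E <= W x)%E}.
  pose F (_ : nat) (x : V) := enorm (g x) `^ p.
  by have [] := @cvg_integral_dominated _ _ _ _ Om F _ W mOm (fun _ => mG) mG iW ae.
apply: filterS aeD => x HD Omx; split; first exact: cvg_cst.
have [_ _ /(_ 0%N) HD0] := HD Omx.
move=> _; rewrite ger0_norm ?powR_ge0//.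
set e := enorm (g x - hgrad G (phi 0%N) x) in HD0.
have e0 : 0 <= e by exact: enorm_ge0.
have le_g : enorm (g x) <= m * (e + B).
  rewrite (le_trans (enorm_le_sum _))//.
  rewrite (@le_trans _ _ (\sum_(j < Ns ord0) (e + B)))//; last first.
    by rewrite sumr_const card_ord mulr_natl.
  apply: ler_sum => j _.
  have -> : g x ord0 j = (g x - hgrad G (phi 0%N) x) ord0 j + hgrad G (phi 0%N) x ord0 j.
    by rewrite !mxE subrK.
  rewrite (le_trans (ler_normD _ _))// lerD ?coord_le_enorm// mxE.
  by rewrite (le_trans (wBj j x))// /B (bigD1 j)//= lerDl sumr_ge0// => i _; exact: le_trans (normr_ge0 _) (wBj i 0).
apply: (@le_trans _ _ (m `^ p * 2 `^ p * (e `^ p + B `^ p))%:E).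
  rewrite lee_fin (le_trans (ler_powR_nneg (ltW p0) (enorm_ge0 _) le_g))//.
  by rewrite powRM ?ler0n ?addr_ge0// -mulrA ler_wpM2l ?powR_ge0// powR_sum_le ?(ltW p0).
rewrite EFinM /W lee_wpmul2l// ?lee_fin ?mulr_ge0 ?powR_ge0//.
by rewrite EFinD leeD2r.
Qed.

Variable f : V -> R.
Hypothesis intf : nu.-integrable Om (EFin \o f).
Variable B : R.
Hypothesis aB : forall s, `|a s| <= B.
Hypothesis bB : forall s, `|b s| <= B.
Hypothesis cB : forall s, `|c s| <= B.
Hypothesis a'B : forall s, `|a' s| <= B.
Hypothesis b'B : forall s, `|b' s| <= B.
Hypothesis c'B : forall s, `|c' s| <= B.

(** The weight |g|^(p-2) does no harm at g = 0 even for p < 2: a negative power of 0 is 0 by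
    convention. *)
Lemma flux_dotv_le (g w : H) :
  `|enorm g `^ (p - 2) * dotv g w| <= (Ns ord0)%:R * (enorm g `^ (p - 1) * enorm w).
Proof.
rewrite normrM ger0_norm ?powR_ge0//.
rewrite (le_trans (ler_wpM2l (powR_ge0 _ _) (normr_dotv_le _ _)))//.
have p10 : 0 < p - 1 by rewrite subr_gt0.
rewrite -(mulr_powRB1 (enorm_ge0 g) p10) (_ : p - 1 - 1 = p - 2); last by ring.
by rewrite le_eqVlt; apply/orP; left; apply/eqP; ring.
Qed.

Lemma flux_integrable u g j : S0_1p G p Om u g ->
  nu.-integrable Om (EFin \o (fun x => (enorm (g x) `^ (p - 2) *: g x) ord0 j)).
Proof.
move=> Su; have ig := S0_integrable_grad Su; have mg i := S0_measurable_coord i Su.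
have i1 : nu.-integrable Om (EFin \o (fun x => enorm (g x) `^ p + 1)).
  have := integrableD mOm ig (cst_integrable 1 mOm nuOm).
  by apply: eq_integrable => // x _; rewrite /= EFinD.
apply: le_integrable i1 => //.
- apply/measurable_EFinP; under eq_fun do rewrite mxE.
  by apply: measurable_funM; [apply: measurable_powR_comp; exact: measurable_enorm|exact: mg].
- move=> x _ /=; rewrite lee_fin [leRHS]ger0_norm ?addr_ge0 ?powR_ge0//.
  rewrite mxE normrM ger0_norm ?powR_ge0//.
  apply: (@le_trans _ _ (enorm (g x) `^ (p - 1))); last by apply: powR_le1D; rewrite ?enorm_ge0 ?ltW.
  have p10 : 0 < p - 1 by rewrite subr_gt0.
  rewrite -(mulr_powRB1 (enorm_ge0 (g x)) p10) (_ : p - 1 - 1 = p - 2); last by ring.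
  by rewrite mulrC ler_wpM2r ?powR_ge0// coord_le_enorm.
Qed.

(** Only the test function is approximated: [test_fun (phi k) (psi k)] is admissible by
    [weak_form_C1c], the flux of [g] stays fixed, and dominated convergence gives the limit. *)
Lemma weak_form_tested u g v h :
  S0_1p G p Om u g -> S0_1p G p Om v h ->
  (forall phi, Coo_c Om phi ->
    (\int[nu]_(x in Om) (enorm (g x) `^ (p - 2) * dotv (g x) (hgrad G phi x))%:E =
     \int[nu]_(x in Om) (f x * phi x)%:E)%E) ->
  let flux w x := enorm (g x) `^ (p - 2) * dotv (g x) w in
  let L x := test_coef1 u v x * flux (g x) x - test_coef2 u v x * flux (h x) x in
  let M x := f x * test_fun u v x in
  [/\ nu.-integrable Om (EFin \o L), nu.-integrable Om (EFin \o M) &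
      (\int[nu]_(x in Om) (L x)%:E = \int[nu]_(x in Om) (M x)%:E)%E].
Proof.
move=> Su Sv weak flux L M.
have [phi [Du [C1phi iDu aeu]]] := S0_fast_subsequence oOm p1 Su.
have [psi [Dv [C1psi iDv aev]]] := S0_fast_subsequence oOm p1 Sv.
have ig := S0_integrable_grad Su; have ih := S0_integrable_grad Sv.
have mg j := S0_measurable_coord j Su; have mh j := S0_measurable_coord j Sv.
have [mu _ _] := Su; have [mv _ _] := Sv.
have weakC : forall phi, C1c G Om phi ->
    (\int[nu]_(x in Om) (enorm (g x) `^ (p - 2) * dotv (g x) (hgrad G phi x))%:E =
     \int[nu]_(x in Om) (f x * phi x)%:E)%E.
  have := @weak_form_C1c R r Ns G Om oOm (fun x => enorm (g x) `^ (p - 2) *: g x) f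
    (fun j => flux_integrable j Su) intf _.
  move=> K phi0 C1; have := K _ phi0 C1.
  under eq_integral do rewrite dotvZl.
  by apply => phi1 C1phi1; under eq_integral do rewrite dotvZl; exact: weak.
have mf : measurable_fun Om (f : V -> mR) by have /integrableP[/measurable_EFinP] := intf.
have mcomp (F : R -> R) (w : V -> R) : continuous F -> measurable_fun Om (w : V -> mR) ->
    measurable_fun Om ((fun x => F (w x)) : V -> mR).
  by move=> cF mw; apply: (measurableT_comp _ mw); exact: continuous_measurable_fun.
have mflux (w : V -> H) : (forall j, measurable_fun Om ((fun x => w x ord0 j) : V -> mR)) ->
    measurable_fun Om ((fun x => flux (w x) x) : V -> mR).
  move=> mw; apply: measurable_funM; first by apply: measurable_powR_comp; exact: measurable_enorm.
  by apply: measurable_sum => j; apply: measurable_funM; [exact: mg|exact: mw].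
have mt1 (w z : V -> R) : measurable_fun Om (w : V -> mR) -> measurable_fun Om (z : V -> mR) ->
    measurable_fun Om (test_coef1 w z : V -> mR).
  move=> mw mz; apply: measurable_funB; first exact: mcomp.
  by apply: measurable_funM; exact: mcomp.
have mt2 (w z : V -> R) : measurable_fun Om (w : V -> mR) -> measurable_fun Om (z : V -> mR) ->
    measurable_fun Om (test_coef2 w z : V -> mR).
  by move=> mw mz; apply: measurable_funM; exact: mcomp.
have mt (w z : V -> R) : measurable_fun Om (w : V -> mR) -> measurable_fun Om (z : V -> mR) ->
    measurable_fun Om (test_fun w z : V -> mR).
  move=> mw mz; apply: measurable_funB; first exact: mcomp.
  by apply: measurable_funM; exact: mcomp.
have mphi k := measurable_C1c (C1phi k).
have mpsi k := measurable_C1c (C1psi k).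
pose L_ k x := test_coef1 (phi k) (psi k) x * flux (hgrad G (phi k) x) x -
  test_coef2 (phi k) (psi k) x * flux (hgrad G (psi k) x) x.
pose M_ k x := f x * test_fun (phi k) (psi k) x.
have mL_ k : measurable_fun Om (L_ k : V -> mR).
  apply: measurable_funB; apply: measurable_funM.
  - exact: mt1.
  - by apply: mflux => j; exact: (measurable_C1c_coord oOm).
  - exact: mt2.
  - by apply: mflux => j; exact: (measurable_C1c_coord oOm).
have mL : measurable_fun Om (L : V -> mR).
  apply: measurable_funB; apply: measurable_funM.
  - exact: mt1.
  - exact: mflux.
  - exact: mt2.
  - exact: mflux.
have mM_ k : measurable_fun Om (M_ k : V -> mR) by apply: measurable_funM => //; exact: mt.
have mM : measurable_fun Om (M : V -> mR) by apply: measurable_funM => //; exact: mt.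
have B0 : 0 <= B := le_trans (normr_ge0 _) (aB 0).
(* A common bound for a - b c, a' - b c' and b' c. *)
pose C := B + B * B.
have C0 : 0 <= C by rewrite addr_ge0// mulr_ge0.
have t1C w z x : `|test_coef1 w z x| <= C.
  by rewrite (le_trans (ler_normB _ _))// lerD// normrM ler_pM.
have t2C w z x : `|test_coef2 w z x| <= C.
  by rewrite normrM (@le_trans _ _ (B * B))// ?ler_pM// lerDr.
have tC w z x : `|test_fun w z x| <= C.
  by rewrite (le_trans (ler_normB _ _))// lerD// normrM ler_pM.
pose n : R := (Ns ord0)%:R.
have n0 : 0 <= n by exact: ler0n.
pose gp x := enorm (g x) `^ p.
pose hp x := enorm (h x) `^ p.
(* [bound] gives n (3 |g|^p + error) for the gradient of [phi k] and n (2 |g|^p + |h|^p + error) for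
   that of [psi k]; the 5 is 3 + 2. *)
pose W x := ((C * n)%:E * ((5 * gp x + hp x)%:E + (Du x + Dv x)))%E.
have iW : nu.-integrable Om W.
  apply: integrableZl => //; apply: integrableD => //; last exact: integrableD.
  have i4 : nu.-integrable Om (fun x => 5%:E * (gp x)%:E)%E by exact: integrableZl.
  have := integrableD mOm i4 ih.
  by apply: eq_integrable => // x _; rewrite /= EFinD EFinM.
have aeL : {ae nu, forall x, Om x -> L_ k x @[k --> \oo] --> L x /\
    forall k, (`|L_ k x|%:E <= W x)%E}.
  apply: filterS2 aeu aev => x Hu Hv Omx.
  have [cu cgu Dgu] := Hu Omx; have [cv cgv Dgv] := Hv Omx.
  have cflux (w : nat -> H) (w0 : H) : enorm (w0 - w k) @[k --> \oo] --> 0 ->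
      flux (w k) x @[k --> \oo] --> flux w0 x.
    move=> cw; apply/cvgrPdist_le => e e0.
    pose K := n * enorm (g x) `^ (p - 1) + 1.
    have K0 : 0 < K by rewrite ltr_pwDr// mulr_ge0// powR_ge0.
    have : \forall k \near \oo, `|enorm (w0 - w k)| <= e / K.
      by move/cvgr0Pnorm_le : cw; apply; rewrite divr_gt0.
    apply: filterS => k; rewrite ger0_norm ?enorm_ge0// ler_pdivlMr// => Hk.
    rewrite -mulrBr -dotvBr (le_trans (flux_dotv_le _ _))// (le_trans _ Hk)//.
    rewrite /K mulrDr mulr1 mulrA mulrC lerDl enorm_ge0//.
  have cc1 F (w : nat -> R) w0 : continuous F -> w k @[k --> \oo] --> w0 ->
      F (w k) @[k --> \oo] --> F w0.
    by move=> cF cw; apply: (@cvg_comp _ _ _ w F _ _ _ cw); exact: cF.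
  split.
    apply: cvgB; apply: cvgM.
    - by apply: cvgB; [exact: cc1|apply: cvgM; exact: cc1].
    - exact: cflux.
    - by apply: cvgM; exact: cc1.
    - exact: cflux.
  move=> k.
  have bound (w z : H) : `|flux z x| <= n * (enorm (g x) `^ p + enorm w `^ p) +
      n * (enorm (g x) `^ p + enorm (w - z) `^ p).
    have -> : flux z x = flux w x - flux (w - z) x.
      by rewrite /flux -mulrBr -dotvBr subKr.
    rewrite (le_trans (ler_normB _ _))// lerD// (le_trans (flux_dotv_le _ _))// ler_wpM2l//;
      by apply: powRB1_mul_le => //; exact: enorm_ge0.
  have bu := bound (g x) (hgrad G (phi k) x).
  have bv := bound (h x) (hgrad G (psi k) x).
  set eu := enorm (g x - hgrad G (phi k) x) `^ p in bu.
  set ev := enorm (h x - hgrad G (psi k) x) `^ p in bv.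
  have bL : `|L_ k x| <= C * n * ((5 * gp x + hp x) + (eu + ev)).
    have H1 := ler_pM (normr_ge0 _) (normr_ge0 _) (t1C (phi k) (psi k) x) bu.
    have H2 := ler_pM (normr_ge0 _) (normr_ge0 _) (t2C (phi k) (psi k) x) bv.
    have H3 := lerD H1 H2; rewrite -!normrM in H3.
    apply: (le_trans (ler_normB _ _)); apply: (le_trans H3).
    by rewrite le_eqVlt; apply/orP; left; apply/eqP; rewrite /gp /hp; ring.
  apply: (@le_trans _ _ (C * n * ((5 * gp x + hp x) + (eu + ev)))%:E).
    by rewrite lee_fin.
  rewrite EFinM /W; apply: lee_wpmul2l; first by rewrite lee_fin mulr_ge0.
  rewrite EFinD; apply: leeD => //; rewrite EFinD.
  by apply: leeD; [exact: Dgu|exact: Dgv].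
have aeM : {ae nu, forall x, Om x -> M_ k x @[k --> \oo] --> M x /\
    forall k, (`|M_ k x|%:E <= (`|f x| * C)%:E)%E}.
  apply: filterS2 aeu aev => x Hu Hv Omx.
  have [cu _ _] := Hu Omx; have [cv _ _] := Hv Omx.
  have cc1 F (w : nat -> R) w0 : continuous F -> w k @[k --> \oo] --> w0 ->
      F (w k) @[k --> \oo] --> F w0.
    by move=> cF cw; apply: (@cvg_comp _ _ _ w F _ _ _ cw); exact: cF.
  split; last by move=> k; rewrite lee_fin normrM ler_wpM2l.
  apply: cvgM; first exact: cvg_cst.
  by apply: cvgB; [exact: cc1|apply: cvgM; exact: cc1].
have iM : nu.-integrable Om (EFin \o (fun x => `|f x| * C)).
  have := integrableZr mOm C (integrable_norm intf).
  by apply: eq_integrable => // x _ /=; rewrite EFinM.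
have [iL cL] := cvg_integral_dominated mOm mL_ mL iW aeL.
have [iM' cM] := cvg_integral_dominated mOm mM_ mM iM aeM.
split => //.
have E : (fun k => \int[nu]_(x in Om) (L_ k x)%:E)%E = (fun k => \int[nu]_(x in Om) (M_ k x)%:E)%E.
  apply/funext => k; rewrite -(weakC _ (test_fun_C1c (C1phi k) (C1psi k))).
  apply: eq_integral => x _; congr EFin.
  by rewrite (test_fun_hgrad x (C1phi k) (C1psi k)) dotvBr !dotvZr /L_ /flux; ring.
rewrite E in cL; exact: (cvg_unique _ cL cM).
Qed.

End TestFunctions.

Section Clamp.
Context (R : realType).

(* [chi + e] stays above [e / 2], so its powers are bounded and C^1; [chi] is an
   antiderivative of a piecewise linear cut-off [q]. *)
Lemma clamp_ex (e M : R) : 0 < e -> 0 < M -> exists chi q : R -> R,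
  [/\ continuous q, forall s, is_derive s (1 : R) chi (q s),
      forall s, - e / 2 <= chi s <= M + 1, forall s, 0 <= q s <= 1
    & forall s, 0 <= s <= M -> chi s = s /\ q s = 1].
Proof.
move=> e0 M0.
(* Equal to 1 on [0, M], with linear ramps to 0 on [-e/2, 0] and [M, M + 1]. As q lies in [0, 1],
   its antiderivative is nondecreasing, falls by at most e/2 below 0 and rises by at most 1 above
   M. *)
pose q t : R := Num.max 0 (Num.min 1 (Num.min (1 + 2 / e * t) (M + 1 - t))).
have cq : continuous q.
  have cmax (f : R -> R) (k : R) : continuous f -> continuous (fun t => Num.max k (f t)).
    by move=> cf t; apply: (@continuous_max _ _ (cst k) f); [exact: cst_continuous|exact: cf].
  have cmin (f g : R -> R) : continuous f -> continuous g -> continuous (fun t => Num.min (f t) (g t)).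
    by move=> cf cg t; apply: (@continuous_min _ _ f g); [exact: cf|exact: cg].
  have cid' : continuous (fun t : R => t) by move=> t A; exact.
  apply: cmax; apply: (cmin (cst 1)); first exact: cst_continuous.
  apply: cmin.
    move=> t; apply: cvgD; first exact: cvg_cst.
    by apply: cvgM; [exact: cvg_cst|exact: cvg_id].
  by move=> t; apply: cvgB; [exact: cvg_cst|exact: cvg_id].
have q01 t : 0 <= q t <= 1.
  by rewrite /q le_max lexx/= ge_max ler01/= ge_min lexx.
have q1 t : 0 <= t <= M -> q t = 1.
  move=> /andP[t0 tM]; rewrite /q.
  have et : 0 <= 2 / e * t by rewrite mulr_ge0// divr_ge0// ltW.
  have H : 1 <= Num.min (1 + 2 / e * t) (M + 1 - t) by rewrite le_min; apply/andP; split; lra.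
  by rewrite (min_idPl H); apply/max_idPr.
have q0l t : t <= - e / 2 -> q t = 0.
  move=> te; apply/max_idPl; rewrite !ge_min; apply/orP; right; apply/orP; left.
  have : 2 / e * t <= 2 / e * (- e / 2) by rewrite ler_wpM2l// divr_ge0// ltW.
  have -> : 2 / e * (- e / 2) = -1 by field; rewrite gt_eqF.
  by move=> ?; lra.
have q0r t : M + 1 <= t -> q t = 0.
  move=> te; apply/max_idPl; rewrite !ge_min; apply/orP; right; apply/orP; right; lra.
have [chi [chi0 dchi]] := antiderivative_ex cq.
have cchi : continuous chi.
  move=> t; apply: differentiable_continuous; apply/derivable1_diffP.
  by have [] := dchi t.
have mvt x y : x < y -> exists2 c, x < c < y & chi y - chi x = q c * (y - x).
  move=> xy; have [|c] := @MVT R chi q x y xy (fun s _ => dchi s).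
    exact: continuous_subspaceT.
  by rewrite in_itv/= => cxy E; exists c.
have chi_id s : 0 <= s <= M -> chi s = s.
  move=> /andP[s0 sM]; have [->//|sn0] := eqVneq s 0.
  have sp : 0 < s by rewrite lt_neqAle eq_sym sn0.
  have [c /andP[c0 cs]] := mvt _ _ sp; rewrite chi0 q1; first by lra.
  by apply/andP; split; lra.
have mono x y : x <= y -> chi x <= chi y.
  rewrite le_eqVlt => /predU1P[->//|xy]; have [c _ E] := mvt _ _ xy.
  by have /andP[qc _] := q01 c; rewrite -subr_ge0 E mulr_ge0// subr_ge0 ltW.
have lip x y : x < y -> chi y - chi x <= y - x.
  move=> xy; have [c _ ->] := mvt _ _ xy; have /andP[_ qc] := q01 c.
  by rewrite ler_piMl// subr_ge0 ltW.
exists chi, q; split => // s; last by move=> sM; split; [exact: chi_id|exact: q1].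
apply/andP; split.
- have [s1|s1] := leP (- e / 2) s.
    apply: le_trans (mono _ _ s1).
    have en : - e / 2 < 0 by lra.
    by have := lip _ _ en; rewrite chi0; lra.
  have [c /andP[_ c2]] := mvt _ _ s1; rewrite q0l ?mul0r; last exact: ltW.
  have en : - e / 2 < 0 by lra.
  by have := lip _ _ en; rewrite chi0; lra.
- have MM : chi M = M by apply: chi_id; rewrite ltW//=.
  have M1 : M < M + 1 by lra.
  have := lip _ _ M1; have [s1|s1] := leP s (M + 1); first by have := mono _ _ s1; lra.
  have [c /andP[c1 _]] := mvt _ _ s1; rewrite q0r ?mul0r; last exact: ltW.
  by lra.
Qed.

(** Young's inequality for rho x and y with rho = V / U, where x and y stand for the lengths of the
    two gradients and d for their scalar product. The left-hand side is antisymmetric, so it cancels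
    when the roles are exchanged and the two inequalities added. *)
Lemma picone_powR (p x y d U V : R) : 1 < p -> 0 <= x -> 0 <= y -> d <= x * y ->
  0 < U -> 0 < V ->
  x `^ p - y `^ p <= (1 + (p - 1) * (V `^ p * U `^ (- p))) * (x `^ (p - 2) * x ^+ 2)
    - p * (V `^ (p - 1) * U `^ (1 - p)) * (x `^ (p - 2) * d).
Proof.
move=> p1 x0 y0 dxy U0 V0.
have p0 : 0 < p by lra.
have p10 : 0 < p - 1 by lra.
pose rho := V / U.
have rho0 : 0 <= rho by rewrite divr_ge0// ltW.
have powdiv s : rho `^ s = V `^ s * U `^ (- s).
  by rewrite /rho powRM ?invr_ge0 ?ltW// -powR_inv1 ?ltW// -powRrM mulN1r.
have x1 : x * x `^ (p - 2) = x `^ (p - 1).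
  by rewrite -(mulr_powRB1 x0 p10); congr (_ * _ `^ _); ring.
have x2 : x `^ (p - 2) * x ^+ 2 = x `^ p.
  rewrite (_ : _ * _ = x * (x * x `^ (p - 2))); last by ring.
  by rewrite x1 mulr_powRB1.
rewrite x2 -powdiv (_ : 1 - p = - (p - 1)); last by ring.
rewrite -powdiv.
have Y := young_powR p1 (mulr_ge0 rho0 x0) y0.
rewrite !(powRM _ rho0 x0) in Y.
have D : rho `^ (p - 1) * (x `^ (p - 2) * d) <= rho `^ (p - 1) * x `^ (p - 1) * y.
  rewrite -mulrA ler_wpM2l ?powR_ge0// -x1.
  have -> : x * x `^ (p - 2) * y = x `^ (p - 2) * (x * y) by ring.
  by rewrite ler_wpM2l// powR_ge0.
have D' := le_trans (ler_wpM2l (ltW p0) D) Y.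
rewrite (_ : (1 + _) * _ = x `^ p + (p - 1) * (rho `^ p * x `^ p)); last by ring.
rewrite -[p * rho `^ _ * _]mulrA.
by move: D'; set s := p * _; set t := (p - 1) * _ => D'; lra.
Qed.

(** A power is monotone, in a direction that depends on the sign of the exponent; the sum of the two
    end values covers both cases. *)
Lemma powR_between (e l K x : R) : 0 < l -> l <= x <= K -> x `^ e <= l `^ e + K `^ e.
Proof.
move=> l0 /andP[lx xK]; have [e0|e0] := leP 0 e.
  apply: (@le_trans _ _ (K `^ e)); last by rewrite lerDr powR_ge0.
  by apply: ler_powR_nneg => //; lra.
apply: (@le_trans _ _ (l `^ e)); last by rewrite lerDl powR_ge0.
have x0 : 0 < x by exact: lt_le_trans lx.
have N z : z `^ e = (z `^ (- e))^-1 by rewrite -powRN opprK.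
rewrite !N lef_pV2 ?posrE ?powR_gt0//.
by apply: ler_powR_nneg => //; lra.
Qed.

End Clamp.

(** * Comparison of two solutions and uniqueness *)

Section Uniqueness.
Context (R : realType) (r : nat) (Ns : 'I_r.+1 -> nat).
Variable (G : stratified_group R Ns).
Notation N := (gdim Ns).
Notation V := 'rV[R]_N.
Notation nu := (@lebesgue_rV R N).
Notation mR := (measurableTypeR R).
Variables (Om : set V) (p : R).
Hypothesis oOm : open Om.
Hypothesis nuOm : (nu Om < +oo)%E.
Hypothesis p1 : 1 < p.
Let mOm : measurable Om. Proof. exact: open_measurable_rV. Qed.

(* [T] is only equal almost everywhere to the displayed expression because it is
   built with the clamped [u] and [v]. *)
Lemma picone_integral (u v : V -> R) g h (fu fv : V -> R) (M e : R) :
  S0_1p G p Om u g -> S0_1p G p Om v h ->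
  nu.-integrable Om (EFin \o fu) -> nu.-integrable Om (EFin \o fv) ->
  (forall phi, Coo_c Om phi ->
    (\int[nu]_(x in Om) (enorm (g x) `^ (p - 2) * dotv (g x) (hgrad G phi x))%:E =
     \int[nu]_(x in Om) (fu x * phi x)%:E)%E) ->
  (forall phi, Coo_c Om phi ->
    (\int[nu]_(x in Om) (enorm (h x) `^ (p - 2) * dotv (h x) (hgrad G phi x))%:E =
     \int[nu]_(x in Om) (fv x * phi x)%:E)%E) ->
  0 < M -> {ae nu, forall x, Om x -> (0 < u x <= M) /\ (0 < v x <= M)} -> 0 < e ->
  exists T : V -> R, [/\ nu.-integrable Om (EFin \o T),
    (0 <= \int[nu]_(x in Om) (T x)%:E)%E &
    {ae nu, forall x, Om x -> T x =
      fu x * ((u x + e) - (v x + e) `^ p * (u x + e) `^ (1 - p)) +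
      fv x * ((v x + e) - (u x + e) `^ p * (v x + e) `^ (1 - p))}].
Proof.
move=> Su Sv ifu ifv wu wv M0 aeM e0.
have p0 : 0 < p by exact: lt_trans ltr01 p1.
have p1' : (1 : R) < p := p1.
have [chi [q [cq dchi chiB q01 chi_id]]] := clamp_ex e0 M0.
pose P s := chi s + e.
pose K := M + 1 + e.
pose l := e / 2.
have l0 : 0 < l by rewrite divr_gt0.
have Pb s : l <= P s <= K.
  have /andP[H1 H2] := chiB s; rewrite /P /l /K; apply/andP; split; lra.
have P0 s : 0 < P s by have /andP[H _] := Pb s; exact: lt_le_trans H.
have dP s : is_derive s (1 : R) P (q s).
  rewrite -[X in is_derive _ _ _ X]addr0.
  exact: is_deriveD (dchi s) (is_derive_cst e s (1 : R)).
have dPow k s : is_derive s (1 : R) (fun s => P s `^ k) (k * P s `^ (k - 1) * q s).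
  exact: (is_derive_comp1 (is_derive1_powR k (P0 s)) (dP s)).
have cPow k : continuous (fun s => P s `^ k) := derive_continuous (dPow k).
have cPow' k : continuous (fun s => k * P s `^ (k - 1) * q s).
  move=> s; apply: cvgM; last exact: cq.
  by apply: cvgM; [exact: cvg_cst|exact: cPow].
have abc0 : P 0 = P 0 `^ p * P 0 `^ (1 - p).
  rewrite -powRD ?(addrC p) ?subrK ?powRr1// ?(ltW (P0 0))//.
  by rewrite (gt_eqF (P0 0)) implybT.
pose Bd k := l `^ k + K `^ k.
have BdP k s : P s `^ k <= Bd k by exact: powR_between.
have Bd0 k : 0 <= Bd k by rewrite addr_ge0// powR_ge0.
(* One bound for P, P^p, P^(1-p) and their derivatives, as [weak_form_tested] asks. Since |1 - p| <=
   p, the factor p serves for both derivatives of powers. *)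
pose B := 1 + K + Bd p + Bd (1 - p) + p * Bd (p - 1) + p * Bd (1 - p - 1).
have K0 : 0 <= K by rewrite /K; lra.
have pB k : 0 <= p * Bd k by rewrite mulr_ge0// ltW.
have Bp := Bd0 p; have B1p := Bd0 (1 - p); have Bp1 := pB (p - 1); have B1p1 := pB (1 - p - 1).
have aB s : `|P s| <= B.
  have /andP[_ H] := Pb s; rewrite gtr0_norm// /B; lra.
have bB s : `|P s `^ p| <= B by rewrite ger0_norm ?powR_ge0//; have := BdP p s; rewrite /B; lra.
have cB s : `|P s `^ (1 - p)| <= B.
  by rewrite ger0_norm ?powR_ge0//; have := BdP (1 - p) s; rewrite /B; lra.
have a'B s : `|q s| <= B by have /andP[q0 q1] := q01 s; rewrite ger0_norm// /B; lra.
have qB k x : `|k| <= p -> 0 <= x -> forall s, `|k * x * q s| <= p * x.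
  move=> kp x0 s; have /andP[q0 q1] := q01 s.
  rewrite !normrM (ger0_norm x0) (ger0_norm q0) -[leRHS]mulr1 ler_pM ?mulr_ge0//.
  by rewrite ler_wpM2r.
have b'B s : `|p * P s `^ (p - 1) * q s| <= B.
  have := @qB p (P s `^ (p - 1)) _ (powR_ge0 _ _) s.
  rewrite gtr0_norm// => /(_ (lexx _)) H.
  have := ler_wpM2l (ltW p0) (BdP (p - 1) s); rewrite /B; lra.
have c'B s : `|(1 - p) * P s `^ (1 - p - 1) * q s| <= B.
  have kp : `|1 - p| <= p by rewrite ltr0_norm; lra.
  have H := @qB (1 - p) (P s `^ (1 - p - 1)) kp (powR_ge0 _ _) s.
  have := ler_wpM2l (ltW p0) (BdP (1 - p - 1) s); rewrite /B; lra.
have [iL1 iM1 E1] := @weak_form_tested R r Ns G Om oOm _ _ _ _ _ _ dP (dPow p) (dPow (1 - p))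
  cq (cPow' p) (cPow' (1 - p)) abc0 p p1 nuOm fu ifu B aB bB cB a'B b'B c'B u g v h Su Sv wu.
have [iL2 iM2 E2] := @weak_form_tested R r Ns G Om oOm _ _ _ _ _ _ dP (dPow p) (dPow (1 - p))
  cq (cPow' p) (cPow' (1 - p)) abc0 p p1 nuOm fv ifv B aB bB cB a'B b'B c'B v h u g Sv Su wv.
set L1 := (fun x => _ - _) in iL1 E1.
set M1 := (fun x => _ * _) in iM1 E1.
set L2 := (fun x => _ - _) in iL2 E2.
set M2 := (fun x => _ * _) in iM2 E2.
exists (fun x => M1 x + M2 x); split.
- have := integrableD mOm iM1 iM2.
  by apply: eq_integrable => // x _; rewrite /= EFinD.
- under eq_integral do rewrite EFinD.
  have -> : (\int[nu]_(x in Om) ((M1 x)%:E + (M2 x)%:E) =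
      \int[nu]_(x in Om) (M1 x)%:E + \int[nu]_(x in Om) (M2 x)%:E)%E.
    exact: (integralD_EFin mOm iM1 iM2).
  rewrite -E1 -E2.
  have -> : (\int[nu]_(x in Om) (L1 x)%:E + \int[nu]_(x in Om) (L2 x)%:E =
      \int[nu]_(x in Om) ((L1 x)%:E + (L2 x)%:E))%E.
    exact/esym/(integralD_EFin mOm iL1 iL2).
  have iL : nu.-integrable Om (fun x => ((L1 x)%:E + (L2 x)%:E)%E) := integrableD mOm iL1 iL2.
  have mL : measurable_fun Om (fun x => ((L1 x)%:E + (L2 x)%:E)%E) by case/integrableP : iL.
  (* Where u and v lie in (0, M] the clamp has slope 1, so [L1] and [L2] are two instances of
     [picone_powR] with the roles exchanged. *)
  have pos : {ae nu, forall x, Om x -> 0 <= L1 x + L2 x}.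
    apply: filterS aeM => x H Omx; have [/andP[u0 uM] /andP[v0 vM]] := H Omx.
    have uI : 0 <= u x <= M by rewrite ltW.
    have vI : 0 <= v x <= M by rewrite ltW.
    have [chiu qu] := chi_id _ uI; have [chiv qv] := chi_id _ vI.
    have U0 := P0 (u x); have V0 := P0 (v x).
    have pw : 1 - p - 1 = - p by ring.
    have P1 := picone_powR p1 (enorm_ge0 (g x)) (enorm_ge0 (h x)) (dotv_le (g x) (h x)) U0 V0.
    have P2 := picone_powR p1 (enorm_ge0 (h x)) (enorm_ge0 (g x)) (dotv_le (h x) (g x)) V0 U0.
    have EL1 : L1 x = (1 + (p - 1) * (P (v x) `^ p * P (u x) `^ (- p))) *
        (enorm (g x) `^ (p - 2) * enorm (g x) ^+ 2) - p * (P (v x) `^ (p - 1) * P (u x) `^ (1 - p)) *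
        (enorm (g x) `^ (p - 2) * dotv (g x) (h x)).
      by rewrite /L1 /test_coef1 /test_coef2 qu qv pw dotvv; ring.
    have EL2 : L2 x = (1 + (p - 1) * (P (u x) `^ p * P (v x) `^ (- p))) *
        (enorm (h x) `^ (p - 2) * enorm (h x) ^+ 2) - p * (P (u x) `^ (p - 1) * P (v x) `^ (1 - p)) *
        (enorm (h x) `^ (p - 2) * dotv (h x) (g x)).
      by rewrite /L2 /test_coef1 /test_coef2 qu qv pw dotvv; ring.
    by rewrite EL1 EL2; have := lerD P1 P2; rewrite addrA subrK subrr.
  have mabs : measurable_fun Om (fun x => `|(L1 x)%:E + (L2 x)%:E|%E) by exact: measurableT_comp.
  (* Nonnegativity is known almost everywhere only; the absolute value is nonnegative everywhere and
     has the same integral. *)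
  rewrite (@ae_eq_integral _ _ _ nu Om (fun x => `|(L1 x)%:E + (L2 x)%:E|%E)) //.
    by apply: integral_ge0 => x _; exact: abse_ge0.
  apply: filterS pos => x H Omx; rewrite -EFinD /= ger0_norm//; exact: H.
- apply: filterS aeM => x H Omx; have [/andP[u0 uM] /andP[v0 vM]] := H Omx.
  have uI : 0 <= u x <= M by rewrite ltW.
  have vI : 0 <= v x <= M by rewrite ltW.
  have [chiu qu] := chi_id _ uI; have [chiv qv] := chi_id _ vI.
  by rewrite /M1 /M2 /test_fun /P chiu chiv.
Qed.

End Uniqueness.

(* Fatou's lemma for C - T_k, together with 0 <= \int T_k, gives
   \int (C - T) <= C mu(D), hence \int (- T) <= 0. *)
Lemma reverse_fatou_eq0 d (X : measurableType d) (R : realType)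
    (mu : {measure set X -> \bar R}) (D : set X) (T_ : nat -> X -> R) (T : X -> R) (C : R) :
  measurable D -> (mu D < +oo)%E -> 0 <= C ->
  (forall k, mu.-integrable D (EFin \o T_ k)) ->
  (forall k, 0 <= \int[mu]_(x in D) (T_ k x)%:E)%E ->
  measurable_fun D (T : X -> measurableTypeR R) ->
  {ae mu, forall x, D x -> [/\ forall k, T_ k x <= C, T_ ^~ x @ \oo --> T x & T x <= 0]} ->
  {ae mu, forall x, D x -> T x = 0}.
Proof.
move=> mD Doo C0 iT T0 mT aeT.
(* [C - T_k] is nonnegative only almost everywhere; its absolute value satisfies the pointwise
   hypothesis of Fatou's lemma. *)
pose J k x := `|(C - T_ k x)%:E|%E.
have iC : mu.-integrable D (EFin \o (fun=> C)).
  apply: measurable_bounded_integrable => //; exists C; split; first exact: num_real.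
  by move=> M CM x Dx /=; rewrite ger0_norm// ltW.
have iCT k : mu.-integrable D (fun x => (C - T_ k x)%:E).
  have := integrableB mD iC (iT k).
  by apply: eq_integrable => // x _; rewrite /= EFinB.
have mCT k : measurable_fun D (fun x => (C - T_ k x)%:E) by case/integrableP : (iCT k).
have mJ k : measurable_fun D (J k) by exact: measurableT_comp.
have J0 k x : D x -> (0 <= J k x)%E by rewrite abse_ge0.
have intC : (\int[mu]_(x in D) C%:E = C%:E * mu D)%E by rewrite integral_cst.
have intJ k : (\int[mu]_(x in D) J k x <= C%:E * mu D)%E.
  rewrite (@ae_eq_integral _ _ _ mu D (fun x => (C - T_ k x)%:E))//.
    under eq_integral do rewrite EFinB.
    rewrite (integralB_EFin mD iC (iT k)) intC.
    by rewrite -[leRHS]sube0 leeB.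
  apply: filterS aeT => x H Dx; have [TC _ _] := H Dx.
  by rewrite /J abse_EFin ger0_norm ?subr_ge0.
have FJ := le_trans (fatou mu mD mJ J0).
have mnT : measurable_fun D (fun x => `|(T x)%:E|%E).
  by apply: measurableT_comp => //; exact/measurable_EFinP.
have mL : measurable_fun D (fun x => limn_einf (J ^~ x)).
  rewrite /limn_einf; apply: measurableT_comp => //.
  apply: measurable_fun_limn_esup => k.
  by apply: measurableT_comp.
(* The limit [T] is nonpositive, so C - T = C + |T|; cancelling the finite C mu(D) then leaves the
   integral of |T|. *)
have EL : (\int[mu]_(x in D) limn_einf (J ^~ x) =
    \int[mu]_(x in D) (C%:E + `|(T x)%:E|))%E.
  apply: ae_eq_integral => //; first exact: emeasurable_funD.
  apply: filterS aeT => x H Dx; have [TC TT Tx0] := H Dx.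
  have cv : J ^~ x @ \oo --> (C%:E + `|(T x)%:E|)%E.
    rewrite abse_EFin ler0_norm// -EFinD.
    have -> : J ^~ x = fun k => (C - T_ k x)%:E.
      by apply/funext => k; rewrite /J abse_EFin ger0_norm ?subr_ge0.
    apply: cvg_EFin; first exact: nearW.
    by apply: cvgB; [exact: cvg_cst|exact: TT].
  by rewrite (cvg_limn_einf_sup cv).1.
have limJ : (limn_einf (fun k => \int[mu]_(x in D) J k x) <= C%:E * mu D)%E.
  rewrite limn_einf_lim; apply: lime_le; first exact: is_cvg_einfs.
  apply: nearW => k; apply: le_trans (intJ k).
  by apply: ereal_inf_lbound; exists k => /=.
have := FJ _ limJ.
rewrite EL ge0_integralD//.
rewrite intC -[leRHS]adde0 leeD2lE; last first.
  by rewrite fin_numM// ge0_fin_numE.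
move=> le0.
have : (\int[mu]_(x in D) `|(T x)%:E| = 0)%E.
  by apply/eqP; rewrite eq_le le0/= integral_ge0// => x _; exact: abse_ge0.
have mTE : measurable_fun D (fun x => (T x)%:E) by exact/measurable_EFinP.
move/(ae_eq_integral_abs mu mD mTE); apply: filterS => x H Dx.
by have [] := H Dx.
Qed.

Section PiconeLimit.
Context (R : realType).
Implicit Types (p a b s t : R).

Lemma cvg_powR_shift s (k : R) (e_ : nat -> R) : 0 < s -> e_ @ \oo --> (0 : R) ->
  (s + e_ i) `^ k @[i --> \oo] --> s `^ k.
Proof.
move=> s0 e0.
have c : {for s, continuous (fun x : R => x `^ k)}.
  apply: differentiable_continuous; apply/derivable1_diffP.
  by have [] := is_derive1_powR k s0.
have se : (fun i => s + e_ i) @ \oo --> s.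
  by rewrite -[X in _ --> X]addr0; apply: cvgD => //; exact: cvg_cst.
exact: (cvg_comp _ _ se c).
Qed.

(** The limiting integrand factors, with s^(1-p) = 1 / s^(p-1) and s^p = s s^(p-1); monotonicity of
    the quotient gives the two factors opposite signs. *)
Lemma picone_rhsE p a b s t : 0 < s -> 0 < t ->
  a * (s - t `^ p * s `^ (1 - p)) + b * (t - s `^ p * t `^ (1 - p)) =
  (a / s `^ (p - 1) - b / t `^ (p - 1)) * (s `^ p - t `^ p).
Proof.
move=> s0 t0.
have inv1 z : 0 < z -> z `^ (1 - p) = (z `^ (p - 1))^-1.
  by move=> z0; rewrite -powRN opprB.
have pw z : 0 < z -> z `^ p = z * z `^ (p - 1).
  by move=> z0; rewrite -{2}(powRr1 (ltW z0)) -powRD ?(gt_eqF z0) ?implybT//; congr (_ `^ _); ring.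
rewrite !inv1// !pw//.
have s1 : s `^ (p - 1) != 0 by rewrite gt_eqF ?powR_gt0.
have t1 : t `^ (p - 1) != 0 by rewrite gt_eqF ?powR_gt0.
by field; rewrite s1 t1.
Qed.

Lemma picone_rhs_lt0 p a b s t : 0 < p -> 0 < s -> s < t ->
  b / t `^ (p - 1) < a / s `^ (p - 1) ->
  a * (s - t `^ p * s `^ (1 - p)) + b * (t - s `^ p * t `^ (1 - p)) < 0.
Proof.
move=> p0 s0 st ab; rewrite picone_rhsE//; last exact: lt_trans st.
rewrite pmulr_rlt0 ?subr_gt0// subr_lt0.
by apply: gt0_ltr_powR => //; rewrite nnegrE ltW// (lt_trans s0).
Qed.

End PiconeLimit.

Theorem theorem3p7 (R : realType) (r : nat) (Ns : 'I_r.+1 -> nat)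
  (G : stratified_group R Ns) (p : R) (Om : set 'rV[R]_(gdim Ns))
  (F : 'rV[R]_(gdim Ns) -> R -> R)
  (hp : 1 < p <= (homogeneous_dim Ns)%:R)
  (hOm : admissible_domain Om)
  (Fpos : forall x rho, Om x -> 0 < F x rho)
  (Fbnd : exists M : R, forall x rho, Om x -> `|F x rho| <= M)
  (Fmeas : measurable_fun (Om `*` [set: measurableTypeR R])
    (fun z : 'rV[R]_(gdim Ns) * measurableTypeR R =>
       (F z.1 z.2 : measurableTypeR R)))
  (Fgrowth : exists C : R, 0 < C /\
    {ae @lebesgue_rV R (gdim Ns), forall x, Om x -> forall rho, 0 < rho ->
       F x rho <= C * (rho `^ (p - 1) + 1)})
  (Fdecr : {ae @lebesgue_rV R (gdim Ns), forall x, Om x ->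
     forall rho sigma, 0 < rho -> rho < sigma ->
       F x sigma / sigma `^ (p - 1) < F x rho / rho `^ (p - 1)})
  (u v : 'rV[R]_(gdim Ns) -> R) :
  positive_weak_solution G p Om F u ->
  positive_weak_solution G p Om F v ->
  {ae @lebesgue_rV R (gdim Ns), forall x, Om x -> u x = v x}.
Proof.
move=> [[[mu [Mu uM]] [g [Su wu]]] u0] [[[mv [Mv vM]] [h [Sv wv]]] v0].
have [oOm bOm _ _] := hOm; have /andP[p1 _] := hp.
have p0 : 0 < p := lt_trans ltr01 p1.
have mOm : measurable Om by exact: open_measurable_rV.
have nuOm : (@lebesgue_rV R (gdim Ns) Om < +oo)%E.
  by have [M0 _ OmM0] := bounded_sub_box bOm; exact: nu_sub_box OmM0.
have [BF' FB'] := Fbnd; pose BF := Num.max BF' 0.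
have BF0 : 0 <= BF by rewrite le_max lexx orbT.
have FB x s : Om x -> `|F x s| <= BF.
  by move=> Omx; rewrite (le_trans (FB' _ s Omx))// le_max lexx.
pose M := Num.max (Num.max Mu Mv) 1.
have M0 : 0 < M by rewrite lt_max ltr01 orbT.
have aeM : {ae @lebesgue_rV R (gdim Ns), forall x, Om x -> 0 < u x <= M /\ 0 < v x <= M}.
  apply: filterS3 u0 v0 (filterI uM vM) => x hu hv [hMu hMv] Omx.
  rewrite hu// hv// !le_max !(le_trans (ler_norm _) (hMu Omx)).
  by rewrite !(le_trans (ler_norm _) (hMv Omx)) ?orbT.
have mFw w : measurable_fun Om (w : _ -> measurableTypeR R) ->
    measurable_fun Om ((fun x => F x (w x)) : _ -> measurableTypeR R).
  move=> mw.
  apply: (measurable_comp _ _ Fmeas (g := fun x => (x, w x : measurableTypeR R))).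
  - exact: measurableX.
  - by move=> _ [x Omx <-].
  (* [w] is extended by 0 outside [Om], so that its graph map is measurable on the whole space
     before being restricted. *)
  - have mw' : measurable_fun setT ((w \_ Om) : _ -> measurableTypeR R).
      exact/(measurable_restrictT _ mOm).
    apply: (eq_measurable_fun (fun x => (x, (w \_ Om) x : measurableTypeR R))).
      by move=> x Omx; rewrite patchE Omx.
    exact/(measurable_funS measurableT (subsetT _))/measurable_fun_pair.
have iFw w : measurable_fun Om (w : _ -> measurableTypeR R) ->
    (@lebesgue_rV R (gdim Ns)).-integrable Om (EFin \o (fun x => F x (w x))).
  by move=> mw; apply: (bounded_integrable mOm nuOm (mFw _ mw)) => x Omx; exact: FB.
pose fu x := F x (u x); pose fv x := F x (v x).
have e0 k : 0 < k.+1%:R^-1 :> R by rewrite invr_gt0.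
have ex k := picone_integral oOm nuOm p1 Su Sv (iFw _ mu) (iFw _ mv) wu wv M0 aeM (e0 k).
have [T_ T_P] := choice ex.
pose I x := fu x * (u x - v x `^ p * u x `^ (1 - p)) + fv x * (v x - u x `^ p * v x `^ (1 - p)).
(* Since e = 1/(k+1) <= 1, both u + e and v + e are at most M + 1. The subtracted terms are
   nonnegative because F is positive, so they are dropped; the 2 counts the two summands. *)
pose C := 2 * (BF * (M + 1)).
have C0 : 0 <= C by rewrite !mulr_ge0// addr_ge0// ltW.
have mI : measurable_fun Om (I : _ -> measurableTypeR R).
  have mpow w k : measurable_fun Om (w : _ -> measurableTypeR R) ->
      measurable_fun Om ((fun x => w x `^ k) : _ -> measurableTypeR R).
    by move=> mw; exact: (measurableT_comp (measurable_powR k) mw).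
  apply: measurable_funD; apply: measurable_funM; try exact: mFw;
    by apply: measurable_funB => //; apply: measurable_funM; exact: mpow.
(* If u x and v x differ, strict monotonicity makes the limiting integrand strictly negative. *)
have sgn x : Om x -> 0 < u x -> 0 < v x ->
    (forall rho sigma, 0 < rho -> rho < sigma ->
       F x sigma / sigma `^ (p - 1) < F x rho / rho `^ (p - 1)) ->
    I x <= 0 /\ (I x = 0 -> u x = v x).
  move=> Omx ux vx dec; rewrite /I.
  have [uv|vu|->] := ltgtP (u x) (v x).
  - have := picone_rhs_lt0 p0 ux uv (dec _ _ ux uv).
    by move=> I0; split; [exact: ltW|move=> E; rewrite E ltxx in I0].
  - have := picone_rhs_lt0 p0 vx vu (dec _ _ vx vu); rewrite addrC.
    by move=> I0; split; [exact: ltW|move=> E; rewrite E ltxx in I0].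
  - by rewrite picone_rhsE// subrr mulr0.
have aeT : {ae @lebesgue_rV R (gdim Ns), forall x, Om x -> forall k, T_ k x =
      fu x * ((u x + k.+1%:R^-1) - (v x + k.+1%:R^-1) `^ p * (u x + k.+1%:R^-1) `^ (1 - p)) +
      fv x * ((v x + k.+1%:R^-1) - (u x + k.+1%:R^-1) `^ p * (v x + k.+1%:R^-1) `^ (1 - p))}.
  (* The exceptional null set of [T_ k] depends on k; a countable union gives a single one for all
     k. *)
  have : {ae @lebesgue_rV R (gdim Ns), forall x k, Om x -> T_ k x =
      fu x * ((u x + k.+1%:R^-1) - (v x + k.+1%:R^-1) `^ p * (u x + k.+1%:R^-1) `^ (1 - p)) +
      fv x * ((v x + k.+1%:R^-1) - (u x + k.+1%:R^-1) `^ p * (v x + k.+1%:R^-1) `^ (1 - p))}.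
    by apply/ae_foralln => k; have [] := T_P k.
  by apply: filterS => x H Omx k; exact: H.
have I0 : {ae @lebesgue_rV R (gdim Ns), forall x, Om x -> I x = 0}.
  apply: (@reverse_fatou_eq0 _ _ _ _ Om T_ I C mOm nuOm C0).
  - by move=> k; have [] := T_P k.
  - by move=> k; have [] := T_P k.
  - exact: mI.
  apply: filterS3 aeT aeM Fdecr => x HT HM Hd Omx.
  have [/andP[ux uMx] /andP[vx vMx]] := HM Omx; split.
  - move=> k; rewrite HT//.
    have e1 : k.+1%:R^-1 <= 1 :> R by rewrite invf_le1// ler1n.
    have bd f s q : 0 <= f <= BF -> 0 < s <= M -> 0 <= q -> f * (s + k.+1%:R^-1 - q) <= BF * (M + 1).
      move=> /andP[f0 fB] /andP[s0 sM] q0.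
      apply: (@le_trans _ _ (f * (M + 1)));
        first by rewrite ler_wpM2l// -addrA lerD// lerBlDr (le_trans e1)// lerDl.
      by rewrite ler_wpM2r// addr_ge0// ltW.
    have Fb s : 0 <= F x s <= BF.
      by rewrite ltW ?Fpos//= (le_trans (ler_norm _) (FB _ _ Omx)).
    rewrite /C mulr_natl mulr2n lerD// bd ?ux ?vx ?mulr_ge0 ?powR_ge0//; exact: Fb.
  - rewrite (_ : T_ ^~ x = fun k => fu x * ((u x + k.+1%:R^-1) -
        (v x + k.+1%:R^-1) `^ p * (u x + k.+1%:R^-1) `^ (1 - p)) +
      fv x * ((v x + k.+1%:R^-1) - (u x + k.+1%:R^-1) `^ p * (v x + k.+1%:R^-1) `^ (1 - p)));
      last by apply/funext => k; exact: HT.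
    have ce : (fun k => k.+1%:R^-1 : R) @ \oo --> (0 : R) by exact: cvg_harmonic.
    have csh (s : R) : s + k.+1%:R^-1 @[k --> \oo] --> (s : R).
      by rewrite -[X in _ --> X]addr0; apply: cvgD => //; exact: cvg_cst.
    apply: cvgD; (apply: cvgM; first exact: cvg_cst);
      (apply: cvgB; first exact: csh); apply: cvgM; exact: cvg_powR_shift.
  - by have [] := sgn _ Omx ux vx (Hd Omx).
apply: filterS3 I0 aeM Fdecr => x H0 HM Hd Omx.
have [/andP[ux _] /andP[vx _]] := HM Omx.
by have [_] := sgn _ Omx ux vx (Hd Omx); apply; exact: H0.
Qed.
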